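(* Let $(M,K)$ be a Cartan space. The triple of connections $(\overline{\nabla}^{\prime\prime*},\overline{\nabla}^{\prime*},\overline{\nabla})$ on $V_{C^*}$, $H(T^*M_0)$ and $\{C^*\}^\perp$, respectively, is a triple of basic connections adapted to the subfoliation $(\mathcal{F}_V,\mathcal{F}_{C^*})$ of $(T^*M_0,G)$.
   Context: Summation convention is used; indices run from $1$ to $n$. $M$ is an $n$-dimensional $C^\infty$ manifold, $(x^i)$ local coordinates on $M$, $(x^i,p_i)$ the induced local coordinates on $T^*M$, and $T^*M_0=T^*M-\{\text{zero section}\}$. A Cartan structure on $M$ is a function $K:T^*M\to[0,\infty)$ such that (i) $K$ is $C^\infty$ on $T^*M_0$; (ii) $K(x,\lambda p)=\lambda K(x,p)$ for all $\lambda>0$; (iii) the matrix $(g^{ij})$, $g^{ij}=\frac12\frac{\partial^2K^2}{\partial p_i\partial p_j}$, is positive definite at all points of $T^*M_0$. (In fact $K(x,p)>0$ for $p\neq 0$.) The pair $(M,K)$ is a Cartan space. The inverse matrix of $(g^{ij})$ is $(g_{ij})$, and $p^i=\frac12\frac{\partial K^2}{\partial p_i}=g^{ij}p_j$. The canonical nonlinear connection has coefficients $N_{ij}=\gamma^0_{ij}-\frac12\gamma^0_{h0}\frac{\partial g_{ij}}{\partial p_h}$, where $\gamma^i_{jk}=\frac12g^{is}\left(\frac{\partial g_{js}}{\partial x^k}+\frac{\partial g_{sk}}{\partial x^j}-\frac{\partial g_{jk}}{\partial x^s}\right)$, $\gamma^0_{jk}=\gamma^i_{jk}p_i$, $\gamma^0_{j0}=\gamma^i_{jk}p_ip^k$;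 the $N_{ij}$ are symmetric and positively homogeneous of degree $1$ in the momenta. The horizontal distribution $H(T^*M_0)$ is locally spanned by $\frac{\delta}{\delta x^i}=\frac{\partial}{\partial x^i}+N_{ij}\frac{\partial}{\partial p_j}$, and the vertical distribution $V(T^*M_0)$ (kernel of the differential of the projection to $M$) by $\frac{\partial}{\partial p_i}$; the dual coframe is $\{dx^i,\delta p_i=dp_i-N_{ji}dx^j\}$. The Riemannian metric on $T^*M_0$ is $G=g_{ij}dx^i\otimes dx^j+g^{ij}\delta p_i\otimes\delta p_j$. $C^*=p_i\frac{\partial}{\partial p_i}$ is the vertical Liouville-Hamilton vector field, $\{C^*\}$ the line distribution it spans, $V_{C^*}$ the $G$-orthogonal complement of $\{C^*\}$ in $V(T^*M_0)$ (an integrable distribution, defining a foliation $\mathcal{F}_{V_{C^*}}$), and $\{C^*\}^\perp=H(T^*M_0)\oplus V_{C^*}$ the $G$-orthogonal complement of $\{C^*\}$ in $T(T^*M_0)$. The vertical foliation $\mathcal{F}_V$ (tangent distribution $V(T^*M_0)$) and the line foliation $\mathcal{F}_{C^*}$ (tangent distribution $\{C^*\}$) form an $(n,2n-1)$-codimensional subfoliation $(\mathcal{F}_V,\mathcal{F}_{C^*})$ of $T^*M_0$. Via $G$, $V(T^*M_0)/\{C^*\}\cong V_{C^*}$, the normal bundle of $\mathcal{F}_V$ is $H(T^*M_0)$ and the normal bundle of $\mathcal{F}_{C^*}$ is $\{C^*\}^\perp$. Let $\pi_0:V(T^*M_0)\to V_{C^*}$, $\pi_1:T(T^*M_0)\to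 H(T^*M_0)$, $\pi_2:T(T^*M_0)\to\{C^*\}^\perp$ be the orthogonal projections. A connection $D^1$ on $V_{C^*}$ is basic with respect to $(\mathcal{F}_V,\mathcal{F}_{C^*})$ if $D^1_XZ=\pi_0[X,\widetilde Z]$ for all $X\in\Gamma(\{C^*\})$, $\widetilde Z\in\Gamma(V(T^*M_0))$ with $\pi_0(\widetilde Z)=Z$. A connection $D^2$ on $H(T^*M_0)$ is basic with respect to $\mathcal{F}_V$ if $D^2_XY=\pi_1[X,\widetilde Y]$ for all $X\in\Gamma(V(T^*M_0))$, $\widetilde Y\in\Gamma(T(T^*M_0))$ with $\pi_1(\widetilde Y)=Y$. A connection $D$ on $\{C^*\}^\perp$ is basic with respect to $\mathcal{F}_{C^*}$ if $D_XY=\pi_2[X,\widetilde Y]$ for all $X\in\Gamma(\{C^*\})$, $\widetilde Y\in\Gamma(T(T^*M_0))$ with $\pi_2(\widetilde Y)=Y$. A triple $(D^1,D^2,D)$ of basic connections, on $V_{C^*}$ (with respect to $(\mathcal{F}_V,\mathcal{F}_{C^*})$), on $H(T^*M_0)$ (with respect to $\mathcal{F}_V$) and on $\{C^*\}^\perp$ (with respect to $\mathcal{F}_{C^*}$) respectively, is called adapted to the subfoliation $(\mathcal{F}_V,\mathcal{F}_{C^*})$. For a Riemannian foliated manifold $(M,g,\mathcal{F})$ with structural distribution $D=T\mathcal{F}$ and transversal distribution $D^\perp$ (orthogonal complement), with projections $\mathcal{D},\mathcal{D}^\perp$ onto $D,D^\perp$ and Levi-Civita connection $\nabla$, the Vrănceanu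 connection is $$\nabla^*_XY=\mathcal{D}\nabla_{\mathcal{D}X}\mathcal{D}Y+\mathcal{D}^\perp\nabla_{\mathcal{D}^\perp X}\mathcal{D}^\perp Y+\mathcal{D}[\mathcal{D}^\perp X,\mathcal{D}Y]+\mathcal{D}^\perp[\mathcal{D}X,\mathcal{D}^\perp Y].$$ Let $\nabla^{\prime*}$ be the Vrănceanu connection of $(T^*M_0,G,\mathcal{F}_V)$ (structural distribution $V(T^*M_0)$, transversal $H(T^*M_0)$) and $\nabla^{\prime\prime*}$ that of $(T^*M_0,G,\mathcal{F}_{V_{C^*}})$ (structural distribution $V_{C^*}$, transversal $\{C^*\}\oplus H(T^*M_0)$). $\overline{\nabla}^{\prime*}$ is the restriction of $\nabla^{\prime*}$ to $\Gamma(T(T^*M_0))\times\Gamma(H(T^*M_0))$, a connection on $H(T^*M_0)$; $\overline{\nabla}^{\prime\prime*}$ is the restriction of $\nabla^{\prime\prime*}$ to $\Gamma(T(T^*M_0))\times\Gamma(V_{C^*})$, a connection on $V_{C^*}$; and $\overline{\nabla}$ is the connection on $\{C^*\}^\perp$ given by $\overline{\nabla}_XZ=\overline{\nabla}^{\prime*}_XZ^h+\overline{\nabla}^{\prime\prime*}_XZ'$ for $X\in\Gamma(T(T^*M_0))$ and $Z=Z^h+Z'$ with $Z^h\in\Gamma(H(T^*M_0))$, $Z'\in\Gamma(V_{C^*})$. *)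

(* Defs.v *)
From HB Require Import structures.
From mathcomp Require Import all_boot all_order all_algebra.
From mathcomp Require Import all_classical all_reals all_analysis.

Set Implicit Arguments.
Unset Strict Implicit.
Unset Printing Implicit Defensive.

Import Order.TTheory GRing.Theory Num.Theory.
Import numFieldNormedType.Exports.

Local Open Scope classical_set_scope.
Local Open Scope ring_scope.

(* f is of class C^k on the open set U; its values outside U are irrelevant. *)
Fixpoint class_C (R : realType) (V W : normedModType R) (k : nat) (U : set V)
    (f : V -> W) : Prop :=
  match k with
  | 0%N => forall x, U x -> {for x, continuous f}
  | k'.+1 => (forall x, U x -> differentiable f x) /\
             (forall v, class_C k' U (fun x => 'D_v f x))
  end.

Definition smooth (R : realType) (V W : normedModType R) (U : set V)
  (f : V -> W) : Prop := forall k, class_C k U f.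

(* The bare data of an atlas with values in R^m.  The underlying point set of
   the manifold is the union [pts] of the chart domains, which may be a proper
   subset of T.  Every point u has a preferred chart [chart_at u]; it is used
   to write tangent and cotangent vectors at u as elements of R^m. *)
Record atlas (R : realType) (m : nat) (T : Type) := Atlas {
  chart : Type;
  chart_dom : chart -> set T;
  chart_map : chart -> T -> 'rV[R]_m;
  chart_inv : chart -> 'rV[R]_m -> T;
  chart_at : T -> chart
}.

Section AtlasCalculus.
Context {R : realType} {m : nat} {T : Type}.
Variable A : atlas R m T.

Definition pts : set T := [set u | exists c : chart A, chart_dom c u].

Definition chart_codom (c : chart A) : set 'rV[R]_m :=
  chart_map c @` chart_dom c.

Definition coords_at (u : T) : 'rV[R]_m := chart_map (chart_at A u) u.

Definition smooth_fun (f : T -> R) : Prop :=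
  forall c : chart A, smooth (chart_codom c) (f \o chart_inv c : 'rV[R]_m -> R).

(* X u is the row of components of X at u in the chart [chart_at u]. *)
Definition vfield := T -> 'rV[R]_m.

(* components of X in the chart c, as a function of the coordinates z *)
Definition local_rep (c : chart A) (X : vfield) (z : 'rV[R]_m) : 'rV[R]_m :=
  let u := chart_inv c z in
  'D_(X u) (chart_map c \o chart_inv (chart_at A u)) (coords_at u).

Definition smooth_vfield (X : vfield) : Prop :=
  forall c : chart A, smooth (chart_codom c) (local_rep c X).

Definition vact (X : vfield) (f : T -> R) (u : T) : R :=
  'D_(X u) (f \o chart_inv (chart_at A u) : 'rV[R]_m -> R) (coords_at u).

(* [X, Y]^a = X^b d_b Y^a - Y^b d_b X^a, computed in the chart [chart_at u] *)
Definition lie_bracket (X Y : vfield) : vfield := fun u =>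
  let c := chart_at A u in
  'D_(X u) (local_rep c Y) (coords_at u) -
  'D_(Y u) (local_rep c X) (coords_at u).

Definition vf_add (X Y : vfield) : vfield := fun u => X u + Y u.
Definition vf_scale (f : T -> R) (X : vfield) : vfield := fun u => f u *: X u.
Definition vf_eq (X Y : vfield) : Prop := forall u, pts u -> X u = Y u.

(* E u is a set of tangent vectors at u *)
Definition distribution := T -> set 'rV[R]_m.

Definition full_distr : distribution := fun _ => setT.

Definition section (E : distribution) (X : vfield) : Prop :=
  smooth_vfield X /\ forall u, pts u -> E u (X u).

Definition tensor2 := T -> 'rV[R]_m -> 'rV[R]_m -> R.

Definition orth_compl (G : tensor2) (E : distribution) : distribution :=
  fun u => [set v | forall e, E u e -> G u v e = 0].

(* [orth_proj G E X] is the pointwise G-orthogonal projection of X onto E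
   (the default value 0 is not used when G is definite and E is a field of
   linear subspaces). *)
Definition orth_proj (G : tensor2) (E : distribution) (X : vfield) : vfield :=
  fun u => xget 0
    [set w | E u w /\ forall e, E u e -> G u (X u - w) e = 0].

Definition connection_on (E : distribution) (D : vfield -> vfield -> vfield) :
    Prop :=
  [/\ forall X Z, section full_distr X -> section E Z -> section E (D X Z),
      forall X Y Z, section full_distr X -> section full_distr Y ->
        section E Z -> vf_eq (D (vf_add X Y) Z) (vf_add (D X Z) (D Y Z)),
      forall f X Z, smooth_fun f -> section full_distr X -> section E Z ->
        vf_eq (D (vf_scale f X) Z) (vf_scale f (D X Z)),
      forall X Z W, section full_distr X -> section E Z -> section E W ->
        vf_eq (D X (vf_add Z W)) (vf_add (D X Z) (D X W)) &
      forall f X Z, smooth_fun f -> section full_distr X -> section E Z ->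
        vf_eq (D X (vf_scale f Z))
              (vf_add (vf_scale (vact X f) Z) (vf_scale f (D X Z)))].

Definition levi_civita (G : tensor2) (nabla : vfield -> vfield -> vfield) :
    Prop :=
  [/\ connection_on full_distr nabla,
      forall X Y, section full_distr X -> section full_distr Y ->
        forall u, pts u -> nabla X Y u - nabla Y X u = lie_bracket X Y u &
      forall X Y Z, section full_distr X -> section full_distr Y ->
        section full_distr Z -> forall u, pts u ->
        vact X (fun w => G w (Y w) (Z w)) u =
          G u (nabla X Y u) (Z u) + G u (Y u) (nabla X Z u)].

(* Vranceanu connection of the foliation with structural distribution E *)
Definition vranceanu (G : tensor2) (nabla : vfield -> vfield -> vfield)
    (E : distribution) (X Y : vfield) : vfield :=
  let P := orth_proj G E in
  let Q := orth_proj G (orth_compl G E) in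
  vf_add (vf_add (P (nabla (P X) (P Y))) (Q (nabla (Q X) (Q Y))))
         (vf_add (P (lie_bracket (Q X) (P Y))) (Q (lie_bracket (P X) (Q Y)))).

(* D is a connection on E and D_X Y = pi [X, Y~] for X in L and every section
   Y~ of B with pi Y~ = Y, where pi is the orthogonal projection onto E. *)
Definition basic_connection (G : tensor2) (B L E : distribution)
    (D : vfield -> vfield -> vfield) : Prop :=
  connection_on E D /\
  forall X Y Yt, section L X -> section E Y -> section B Yt ->
    vf_eq (orth_proj G E Yt) Y ->
    vf_eq (D X Y) (orth_proj G E (lie_bracket X Yt)).

End AtlasCalculus.

Record manifold (R : realType) (n : nat) := Manifold {
  mfd_space :> topologicalType;
  mfd_atlas : atlas R n mfd_space;
  mfd_hausdorff : hausdorff_space mfd_space;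
  mfd_second_countable : @second_countable mfd_space;
  mfd_dom_open : forall c : chart mfd_atlas, open (chart_dom c);
  mfd_codom_open : forall c : chart mfd_atlas, open (chart_codom c);
  mfd_mapK : forall (c : chart mfd_atlas) x, chart_dom c x ->
    chart_inv c (chart_map c x) = x;
  mfd_map_continuous : forall (c : chart mfd_atlas) x, chart_dom c x ->
    {for x, continuous (chart_map c)};
  mfd_inv_continuous : forall (c : chart mfd_atlas) a, chart_codom c a ->
    {for a, continuous (chart_inv c)};
  mfd_chart_at : forall x, chart_dom (chart_at mfd_atlas x) x;
  mfd_transition : forall c d : chart mfd_atlas,
    smooth (chart_map c @` (chart_dom c `&` chart_dom d))
           (chart_map d \o chart_inv c)
}.

Section Cotangent.
Context {R : realType} {n : nat}.
Variable M : manifold R n.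
Let A := mfd_atlas M.

(* (x, p) is the covector p_i dx^i at x, where x^i are the coordinates of the
   chart [chart_at x]. *)
Definition cotangent := (M * 'rV[R]_n)%type.

(* If q is the row of components in the chart d of a covector at the point with
   c-coordinates a, this is the row of its components in the chart c:
   i-th entry = q_j * (d x_d^j / d x_c^i) (a). *)
Definition covec_change (c d : chart A) (a q : 'rV[R]_n) : 'rV[R]_n :=
  q *m (jacobian (chart_map d \o chart_inv c) a)^T.

Definition cotangent_map (c : chart A) (u : cotangent) : 'rV[R]_(n + n) :=
  let a := chart_map c u.1 in
  row_mx a (covec_change c (chart_at A u.1) a u.2).

Definition cotangent_inv (c : chart A) (z : 'rV[R]_(n + n)) : cotangent :=
  let x := chart_inv c (lsubmx z) in
  (x, covec_change (chart_at A x) c (coords_at A x) (rsubmx z)).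

(* The slit cotangent bundle T^*M_0 with its induced charts (x^i, p_i). *)
Definition slit_cotangent : atlas R (n + n) cotangent := {|
  chart := chart A;
  chart_dom := fun c => [set u | chart_dom c u.1 /\ u.2 != 0];
  chart_map := cotangent_map;
  chart_inv := cotangent_inv;
  chart_at := fun u => chart_at A u.1
|}.

Definition d_x (i : 'I_n) (f : 'rV[R]_(n + n) -> R) (z : 'rV[R]_(n + n)) : R :=
  'D_(row_mx (delta_mx 0 i) 0) f z.

Definition d_p (i : 'I_n) (f : 'rV[R]_(n + n) -> R) (z : 'rV[R]_(n + n)) : R :=
  'D_(row_mx 0 (delta_mx 0 i)) f z.

Section CartanSpace.
Variable K : cotangent -> R.

Section LocalFormulas.
Variable c : chart A.
Implicit Types (z : 'rV[R]_(n + n)) (i j k h s : 'I_n).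

Definition K2_loc z : R := K (cotangent_inv c z) ^+ 2.

Definition g_up z : 'M[R]_n :=
  \matrix_(i, j) (2^-1 * d_p i (d_p j K2_loc) z).

Definition g_dn z : 'M[R]_n := invmx (g_up z).

Definition p_dn z i : R := rsubmx z 0 i.
Definition p_up z i : R := 2^-1 * d_p i K2_loc z.

(* gamma i j k z is gamma^i_{jk} *)
Definition gamma i j k z : R :=
  2^-1 * \sum_s g_up z i s *
    (d_x k (fun y => g_dn y j s) z + d_x j (fun y => g_dn y s k) z
     - d_x s (fun y => g_dn y j k) z).

Definition gamma0 j k z : R := \sum_i gamma i j k z * p_dn z i.
Definition gamma00 j z : R :=
  \sum_i \sum_k gamma i j k z * p_dn z i * p_up z k.

Definition N_conn z : 'M[R]_n :=
  \matrix_(i, j) (gamma0 i j z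
    - 2^-1 * \sum_h gamma00 h z * d_p h (fun y => g_dn y i j) z).

(* delta / delta x^i = d / d x^i + N_{ij} d / d p_j *)
Definition delta_x z i : 'rV[R]_(n + n) :=
  row_mx (delta_mx 0 i) (row i (N_conn z)).

(* delta p_i = d p_i - N_{ji} d x^j, evaluated on the tangent vector v *)
Definition delta_p z i (v : 'rV[R]_(n + n)) : R :=
  rsubmx v 0 i - \sum_j N_conn z j i * lsubmx v 0 j.

Definition G_loc z (v w : 'rV[R]_(n + n)) : R :=
  \sum_i \sum_j g_dn z i j * lsubmx v 0 i * lsubmx w 0 j +
  \sum_i \sum_j g_up z i j * delta_p z i v * delta_p z j w.

End LocalFormulas.

Definition cartan_structure : Prop :=
  [/\ forall u, 0 <= K u,
      smooth_fun slit_cotangent K,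
      forall (x : M) (p : 'rV[R]_n) (l : R), 0 < l ->
        K (x, l *: p) = l * K (x, p) &
      forall (c : chart slit_cotangent) z, chart_codom c z ->
        forall w : 'rV[R]_n, w != 0 -> 0 < (w *m g_up c z *m w^T) 0 0].

Let S := slit_cotangent.

Definition cartan_metric : tensor2 := fun u : cotangent =>
  G_loc (chart_at S u) (coords_at S u).

(* kernel of the differential of the projection T^*M_0 -> M *)
Definition vertical : distribution := fun u : cotangent =>
  [set v : 'rV[R]_(n + n) |
    'D_v (chart_map (chart_at A u.1) \o fst \o chart_inv (chart_at S u))
         (coords_at S u) = 0].

Definition horizontal : distribution := fun u : cotangent =>
  [set v : 'rV[R]_(n + n) | exists a : 'I_n -> R,
    v = \sum_i a i *: delta_x (chart_at S u) (coords_at S u) i].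

(* C^* = p_i d / d p_i *)
Definition liouville : vfield := fun u : cotangent =>
  row_mx (0 : 'rV[R]_n) u.2.

Definition liouville_line : distribution := fun u : cotangent =>
  [set v : 'rV[R]_(n + n) | exists a : R, v = a *: liouville u].

Definition liouville_perp : distribution :=
  orth_compl cartan_metric liouville_line.

(* V_{C^*} *)
Definition vertical_perp : distribution := fun u : cotangent =>
  vertical u `&` liouville_perp u.

Definition adapted_basic_triple
    (D1 D2 D : @vfield R (n + n) cotangent -> @vfield R (n + n) cotangent ->
               @vfield R (n + n) cotangent) : Prop :=
  [/\ basic_connection S cartan_metric
        vertical liouville_line vertical_perp D1,
      basic_connection S cartan_metric
        full_distr vertical horizontal D2 &
      basic_connection S cartan_metric
        full_distr liouville_line liouville_perp D].

Section Connections.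
Variable nabla : @vfield R (n + n) cotangent -> @vfield R (n + n) cotangent ->
                 @vfield R (n + n) cotangent.

(* These three operators are meant on sections of H, of V_{C^*} and of
   {C^*}^perp respectively in their second argument. *)
Definition vranceanu_hor := vranceanu S cartan_metric nabla vertical.
Definition vranceanu_vert := vranceanu S cartan_metric nabla vertical_perp.
Definition vranceanu_sum (X Z : @vfield R (n + n) cotangent) :
    @vfield R (n + n) cotangent :=
  vf_add (vranceanu_hor X (orth_proj cartan_metric horizontal Z))
         (vranceanu_vert X (orth_proj cartan_metric vertical_perp Z)).

End Connections.
End CartanSpace.
End Cotangent.

(* Main.v *)
(* Write L for the line distribution of C^*, h for the projection onto H along V, v = id - h, l for
   the projection onto L and w = v - l for the projection onto the complement of L in V.  On their
   domains the two restricted Vranceanu connections reduce to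
     h (nabla_{h X} Z + [v X, Z])   and   w (nabla_{w X} Z + [X - w X, Z]),
   which are connections by the Leibniz rules.  They are basic because for X in V (resp. in L) the
   first term vanishes, and changing the lift of Z changes the bracket by a section of [V, V], hence
   of V (resp. of [L, L], hence of L).  For the sum one needs moreover that [L, H] lies in L + H,
   which is Euler's relation for the coefficients N, homogeneous of degree 1 in p.

   The projections preserve smooth fields only if they do not depend on the chart, so the
   transformation law of N has to be proved.  With xi the Hamiltonian field of K^2 / 2 and
   Q_{ij} = d p^j / d x^i, homogeneity of K turns the definition of N into
     N = - (xi(g) + Q g + (Q g)^T) / 2,   g = (g_{ij}).
   If J is the Jacobian of a change of coordinates, then g = J g' J^T and xi is preserved, and the
   second derivatives of the change combine, by their symmetry, into N = J N' J^T - S with S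
   symmetric, which says exactly that the horizontal spaces correspond. *)
Require Import Defs.
From mathcomp Require Import all_boot all_order all_algebra.
From mathcomp Require Import all_classical all_reals all_analysis.
From mathcomp Require Import ring lra.

Set Implicit Arguments.
Unset Strict Implicit.
Unset Printing Implicit Defensive.

Import Order.TTheory GRing.Theory Num.Theory.
Import numFieldNormedType.Exports.

Local Open Scope classical_set_scope.
Local Open Scope ring_scope.

(** * Differential calculus for matrix-valued functions *)

(** Tangent vectors and momenta are rows and matrices act on the right: a tangent row changes by
    [v *m D] with D the Jacobian, a momentum row by [p *m C] with C the transposed inverse of D.
    Differentiating the latter brings in the derivative of C, the inhomogeneous term that the
    transformation laws have to carry along.

    The definition of N involves x-derivatives of the metric, whose direct transformation law is
    unwieldy. But they occur contracted with p^i, and differentiating p_j = p^i g_ij along x^k at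
    fixed momenta gives p^i d_k g_ij = - (d_k p^i) g_ij. What remains of the derivatives of g is a
    single one along xi, a field that does not depend on coordinates.

    A further obstacle is that fields are functions on the whole cotangent bundle, while fields are
    compared, and the projections computed, on the slit bundle only. Since [nabla] takes a field as
    a function, replacing [orth_proj] by an explicit projection under it has to be justified by its
    linearity over smooth functions. *)

Section DirectionalDerivatives.
Context {R : realType}.
Implicit Types V W : normedModType R.

(** Differentiability is the existence of a first-order expansion, which only sees values near [x];
    uniqueness of the differential then identifies that of [g] with that of [f]. *)
Lemma near_eq_differentiable V W (f g : V -> W) (x : V) :
  (\forall y \near x, f y = g y) -> differentiable f x -> differentiable g x.
Proof.
move=> fg df; have gx : g x = f x by rewrite (nbhs_singleton fg).
have /eqaddoP fE := diff_locally df.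
have dg : g \o shift x = cst (g x) + 'd f x +o_ 0 id.
  apply/eqaddoP => e e0; near=> h.
  have fgh : f (h + x) = g (h + x).
    near: h; move: fg; rewrite (near_shift 0 x)/=.
    by apply: filterS => h /=; rewrite subr0.
  have : `|(f \o shift x - (cst (f x) + 'd f x)) h| <= e * `|h|.
    by near: h; exact: fE.
  by rewrite gx !fctE /= fgh.
have dE : 'd g x = 'd f x :> (V -> W).
  by apply: diff_unique => //; exact: diff_continuous.
by apply/diff_locallyP; rewrite dE; split => //; exact: diff_continuous.
Unshelve. all: by end_near. Qed.

Lemma open_near V (U : set V) x : open U -> U x -> \forall y \near x, U y.
Proof. by move=> oU Ux; exact: open_nbhs_nbhs. Qed.

Lemma open_eq_near V W (U : set V) (f g : V -> W) x : open U -> U x ->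
  (forall y, U y -> f y = g y) -> \forall y \near x, f y = g y.
Proof. by move=> oU Ux fg; apply: filterS (open_near oU Ux). Qed.

Lemma open_eq_derive V W (U : set V) (f g : V -> W) x v : open U -> U x ->
  (forall y, U y -> f y = g y) -> 'D_v f x = 'D_v g x.
Proof. by move=> oU Ux fg; apply: near_eq_derive; exact: open_eq_near fg. Qed.

Lemma deriveZv V W (f : V -> W) x a v : differentiable f x ->
  'D_(a *: v) f x = a *: 'D_v f x.
Proof. by move=> df; rewrite !deriveE// linearZ. Qed.

Lemma deriveDv V W (f : V -> W) x v w : differentiable f x ->
  'D_(v + w) f x = 'D_v f x + 'D_w f x.
Proof. by move=> df; rewrite !deriveE// linearD. Qed.

Lemma deriveNv V W (f : V -> W) x v : differentiable f x ->
  'D_(- v) f x = - 'D_v f x.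
Proof. by move=> df; rewrite !deriveE// linearN. Qed.

Lemma derive_sumv V W (f : V -> W) x (I : finType) (v : I -> V) :
  differentiable f x -> 'D_(\sum_i v i) f x = \sum_i 'D_(v i) f x.
Proof.
by move=> df; rewrite deriveE// linear_sum; apply: eq_bigr => i _; rewrite deriveE.
Qed.

Lemma derive_comp V W W' (f : V -> W) (g : W -> W') x v :
  differentiable f x -> differentiable g (f x) ->
  'D_v (g \o f) x = 'D_('D_v f x) g (f x).
Proof.
move=> df dg; have dgf := differentiable_comp df dg.
by rewrite !deriveE// diff_comp.
Qed.

Lemma derive_linear V W (f : {linear V -> W}) x v : continuous f ->
  'D_v f x = f v.
Proof.
by move=> cf; rewrite deriveE; [rewrite diff_lin | exact: linear_differentiable].
Qed.

Lemma differentiable_mxP V m n (f : V -> 'M[R]_(m, n)) x :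
  (forall i j, differentiable (fun z => f z i j) x) <-> differentiable f x.
Proof.
split=> [df|df i j]; last first.
  exact: (differentiable_comp df (@differentiable_coord _ _ _ _ i j)).
rewrite (_ : f = \sum_i \sum_j (fun z => f z i j *: delta_mx i j)).
  by do 2![apply: differentiable_sum => ?]; exact: differentiableZl.
apply/funext => z; rewrite {1}(matrix_sum_delta (f z)) fct_sumE.
by apply: eq_bigr => i _; rewrite fct_sumE.
Qed.

Lemma derive_mxE V m n (f : V -> 'M[R]_(m, n)) x v i j :
  differentiable f x -> ('D_v f x) i j = 'D_v (fun z => f z i j) x.
Proof.
by move=> df; rewrite derive_mx ?mxE//; exact: diff_derivable.
Qed.

Lemma differentiable_bigsum V W (I : finType) (f : I -> V -> W) x :
  (forall i, differentiable (f i) x) ->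
  differentiable (fun z => \sum_i f i z) x.
Proof.
move=> df; have -> : (fun z => \sum_i f i z) = \sum_i f i by apply/funext => z; rewrite fct_sumE.
elim/big_ind : _; [exact: differentiable_cst| |by move=> i _; exact: df].
by move=> g h dg dh; exact: differentiableD.
Qed.

Lemma derive_bigsum V W (I : finType) (f : I -> V -> W) x v :
  (forall i, differentiable (f i) x) ->
  'D_v (fun z => \sum_i f i z) x = \sum_i 'D_v (f i) x.
Proof.
move=> df; have -> : (fun z => \sum_i f i z) = \sum_i f i by apply/funext => z; rewrite fct_sumE.
(* Differentiability is carried through the induction because the sum rule asks for it at each
   step. *)
suff : differentiable (\sum_i f i) x /\ 'D_v (\sum_i f i) x = \sum_i 'D_v (f i) x.
  by case.
elim: (index_enum I) => [|i s [ds IH]].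
  by rewrite !big_nil; split; [exact: differentiable_cst|exact: derive_cst].
rewrite !big_cons; split; first exact: differentiableD.
by rewrite deriveD ?IH//; exact: diff_derivable.
Qed.

Lemma deriveM_diff V (f g : V -> R) x v :
  differentiable f x -> differentiable g x ->
  'D_v (fun z => f z * g z) x = 'D_v f x * g x + f x * 'D_v g x.
Proof.
move=> df dg; have dv h : differentiable h x -> derivable (h : V -> R) x v.
  exact: diff_derivable.
rewrite (@deriveM _ _ f g _ _ (dv _ df) (dv _ dg)) addrC; congr (_ + _).
exact: mulrC.
Qed.

Lemma differentiable_mulmx V m n p (f : V -> 'M[R]_(m, n)) (g : V -> 'M[R]_(n, p)) x :
  differentiable f x -> differentiable g x ->
  differentiable (fun z => f z *m g z) x.
Proof.
move=> /differentiable_mxP df /differentiable_mxP dg; apply/differentiable_mxP => i j.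
under eq_fun do rewrite mxE.
by apply: differentiable_bigsum => k; exact: differentiableM.
Qed.

Lemma derive_mulmx V m n p (f : V -> 'M[R]_(m, n)) (g : V -> 'M[R]_(n, p)) x v :
  differentiable f x -> differentiable g x ->
  'D_v (fun z => f z *m g z) x = 'D_v f x *m g x + f x *m 'D_v g x.
Proof.
move=> df dg; apply/matrixP => i j.
rewrite derive_mxE; last exact: differentiable_mulmx.
under eq_fun do rewrite mxE.
move: (df) (dg) => /differentiable_mxP df' /differentiable_mxP dg'.
rewrite derive_bigsum; last by move=> k; exact: differentiableM.
rewrite !mxE -big_split; apply: eq_bigr => k _ /=.
by rewrite (deriveM_diff v (df' i k) (dg' k j)) !derive_mxE.
Qed.

Lemma differentiable_trmx V m n (f : V -> 'M[R]_(m, n)) x :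
  differentiable f x -> differentiable (fun z => (f z)^T) x.
Proof.
move=> /differentiable_mxP df; apply/differentiable_mxP => i j.
by under eq_fun do rewrite mxE.
Qed.

Lemma derive_trmx V m n (f : V -> 'M[R]_(m, n)) x v :
  differentiable f x -> 'D_v (fun z => (f z)^T) x = ('D_v f x)^T.
Proof.
move=> df; apply/matrixP => i j; rewrite derive_mxE; last exact: differentiable_trmx.
by under eq_fun do rewrite mxE; rewrite mxE derive_mxE.
Qed.

Lemma differentiable_row_mx V m n p (f : V -> 'M[R]_(m, n)) (g : V -> 'M[R]_(m, p)) x :
  differentiable f x -> differentiable g x ->
  differentiable (fun z => row_mx (f z) (g z)) x.
Proof.
move=> /differentiable_mxP df /differentiable_mxP dg; apply/differentiable_mxP => i j.
by under eq_fun do rewrite mxE; case: splitP => k _.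
Qed.

Lemma derive_row_mx V m n p (f : V -> 'M[R]_(m, n)) (g : V -> 'M[R]_(m, p)) x v :
  differentiable f x -> differentiable g x ->
  'D_v (fun z => row_mx (f z) (g z)) x = row_mx ('D_v f x) ('D_v g x).
Proof.
move=> df dg; apply/matrixP => i j.
rewrite derive_mxE; last exact: differentiable_row_mx.
under eq_fun do rewrite mxE.
by rewrite mxE; case: splitP => k _; rewrite derive_mxE.
Qed.

Lemma differentiable_scale V m n (f : V -> R) (g : V -> 'M[R]_(m, n)) x :
  differentiable f x -> differentiable g x ->
  differentiable (fun z => f z *: g z) x.
Proof.
move=> df /differentiable_mxP dg; apply/differentiable_mxP => i j.
by under eq_fun do rewrite mxE; exact: differentiableM.
Qed.

Lemma derive_scale V m n (f : V -> R) (g : V -> 'M[R]_(m, n)) x v :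
  differentiable f x -> differentiable g x ->
  'D_v (fun z => f z *: g z) x = 'D_v f x *: g x + f x *: 'D_v g x.
Proof.
move=> df dg; apply/matrixP => i j.
rewrite derive_mxE; last exact: differentiable_scale.
move: (dg) => /differentiable_mxP dg'.
under eq_fun do rewrite mxE.
by rewrite (deriveM_diff v df (dg' i j)) !mxE derive_mxE.
Qed.

Lemma derive_lsubmx V m n p (f : V -> 'M[R]_(m, n + p)) x v :
  differentiable f x -> 'D_v (fun z => lsubmx (f z)) x = lsubmx ('D_v f x).
Proof.
move=> df; rewrite (derive_comp v df (differentiable_lsubmx _)).
by rewrite (derive_linear _ _ (@continuous_lsubmx _ _ _ _)).
Qed.

End DirectionalDerivatives.

(** * Functions of class C^k on an open set *)

Section ClassC.
Context {R : realType}.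
Implicit Types V W : normedModType R.

(** A derivative at [x] depends on values around [x], so agreement on [U] passes to derivatives
    because [U] is a neighbourhood of its points. Most formulas below hold on a chart domain only,
    and regularity reaches the actual function through this lemma. *)
Lemma class_C_eq V W k (U : set V) (f g : V -> W) : open U ->
  (forall x, U x -> f x = g x) -> class_C k U f -> class_C k U g.
Proof.
move=> oU; elim: k f g => [|k IH] f g fg /=.
  move=> cf x Ux; have nfg := open_eq_near oU Ux fg.
  rewrite /prop_for /continuous_at -(fg _ Ux); apply: cvg_trans (cf x Ux).
  by apply: near_eq_cvg; apply: filterS nfg => y.
move=> [df cf]; split=> [x Ux|v].
  exact: near_eq_differentiable (open_eq_near oU Ux fg) (df x Ux).
by apply: IH (cf v) => x Ux; exact: open_eq_derive fg.
Qed.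

Lemma class_CS V W k (U : set V) (f : V -> W) :
  class_C k.+1 U f -> class_C k U f.
Proof.
elim: k f => [|k IH] f [df cf]; first by move=> x Ux; exact/differentiable_continuous/df.
by split=> // v; apply: IH; exact: cf.
Qed.

Lemma class_C_cst V W k (U : set V) (a : W) : class_C k U (fun=> a : W).
Proof.
elim: k a => [|k IH] a /=; first by move=> x _; exact: cvg_cst.
split=> [x _|v]; first exact: differentiable_cst.
by under eq_fun do rewrite derive_cst; exact: IH.
Qed.

Lemma class_C_add V W k (U : set V) (f g : V -> W) : open U ->
  class_C k U f -> class_C k U g -> class_C k U (fun x => f x + g x).
Proof.
move=> oU; elim: k f g => [|k IH] f g /=.
  by move=> cf cg x Ux; apply: cvgD; [exact: cf|exact: cg].
move=> [df cf] [dg cg]; split=> [x Ux|v].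
  by apply: differentiableD; [exact: df|exact: dg].
apply: class_C_eq oU _ (IH _ _ (cf v) (cg v)) => x Ux.
by rewrite -deriveD//; apply: diff_derivable; [exact: df|exact: dg].
Qed.

Lemma class_C_mul V k (U : set V) (f g : V -> R) : open U ->
  class_C k U f -> class_C k U g -> class_C k U (fun x => f x * g x).
Proof.
move=> oU; elim: k f g => [|k IH] f g.
  by move=> cf cg x Ux; apply: cvgM; [exact: cf|exact: cg].
move=> cf cg; move: (cf) (cg) => [df c'f] [dg c'g]; split=> [x Ux|v].
  by apply: differentiableM; [exact: df|exact: dg].
apply: class_C_eq oU _ (class_C_add oU (IH _ _ (c'f v) (class_CS cg))
                                       (IH _ _ (class_CS cf) (c'g v))) => x Ux /=.
by rewrite deriveM_diff//; [exact: df|exact: dg].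
Qed.

Lemma class_C_inv V k (U : set V) (f : V -> R) : open U ->
  (forall x, U x -> f x != 0) ->
  class_C k U f -> class_C k U (fun x => (f x)^-1).
Proof.
move=> oU f0; elim: k => [|k IH].
  by move=> cf x Ux; apply: cvgV; [exact: f0|exact: cf].
move=> cf; move: (cf) => [df c'f]; split=> [x Ux|v].
  by apply: differentiableV; [exact: df|exact: f0].
(* The derivative of 1/f is -(1/f)^2 f', which involves 1/f only at order [k], where the induction
   hypothesis applies. *)
have cV := IH (class_CS cf).
apply: class_C_eq oU _ (class_C_mul oU (class_C_mul oU (@class_C_cst _ _ k U (-1 : R))
      (class_C_mul oU cV cV)) (c'f v)) => x Ux.
rewrite deriveV; [|exact: f0|exact/diff_derivable/df].
by rewrite mulN1r -expr2 exprVn.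
Qed.

Lemma class_C_bigsum V W k (U : set V) (I : finType) (f : I -> V -> W) : open U ->
  (forall i, class_C k U (f i)) -> class_C k U (fun x => \sum_i f i x).
Proof.
move=> oU cf.
elim: (index_enum I) => [|i s IH].
  by under eq_fun do rewrite big_nil; exact: class_C_cst.
by under eq_fun do rewrite big_cons; exact: class_C_add.
Qed.

Lemma class_C_bigprod V k (U : set V) (I : finType) (f : I -> V -> R) : open U ->
  (forall i, class_C k U (f i)) -> class_C k U (fun x => \prod_i f i x).
Proof.
move=> oU cf.
elim: (index_enum I) => [|i s IH].
  by under eq_fun do rewrite big_nil; exact: class_C_cst.
by under eq_fun do rewrite big_cons; exact: class_C_mul.
Qed.

Lemma class_C_scalel V W k (U : set V) (f : V -> R) (w : W) : open U ->
  class_C k U f -> class_C k U (fun x => f x *: w).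
Proof.
move=> oU; elim: k f => [|k IH] f /=.
  by move=> cf x Ux; apply: cvgZl; exact: cf.
move=> [df cf]; split=> [x Ux|v]; first exact/differentiableZl/df.
apply: class_C_eq oU _ (IH _ (cf v)) => x Ux.
have dfx := df x Ux.
by rewrite (deriveE _ dfx) (deriveE _ (differentiableZl w dfx)) diffZl.
Qed.

Lemma class_C_coord V k m n (U : set V) (f : V -> 'M[R]_(m, n)) i j : open U ->
  class_C k U f -> class_C k U (fun x => f x i j).
Proof.
move=> oU; elim: k f => [|k IH] f /=.
  move=> cf x Ux.
  exact: (continuous_comp (cf x Ux) (@coord_continuous _ _ _ i j (f x))).
move=> [df cf]; split=> [x Ux|v].
  by move/differentiable_mxP: (df x Ux).
by apply: class_C_eq oU _ (IH _ (cf v)) => x Ux; rewrite derive_mxE//; exact: df.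
Qed.

Lemma class_C_mxP V k m n (U : set V) (f : V -> 'M[R]_(m, n)) : open U ->
  (forall i j, class_C k U (fun x => f x i j)) <-> class_C k U f.
Proof.
move=> oU; split=> [cf|cf i j]; last exact: class_C_coord.
rewrite (_ : f = fun x => \sum_i \sum_j (f x i j *: delta_mx i j)).
  do 2![apply: class_C_bigsum => // ?]; exact: class_C_scalel.
by apply/funext => z; rewrite -matrix_sum_delta.
Qed.

Lemma class_C_mulmx V k m n p (U : set V) (f : V -> 'M[R]_(m, n))
    (g : V -> 'M[R]_(n, p)) : open U ->
  class_C k U f -> class_C k U g -> class_C k U (fun x => f x *m g x).
Proof.
move=> oU /(class_C_mxP _ _ oU) cf /(class_C_mxP _ _ oU) cg.
apply/(class_C_mxP _ _ oU) => i j; under eq_fun do rewrite mxE.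
by apply: class_C_bigsum => // l; exact: class_C_mul.
Qed.

Lemma class_C_trmx V k m n (U : set V) (f : V -> 'M[R]_(m, n)) : open U ->
  class_C k U f -> class_C k U (fun x => (f x)^T).
Proof.
move=> oU /(class_C_mxP _ _ oU) cf.
by apply/(class_C_mxP _ _ oU) => i j; under eq_fun do rewrite mxE.
Qed.

Lemma class_C_scale V k m n (U : set V) (f : V -> R) (g : V -> 'M[R]_(m, n)) :
  open U -> class_C k U f -> class_C k U g -> class_C k U (fun x => f x *: g x).
Proof.
move=> oU cf /(class_C_mxP _ _ oU) cg.
by apply/(class_C_mxP _ _ oU) => i j; under eq_fun do rewrite mxE; exact: class_C_mul.
Qed.

Lemma class_C_row_mx V k m n p (U : set V) (f : V -> 'M[R]_(m, n))
    (g : V -> 'M[R]_(m, p)) : open U ->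
  class_C k U f -> class_C k U g -> class_C k U (fun x => row_mx (f x) (g x)).
Proof.
move=> oU /(class_C_mxP _ _ oU) cf /(class_C_mxP _ _ oU) cg.
by apply/(class_C_mxP _ _ oU) => i j; under eq_fun do rewrite mxE; case: splitP => l _.
Qed.

Lemma class_C_lsubmx V k m n p (U : set V) (f : V -> 'M[R]_(m, n + p)) : open U ->
  class_C k U f -> class_C k U (fun x => lsubmx (f x)).
Proof.
move=> oU /(class_C_mxP _ _ oU) cf.
by apply/(class_C_mxP _ _ oU) => i j; under eq_fun do rewrite mxE.
Qed.

Lemma class_C_rsubmx V k m n p (U : set V) (f : V -> 'M[R]_(m, n + p)) : open U ->
  class_C k U f -> class_C k U (fun x => rsubmx (f x)).
Proof.
move=> oU /(class_C_mxP _ _ oU) cf.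
by apply/(class_C_mxP _ _ oU) => i j; under eq_fun do rewrite mxE.
Qed.

Lemma class_C_det V k n (U : set V) (f : V -> 'M[R]_n) : open U ->
  class_C k U f -> class_C k U (fun x => \det (f x)).
Proof.
move=> oU /(class_C_mxP _ _ oU) cf; rewrite /determinant.
apply: class_C_bigsum => // s; apply: class_C_mul => //; first exact: class_C_cst.
exact: class_C_bigprod.
Qed.

(** By Cramer's rule the inverse is the adjugate over the determinant, and both are polynomial in
    the entries. *)
Lemma class_C_invmx V k n (U : set V) (f : V -> 'M[R]_n) : open U ->
  (forall x, U x -> f x \in unitmx) ->
  class_C k U f -> class_C k U (fun x => invmx (f x)).
Proof.
move=> oU uf cf.
apply: (@class_C_eq _ _ k U (fun x => (\det (f x))^-1 *: \adj (f x))) => //.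
  by move=> x Ux; rewrite /invmx uf.
apply: class_C_scale => //.
  apply: class_C_inv => // [x /uf|]; last exact: class_C_det.
  by rewrite unitmxE unitfE.
apply/(class_C_mxP _ _ oU) => i j; under eq_fun do rewrite mxE /cofactor.
apply: class_C_mul => //; first exact: class_C_cst.
apply: class_C_det => //; apply/(class_C_mxP _ _ oU) => a b.
by under eq_fun do rewrite !mxE; exact: class_C_coord.
Qed.

End ClassC.

(** * Symmetry of second derivatives *)

Section SymmetryOfSecondDerivatives.
Context {R : realType} {V : normedModType R}.

Lemma MVT_line (f : V -> R) (x v : V) (t : R) : 0 < t ->
  (forall s, 0 <= s <= t -> differentiable f (x + s *: v)) ->
  exists2 s, 0 < s < t & f (x + t *: v) - f x = t * 'D_v f (x + s *: v).
Proof.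
move=> t0 df.
pose l s := x + s *: v.
have dl s : differentiable (l : R -> V) s.
  apply: differentiableD; first exact: differentiable_cst.
  exact: (@differentiableZl _ _ _ id v).
have Dl s : 'D_1 (l : R -> V) s = v.
  rewrite /l deriveD; [|exact: derivable_cst|].
    rewrite derive_cst add0r deriveE; last exact: (@differentiableZl _ _ _ id v).
    rewrite (@diffZl _ _ _ id v)//.
    by rewrite -deriveE// derive_id scale1r.
  by apply: diff_derivable; exact: (@differentiableZl _ _ _ id v).
have [||s] := @MVT R (f \o l) (fun s => 'D_v f (x + s *: v)) 0 t t0.
- move=> s; rewrite in_itv/= => /andP[s0 st].
  have dfs : differentiable f (l s) by apply: df; rewrite !ltW.
  apply: DeriveDef; first by apply: diff_derivable; exact: differentiable_comp.
  by rewrite derive_comp// Dl.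
- apply: continuous_in_subspaceT => s; rewrite inE/= in_itv/= => st.
  by apply: differentiable_continuous; apply: differentiable_comp => //; exact: df.
rewrite in_itv/= subr0 => s0t E; exists s => //.
by move: E; rewrite /= /l scale0r addr0 mulrC => <-.
Qed.

Lemma ler_dist_half (a b c e : R) :
  `|a - c| < e / 2 -> `|b - c| < e / 2 -> `|a - b| <= e.
Proof.
rewrite !ltr_norml ler_norml => /andP[? ?] /andP[? ?]; apply/andP; split; lra.
Qed.

(** Two applications of the mean value theorem: along [v] to the increment g(y) = f(y + t w) - f(y),
    then along [w] to the derivative of [f] in the direction [v]. *)
Lemma second_difference (f : V -> R) (x v w : V) (t : R) (U : set V) : 0 < t ->
  (forall r s, 0 <= r <= t -> 0 <= s <= t -> U (x + r *: v + s *: w)) ->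
  (forall y, U y -> differentiable f y) ->
  (forall y, U y -> differentiable ('D_v f) y) ->
  exists2 y, U y & f (x + t *: v + t *: w) - f (x + t *: v) - f (x + t *: w) + f x
    = t ^+ 2 * 'D_w ('D_v f) y.
Proof.
move=> t0 Uvw df dDf.
have t00 : 0 <= (0 : R) <= t by rewrite lexx ltW.
have tt : 0 <= t <= t by rewrite lexx ltW.
pose g y := f (y + t *: w) - f y.
have dsh y : U (y + t *: w) -> differentiable (fun z => f (z + t *: w)) y.
  move=> Uy; apply: (@differentiable_comp _ _ _ _ (fun z => z + t *: w) f).
    by apply: differentiableD => //; exact: differentiable_cst.
  exact: df.
have [|r rt gE] := @MVT_line g x v t t0.
  move=> r rt; apply: differentiableB.
    by apply: dsh; exact: Uvw.
  by apply: df; have := Uvw _ _ rt t00; rewrite scale0r addr0.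
have {}rt : 0 <= r <= t by case/andP: rt => *; rewrite !ltW.
have Ur : U (x + r *: v) by have := Uvw _ _ rt t00; rewrite scale0r addr0.
have Urt : U (x + r *: v + t *: w) by exact: Uvw.
have [|s st hE] := @MVT_line ('D_v f) (x + r *: v) w t t0.
  by move=> s st; apply: dDf; exact: Uvw.
exists (x + r *: v + s *: w).
  by apply: Uvw => //; case/andP: st => *; rewrite !ltW.
have -> : f (x + t *: v + t *: w) - f (x + t *: v) - f (x + t *: w) + f x
  = g (x + t *: v) - g x by rewrite /g; ring.
rewrite gE expr2 -mulrA -hE; congr (_ * _).
rewrite /g deriveB; [|by apply: diff_derivable; exact: dsh|by apply: diff_derivable; exact: df].
congr (_ - _).
rewrite (@derive_comp _ _ _ _ (fun z => z + t *: w) f); [| |exact: df].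
  congr ('D_ _ f _); rewrite deriveD; [|exact: derivable_id|exact: derivable_cst].
  by rewrite derive_id derive_cst addr0.
by apply: differentiableD => //; exact: differentiable_cst.
Qed.

(** The second difference is symmetric in [v] and [w]. Evaluated in both orders on a small
    parallelogram, it shows that one mixed derivative at some [y] equals the other at some [z], both
    points near [x]; continuity then makes the values at [x] differ by at most [e]. *)
Lemma derive_comm_scalar (f : V -> R) (U : set V) x v w : open U -> U x ->
  class_C 2 U f -> 'D_v ('D_w f) x = 'D_w ('D_v f) x.
Proof.
move=> oU Ux [df cDf].
have dDf u y : U y -> differentiable ('D_u f) y by case: (cDf u) => + _; exact.
have cDDf u u' : {for x, continuous ('D_u' ('D_u f))}.
  by case: (cDf u) => _ /(_ u'); exact.
apply/eqP; rewrite eq_sym -subr_eq0 -normr_le0; apply/ler_addgt0Pr => e e0.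
rewrite add0r.
have e2 : 0 < e / 2 by rewrite divr_gt0.
pose W := [set y | [/\ U y, `|'D_w ('D_v f) x - 'D_w ('D_v f) y| < e / 2 &
                      `|'D_v ('D_w f) x - 'D_v ('D_w f) y| < e / 2]].
have : \forall y \near x, W y.
  have c1 : 'D_w ('D_v f) y @[y --> x] --> 'D_w ('D_v f) x by exact: cDDf.
  have c2 : 'D_v ('D_w f) y @[y --> x] --> 'D_v ('D_w f) x by exact: cDDf.
  move/cvgrPdist_lt : c1 => /(_ _ e2) c1; move/cvgrPdist_lt : c2 => /(_ _ e2) c2.
  by apply: filterS3 (open_near oU Ux) c1 c2 => y Uy h1 h2; split; [exact: Uy|exact: h1|exact: h2].
move=> /nbhs_ballP[d /= d0 dW].
(* With this [t] the parallelogram stays within d/2 of [x]; the summand 1 keeps the denominator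
   positive when both directions vanish. *)
pose t := d / (1 + `|v| + `|w|) / 2.
have vw0 : 0 < 1 + `|v| + `|w| by rewrite -addrA ltr_wpDr// addr_ge0.
have t0 : 0 < t by rewrite !divr_gt0.
have inW r s : 0 <= r <= t -> 0 <= s <= t -> W (x + r *: v + s *: w).
  move=> /andP[r0 rt] /andP[s0 st]; apply: dW.
  rewrite -ball_normE /ball_/= -addrA opprD addrA subrr add0r normrN.
  apply: le_lt_trans (ler_normD _ _) _; rewrite !normrZ !ger0_norm//.
  have td : t * (1 + `|v| + `|w|) < d.
    rewrite /t mulrAC divfK ?gt_eqF//.
    by rewrite ltr_pdivrMr// ltr_pMr// ltr1n.
  apply: le_lt_trans td; rewrite -addrA mulrDr mulr1 mulrDr.
  have := ler_wpM2r (normr_ge0 v) rt; have := ler_wpM2r (normr_ge0 w) st.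
  by move: t0; lra.
have inW' r s : 0 <= r <= t -> 0 <= s <= t -> W (x + r *: w + s *: v).
  by move=> ? ?; rewrite addrAC; exact: inW.
have [y [_ yE _] E] := second_difference t0 inW (fun y '(And3 Uy _ _) => df y Uy)
  (fun y '(And3 Uy _ _) => dDf v y Uy).
have [z [_ _ zE] E'] := second_difference t0 inW' (fun y '(And3 Uy _ _) => df y Uy)
  (fun y '(And3 Uy _ _) => dDf w y Uy).
have EE : 'D_w ('D_v f) y = 'D_v ('D_w f) z.
  have tn : t ^+ 2 != 0 by rewrite expf_neq0// gt_eqF.
  apply: (mulfI tn); apply: etrans (esym E) _; apply: etrans E'.
  by rewrite (addrAC x (t *: w)); congr (_ + _); exact: addrAC.
move: yE zE; rewrite EE; exact: ler_dist_half.
Qed.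

Lemma derive_comm m n (f : V -> 'M[R]_(m, n)) (U : set V) x v w : open U -> U x ->
  class_C 2 U f -> 'D_v ('D_w f) x = 'D_w ('D_v f) x.
Proof.
move=> oU Ux cf; move: (cf) => [df cDf].
have dDf u y : U y -> differentiable ('D_u f) y by case: (cDf u) => + _; exact.
apply/matrixP => i j.
have E1 := derive_mxE v i j (dDf w x Ux).
have E2 := derive_mxE w i j (dDf v x Ux).
apply: etrans E1 _; apply: etrans (esym E2).
have E3 := open_eq_derive v oU Ux (fun y Uy => derive_mxE w i j (df y Uy)).
have E4 := open_eq_derive w oU Ux (fun y Uy => derive_mxE v i j (df y Uy)).
apply: etrans E3 _; apply: etrans (esym E4).
exact: derive_comm_scalar oU Ux (class_C_coord i j oU cf).
Qed.

End SymmetryOfSecondDerivatives.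

(** * Charts of the slit cotangent bundle *)

Section ManifoldCharts.
Context {R : realType} {n : nat}.
Variable M : manifold R n.
Let A := mfd_atlas M.
Let S := slit_cotangent M.
Implicit Types (c d e : chart A) (x : M).

(** Matrix identities between Jacobians are proved below by applying both sides to an arbitrary
    direction. *)
Lemma mulmx_rV_inj m p (B C : 'M[R]_(m, p)) :
  (forall v : 'rV_m, v *m B = v *m C) -> B = C.
Proof. by move=> BC; apply/row_matrixP => i; rewrite !rowE. Qed.

Lemma jacobianE m p (f : 'rV[R]_m -> 'rV[R]_p) a :
  differentiable f a -> forall i j, jacobian f a i j = 'D_(delta_mx 0 i) f a 0 j.
Proof. by move=> df i j; rewrite (deriveEjacobian _ df) -rowE [RHS]mxE. Qed.

Lemma chart_codom_map c x : chart_dom c x -> chart_codom c (chart_map c x).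
Proof. by move=> cx; exists x. Qed.

Lemma chart_codomK c a : chart_codom c a ->
  chart_dom c (chart_inv c a) /\ chart_map c (chart_inv c a) = a.
Proof. by case=> x cx <-; rewrite mfd_mapK. Qed.

Definition overlap c d : set 'rV[R]_n := chart_map c @` (chart_dom c `&` chart_dom d).

Definition transition c d : 'rV[R]_n -> 'rV[R]_n := chart_map d \o chart_inv c.

Lemma overlapP c d a :
  overlap c d a <-> chart_codom c a /\ chart_dom d (chart_inv c a).
Proof.
split=> [[x [cx dx] <-]|[[x cx <-]]]; first by rewrite mfd_mapK//; split=> //; exists x.
by rewrite mfd_mapK// => dx; exists x.
Qed.

Lemma overlap_map c d x : chart_dom c x -> chart_dom d x ->
  overlap c d (chart_map c x).
Proof. by move=> cx dx; exists x. Qed.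

Lemma open_overlap c d : open (overlap c d).
Proof.
rewrite openE => a /overlapP[ca dxa]; rewrite /interior.
have n1 : \forall b \near a, chart_codom c b.
  exact: open_near (@mfd_codom_open _ _ M c) ca.
have n2 : \forall b \near a, chart_dom d (chart_inv c b).
  have /(_ (chart_dom d)) := mfd_inv_continuous ca; apply.
  exact: (open_nbhs_nbhs (conj (@mfd_dom_open _ _ M d) dxa)).
by apply: filterS2 n1 n2 => b cb db; apply/overlapP.
Qed.

Arguments open_overlap : clear implicits.

Lemma smooth_transition c d : smooth (overlap c d) (transition c d).
Proof. exact: mfd_transition. Qed.

Lemma differentiable_transition c d a : overlap c d a ->
  differentiable (transition c d) a.
Proof. by move=> oa; case: (smooth_transition c d 1) => + _; exact. Qed.

Definition jac c d x : 'M[R]_n := jacobian (transition c d) (chart_map c x).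

Lemma derive_transition c d x v : chart_dom c x -> chart_dom d x ->
  'D_v (transition c d) (chart_map c x) = v *m jac c d x.
Proof.
by move=> cx dx; apply: deriveEjacobian; exact/differentiable_transition/overlap_map.
Qed.

Lemma transition_map c d x : chart_dom c x ->
  transition c d (chart_map c x) = chart_map d x.
Proof. by move=> cx; rewrite /transition/= mfd_mapK. Qed.

Lemma transition_comp c d e a : overlap c d a ->
  transition d e (transition c d a) = transition c e a.
Proof. by move=> /overlapP[_ da]; rewrite /transition/= mfd_mapK. Qed.

(** Chain rule; the factorisation of one transition through another holds on the overlap only,
    whence the use of [open_eq_derive]. *)
Lemma jac_comp c d e x : chart_dom c x -> chart_dom d x -> chart_dom e x ->
  jac c e x = jac c d x *m jac d e x.
Proof.
move=> cx dx ex; apply: mulmx_rV_inj => v.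
have ocd := overlap_map cx dx.
rewrite -(derive_transition v cx ex) mulmxA -(derive_transition v cx dx)
    -(derive_transition _ dx ex).
rewrite -(open_eq_derive v (open_overlap c d) ocd (@transition_comp c d e)).
rewrite -(transition_map d cx); apply: derive_comp.
  exact: differentiable_transition.
by rewrite transition_map//; exact/differentiable_transition/overlap_map.
Qed.

Lemma jac_id c x : chart_dom c x -> jac c c x = 1%:M.
Proof.
move=> cx; apply: mulmx_rV_inj => v; rewrite -(derive_transition v cx cx) mulmx1.
have cc : chart_codom c (chart_map c x) by exact: chart_codom_map.
rewrite (open_eq_derive v (@mfd_codom_open _ _ M c) cc (g := id)) ?derive_id//.
by move=> a /chart_codomK[].
Qed.

Lemma jacVr c d x : chart_dom c x -> chart_dom d x ->
  jac c d x *m jac d c x = 1%:M.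
Proof. by move=> cx dx; rewrite -jac_comp// jac_id. Qed.

Lemma jac_unit c d x : chart_dom c x -> chart_dom d x -> jac c d x \in unitmx.
Proof. by move=> cx dx; have [+ _] := mulmx1_unit (jacVr cx dx); exact. Qed.

Lemma jacV c d x : chart_dom c x -> chart_dom d x ->
  jac d c x = invmx (jac c d x).
Proof.
move=> cx dx; rewrite -[LHS](mulKmx (jac_unit cx dx)) jacVr//.
by rewrite mulmx1.
Qed.

Lemma chart_at_dom x : chart_dom (chart_at A x) x.
Proof. exact: mfd_chart_at. Qed.

Lemma cotangent_mapE c (u : cotangent M) : cotangent_map c u =
  row_mx (chart_map c u.1) (u.2 *m (jac c (chart_at A u.1) u.1)^T).
Proof. by []. Qed.

Lemma cotangent_invE c z : cotangent_inv c z =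
  let x := chart_inv c (lsubmx z) in
  (x, rsubmx z *m (jac (chart_at A x) c x)^T) :> cotangent M.
Proof. by []. Qed.

Lemma cotangent_mapK c (u : cotangent M) : chart_dom c u.1 ->
  cotangent_inv c (cotangent_map c u) = u.
Proof.
case: u => x q /= cx; rewrite cotangent_mapE cotangent_invE/= row_mxKl row_mxKr mfd_mapK//.
by rewrite -mulmxA -trmx_mul jacVr ?trmx1 ?mulmx1//; exact: chart_at_dom.
Qed.

Lemma cotangent_invK c z : chart_codom c (lsubmx z) ->
  cotangent_map c (cotangent_inv c z) = z.
Proof.
move=> /chart_codomK[cx cxE]; rewrite cotangent_invE cotangent_mapE/= cxE.
rewrite -mulmxA -trmx_mul jacVr ?trmx1 ?mulmx1 ?hsubmxK//; exact: chart_at_dom.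
Qed.

Lemma mulmx_unit_neq0 (q : 'rV[R]_n) (B : 'M[R]_n) : B \in unitmx ->
  (q *m B != 0) = (q != 0).
Proof.
move=> uB; apply/idP/idP; apply: contraNN => /eqP; first by move=> ->; rewrite mul0mx.
by move=> qB; rewrite -(mulmxK uB q) qB mul0mx.
Qed.

Lemma slit_codomP (c : chart S) z : chart_codom c z <->
  chart_codom (c : chart A) (lsubmx z) /\ rsubmx z != 0.
Proof.
split=> [[[x q] /= [cx q0] <-]|[cz p0]].
  rewrite cotangent_mapE/= row_mxKl row_mxKr; split; first exact: chart_codom_map.
  by rewrite mulmx_unit_neq0// unitmx_tr jac_unit//; exact: chart_at_dom.
exists (cotangent_inv c z); last exact: cotangent_invK.
have [cx _] := chart_codomK cz; split=> //=.
by rewrite mulmx_unit_neq0// unitmx_tr jac_unit//; exact: chart_at_dom.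
Qed.

Lemma slit_codomK (c : chart S) z : chart_codom c z ->
  chart_map c (chart_inv c z) = z.
Proof. by move=> /slit_codomP[cz _]; exact: cotangent_invK. Qed.

Lemma slit_codom_dom (c : chart S) z : chart_codom c z -> chart_dom c (chart_inv c z).
Proof. case=> u cu <-; have E : chart_inv c (chart_map c u) = u.
  by case: cu => cu _; exact: cotangent_mapK.
by rewrite E. Qed.

Lemma open_slit (O : set 'rV[R]_n) : open O ->
  open [set z : 'rV[R]_(n + n) | O (lsubmx z) /\ rsubmx z != 0].
Proof.
move=> oO.
have -> : [set z : 'rV[R]_(n + n) | O (lsubmx z) /\ rsubmx z != 0] =
  (lsubmx @^-1` O) `&` (rsubmx @^-1` [set~ 0]).
  by apply/seteqP; split=> z /= [Oz /eqP z0].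
apply: openI; apply: open_comp => //; first by move=> z _; exact: continuous_lsubmx.
  by move=> z _; exact: continuous_rsubmx.
apply: closed_openC; apply: accessible_closed_set1.
exact/hausdorff_accessible/norm_hausdorff.
Qed.

Lemma open_slit_codom (c : chart S) : open (chart_codom c).
Proof.
rewrite (_ : chart_codom c =
  [set z | chart_codom (c : chart A) (lsubmx z) /\ rsubmx z != 0]).
  exact/open_slit/(@mfd_codom_open _ _ M c).
by apply/seteqP; split=> z /slit_codomP.
Qed.

Arguments open_slit_codom : clear implicits.

Lemma slit_ptsP (u : cotangent M) : pts S u <-> u.2 != 0.
Proof.
split=> [[c [] //]|u0]; exists (chart_at A u.1); split=> //; exact: chart_at_dom.
Qed.

Lemma slit_chart_at (u : cotangent M) : pts S u -> chart_dom (chart_at S u) u.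
Proof. by move=> /slit_ptsP u0; split=> //; exact: chart_at_dom. Qed.

Lemma slit_coords_at (u : cotangent M) : pts S u ->
  chart_codom (chart_at S u) (coords_at S u).
Proof. by move=> /slit_chart_at du; exists u. Qed.

Lemma slit_inv_coords_at (u : cotangent M) :
  chart_inv (chart_at S u) (coords_at S u) = u.
Proof. by apply: cotangent_mapK; exact: chart_at_dom. Qed.

Lemma slit_inv_pts (c : chart S) z : chart_codom c z -> pts S (chart_inv c z).
Proof. by move=> /slit_codom_dom; exists c. Qed.

Lemma rsubmx_coords_at (u : cotangent M) : rsubmx (coords_at S u) = u.2.
Proof.
rewrite /coords_at/= cotangent_mapE row_mxKr jac_id ?trmx1 ?mulmx1//.
exact: chart_at_dom.
Qed.

Definition slit_overlap c d : set 'rV[R]_(n + n) :=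
  [set z | overlap c d (lsubmx z) /\ rsubmx z != 0].

Lemma open_slit_overlap c d : open (slit_overlap c d).
Proof. exact/open_slit/open_overlap. Qed.

Arguments open_slit_overlap : clear implicits.

Lemma slit_overlap_codom c d z : slit_overlap c d z -> chart_codom (c : chart S) z.
Proof. by move=> [/overlapP[cz _] z0]; apply/slit_codomP. Qed.

Lemma slit_overlap_map c d (u : cotangent M) :
  chart_dom c u.1 -> chart_dom d u.1 -> u.2 != 0 ->
  slit_overlap c d (cotangent_map c u).
Proof.
move=> cu du u0; have [_ zr] : chart_codom c (lsubmx (cotangent_map c u)) /\
    rsubmx (cotangent_map c u) != 0 by apply/(@slit_codomP c); exists u.
by split=> //; rewrite cotangent_mapE row_mxKl; exact: overlap_map.
Qed.

(** Momentum rows change by [p *m cojac c d a], contragrediently to tangent rows, which change by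
    the Jacobian. *)
Definition cojac c d (a : 'rV[R]_n) : 'M[R]_n := (invmx (jacobian (transition c d) a))^T.

Definition slit_transition c d : 'rV[R]_(n + n) -> 'rV[R]_(n + n) :=
  cotangent_map d \o cotangent_inv c.

(** [cotangent_inv c] passes to the preferred chart at the point and [cotangent_map d] leaves it
    again; the two Jacobians compose to that of [transition d c], the inverse of the one of
    [transition c d]. *)
Lemma slit_transitionE c d z : slit_overlap c d z -> slit_transition c d z =
  row_mx (transition c d (lsubmx z)) (rsubmx z *m cojac c d (lsubmx z)).
Proof.
move=> [/overlapP[cz dz] _]; have [cx cxE] := chart_codomK cz.
rewrite /slit_transition/= cotangent_invE cotangent_mapE/=; congr row_mx.
set x := chart_inv c _ in cx cxE dz *; have ax := chart_at_dom x.
by rewrite -mulmxA -trmx_mul -jac_comp// (jacV cx dz) /cojac /jac cxE.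
Qed.

Lemma class_C_jacobian_transition c d k :
  class_C k (overlap c d) (fun a => jacobian (transition c d) a).
Proof.
apply/(class_C_mxP _ _ (open_overlap c d)) => i j.
have [_ /(_ (delta_mx 0 i)) cD] := smooth_transition c d k.+1.
apply: class_C_eq (open_overlap c d) _ (class_C_coord 0 j (open_overlap c d) cD).
by move=> a oa; rewrite jacobianE//; exact: differentiable_transition.
Qed.

Lemma jacobian_transition_unit c d a : overlap c d a ->
  jacobian (transition c d) a \in unitmx.
Proof.
move=> [x [cx dx] <-]; exact: (jac_unit cx dx).
Qed.

Lemma class_C_cojac c d k : class_C k (overlap c d) (cojac c d).
Proof.
apply: class_C_trmx; first exact: open_overlap.
apply: class_C_invmx; [exact: open_overlap|exact: jacobian_transition_unit|].
exact: class_C_jacobian_transition.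
Qed.

Lemma differentiable_cojac c d a : overlap c d a -> differentiable (cojac c d) a.
Proof. by move=> oa; case: (class_C_cojac c d 1) => + _; exact. Qed.

Lemma derive_lsubmx_id m p (z v : 'rV[R]_(m + p)) : 'D_v lsubmx z = lsubmx v.
Proof. exact: (derive_linear _ _ (@continuous_lsubmx _ _ _ _)). Qed.

Lemma derive_rsubmx_id m p (z v : 'rV[R]_(m + p)) : 'D_v rsubmx z = rsubmx v.
Proof. exact: (derive_linear _ _ (@continuous_rsubmx _ _ _ _)). Qed.

Lemma differentiable_comp_lsubmx m p q r (f : 'rV[R]_m -> 'M[R]_(q, r))
    (z : 'rV[R]_(m + p)) :
  differentiable f (lsubmx z) -> differentiable (f \o lsubmx) z.
Proof. by move=> df; apply: differentiable_comp => //; exact: differentiable_lsubmx. Qed.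

Lemma derive_comp_lsubmx m p q r (f : 'rV[R]_m -> 'M[R]_(q, r)) (z v : 'rV[R]_(m + p)) :
  differentiable f (lsubmx z) ->
  'D_v (f \o lsubmx) z = 'D_(lsubmx v) f (lsubmx z).
Proof.
move=> df; rewrite derive_comp ?derive_lsubmx_id//; exact: differentiable_lsubmx.
Qed.

Lemma differentiable_slit_transition c d z : slit_overlap c d z ->
  differentiable (slit_transition c d) z.
Proof.
move=> oz; have [oa _] := oz.
have E := open_eq_near (open_slit_overlap c d) oz (fun y oy => esym (slit_transitionE oy)).
apply: near_eq_differentiable E _; apply: differentiable_row_mx.
  exact/differentiable_comp_lsubmx/differentiable_transition.
apply: differentiable_mulmx; first exact: differentiable_rsubmx.
exact/differentiable_comp_lsubmx/differentiable_cojac.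
Qed.

Lemma derive_slit_transition c d z v : slit_overlap c d z ->
  'D_v (slit_transition c d) z =
  row_mx (lsubmx v *m jacobian (transition c d) (lsubmx z))
         (rsubmx v *m cojac c d (lsubmx z) +
          rsubmx z *m 'D_(lsubmx v) (cojac c d) (lsubmx z)).
Proof.
move=> oz; have [oa _] := oz.
have dt := differentiable_transition oa; have dc := differentiable_cojac oa.
rewrite (open_eq_derive v (open_slit_overlap c d) oz (@slit_transitionE c d)).
rewrite derive_row_mx; first last.
- apply: differentiable_mulmx; first exact: differentiable_rsubmx.
  exact: (differentiable_comp_lsubmx dc).
- exact: (differentiable_comp_lsubmx dt).
rewrite derive_mulmx; first last.
- exact: (differentiable_comp_lsubmx dc).
- exact: differentiable_rsubmx.
have E1 := derive_comp_lsubmx v dt; have E2 := derive_comp_lsubmx v dc.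
have E3 := deriveEjacobian (lsubmx v) dt.
apply: congr2; first exact: etrans E1 E3.
apply: congr2; first by rewrite derive_rsubmx_id.
exact: congr1 E2.
Qed.

Lemma local_repE (c : chart S) (X : vfield) z : local_rep c X z =
  let u := chart_inv c z in
  'D_(X u) (slit_transition (chart_at A u.1) c) (coords_at S u).
Proof. by []. Qed.

End ManifoldCharts.

Section ClassCDerivatives.
Context {R : realType}.

Lemma class_C_derive (V W : normedModType R) k (A : set V) (f : V -> W) v :
  class_C k.+1 A f -> class_C k A ('D_v f).
Proof. by case=> _; exact. Qed.

Lemma class_C_diff (V W : normedModType R) (A : set V) (f : V -> W) z :
  (forall k, class_C k A f) -> A z -> differentiable f z.
Proof. by move=> /(_ 1%N)[+ _]; exact. Qed.

Lemma class_C_id (V : normedModType R) k (A : set V) : class_C k A (fun x : V => x).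
Proof.
case: k => [|k]; first by move=> x _.
split=> [x _|v]; first exact: ex_diff.
by under eq_fun do rewrite derive_id; exact: class_C_cst.
Qed.

End ClassCDerivatives.

(** * Cartan geometry in one chart *)

Section Homogeneity.
Context {R : realType} {n : nat}.
Implicit Types (z v : 'rV[R]_(n + n)) (l : R).

Definition fibre_scale l z : 'rV[R]_(n + n) := row_mx (lsubmx z) (l *: rsubmx z).

(** Components of C^* in any induced chart. *)
Definition radial z : 'rV[R]_(n + n) := row_mx 0 (rsubmx z).

Lemma fibre_scaleE l z : fibre_scale l z = z + (l - 1) *: radial z.
Proof.
rewrite /fibre_scale /radial -[X in X + _](hsubmxK z) scale_row_mx scaler0 add_row_mx addr0.
by rewrite scalerBl scale1r addrC subrK.
Qed.

Lemma differentiable_fibre_scale l z : differentiable (fibre_scale l) z.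
Proof.
apply: differentiable_row_mx; first exact: differentiable_lsubmx.
by apply: differentiableZ; exact: differentiable_rsubmx.
Qed.

Lemma derive_fibre_scale l z v : 'D_v (fibre_scale l) z = fibre_scale l v.
Proof.
rewrite derive_row_mx; [|exact: differentiable_lsubmx|]; last first.
  by apply: differentiableZ; exact: differentiable_rsubmx.
rewrite derive_lsubmx_id deriveZ ?derive_rsubmx_id//.
by apply: diff_derivable; exact: differentiable_rsubmx.
Qed.

Variable U : set 'rV[R]_(n + n).
Hypothesis oU : open U.
Hypothesis coneU : forall l z, 0 < l -> U z -> U (fibre_scale l z).

(** [fibre_scale l] is linear, hence its own derivative. The factor [b] stands for a power of [l],
    so that one statement serves every degree. *)
Lemma derive_homogeneous (W : normedModType R) (f : 'rV[R]_(n + n) -> W) (b l : R) z v :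
  0 < l -> (forall z, U z -> differentiable f z) ->
  (forall z, U z -> f (fibre_scale l z) = b *: f z) -> U z ->
  'D_(fibre_scale l v) f (fibre_scale l z) = b *: 'D_v f z.
Proof.
move=> l0 df hf Uz; rewrite -(derive_fibre_scale l z v).
have dfl := df _ (coneU l0 Uz).
rewrite -(derive_comp v (differentiable_fibre_scale l z) dfl).
rewrite (open_eq_derive v oU Uz hf) deriveZ//.
by apply: diff_derivable; exact: df.
Qed.

(* Euler's relation: along the ray through z the difference quotient is constant. *)
Lemma derive_radial (W : normedModType R) (f : 'rV[R]_(n + n) -> W) z :
  (forall l z, 0 < l -> U z -> f (fibre_scale l z) = l *: f z) -> U z ->
  'D_(radial z) f z = f z.
Proof.
move=> hf Uz; rewrite /derive; apply: lim_near_cst => //=.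
near=> h.
have h1 : 0 < 1 + h.
  have : `|h| < 1 by near: h; exact: dnbhs0_lt.
  rewrite ltr_norml => /andP[+ _]; lra.
have h0 : h != 0 by near: h; exact: nbhs_dnbhs_neq.
have -> : h *: radial z + z = fibre_scale (1 + h) z.
  by rewrite fibre_scaleE addrC [1 + h]addrC addrK.
by rewrite hf// scalerDl scale1r addrC addKr scalerA mulVf// scale1r.
Unshelve. all: by end_near. Qed.

End Homogeneity.

(** * The coefficients N and the projections they define *)

Section LocalGeometry.
Context {R : realType} {n : nat}.
Variables (M : manifold R n) (K : cotangent M -> R) (hK : cartan_structure K).
Variable c : chart (slit_cotangent M).
Notation U := (chart_codom c).
Notation L := (K2_loc K c).
Notation gu := (g_up K c).
Notation gd := (g_dn K c).
Notation ex i := (row_mx (delta_mx 0 i) 0 : 'rV[R]_(n + n)).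
Notation ep i := (row_mx 0 (delta_mx 0 i) : 'rV[R]_(n + n)).
Implicit Types (z v : 'rV[R]_(n + n)) (i j : 'I_n).

Let oU : open U := @open_slit_codom _ _ _ c.

Lemma fibre_scale_codom (l : R) z : 0 < l -> U z -> U (fibre_scale l z).
Proof.
move=> l0 /slit_codomP[cz z0]; apply/slit_codomP; rewrite row_mxKl row_mxKr; split=> //.
by rewrite scaler_eq0 negb_or gt_eqF.
Qed.

Lemma K2_smooth k : class_C k U L.
Proof.
have [_ sK _ _] := hK; rewrite /K2_loc; under eq_fun do rewrite expr2.
by apply: class_C_mul; [exact: oU|exact: sK|exact: sK].
Qed.

Lemma K2_homogeneous (l : R) z : 0 < l -> L (fibre_scale l z) = l ^+ 2 *: L z.
Proof.
move=> l0; have [_ _ hom _] := hK.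
rewrite /K2_loc /fibre_scale /cotangent_inv row_mxKl row_mxKr /=.
by rewrite /covec_change -scalemxAl hom// exprMn.
Qed.

Definition p_upv z : 'rV[R]_n := \row_i p_up K c z i.
Definition dx_p_up z : 'M[R]_n := \matrix_(i, j) d_x i (fun y => p_up K c y j) z.
Definition dx_K2 z : 'rV[R]_n := \row_i (2^-1 * d_x i L z).
(* Hamiltonian vector field of K^2 / 2 *)
Definition ham z : 'rV[R]_(n + n) := row_mx (p_upv z) (- dx_K2 z).

Lemma class_C_p_upv k : class_C k U p_upv.
Proof.
apply/(class_C_mxP _ _ oU) => i j; under eq_fun do rewrite mxE.
apply: class_C_mul => //; first exact: class_C_cst.
by apply: class_C_derive; exact: K2_smooth.
Qed.

Lemma class_C_dx_K2 k : class_C k U dx_K2.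
Proof.
apply/(class_C_mxP _ _ oU) => i j; under eq_fun do rewrite mxE.
apply: class_C_mul => //; first exact: class_C_cst.
by apply: class_C_derive; exact: K2_smooth.
Qed.

Lemma class_C_g_up k : class_C k U gu.
Proof.
apply/(class_C_mxP _ _ oU) => i j; under eq_fun do rewrite mxE.
apply: class_C_mul => //; first exact: class_C_cst.
by do 2!apply: class_C_derive; exact: K2_smooth.
Qed.

Lemma K2_diff z : U z -> differentiable L z.
Proof. exact/class_C_diff/K2_smooth. Qed.

Lemma p_upv_diff z : U z -> differentiable p_upv z.
Proof. exact/class_C_diff/class_C_p_upv. Qed.

Lemma p_up_diff j z : U z -> differentiable (fun y => p_up K c y j) z.
Proof.
move=> /p_upv_diff/differentiable_mxP/(_ 0 j).
by under eq_fun do rewrite mxE.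
Qed.

Lemma derive_p_upv v z j : U z ->
  ('D_v p_upv z) 0 j = 'D_v (fun y => p_up K c y j) z.
Proof.
move=> Uz; rewrite (derive_mxE _ _ _ (p_upv_diff Uz)).
by under eq_fun do rewrite mxE.
Qed.

Lemma row_vec_sum (w : 'rV[R]_n) : row_mx w 0 = \sum_i w 0 i *: ex i.
Proof.
under eq_bigr do rewrite scale_row_mx scaler0.
rewrite [in LHS](row_sum_delta w); elim/big_rec2 : _ => [|i x y _ <-].
  by rewrite row_mx0.
by rewrite add_row_mx addr0.
Qed.

Lemma covec_sum (w : 'rV[R]_n) : row_mx 0 w = \sum_i w 0 i *: ep i.
Proof.
under eq_bigr do rewrite scale_row_mx scaler0.
rewrite [in LHS](row_sum_delta w); elim/big_rec2 : _ => [|i x y _ <-].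
  by rewrite row_mx0.
by rewrite add_row_mx addr0.
Qed.

Lemma derive_vec_sum (W : normedModType R) (f : 'rV[R]_(n + n) -> W) z (w : 'rV_n) :
  differentiable f z -> 'D_(row_mx w 0) f z = \sum_i w 0 i *: 'D_(ex i) f z.
Proof.
move=> df; rewrite row_vec_sum derive_sumv//; apply: eq_bigr => i _.
exact: deriveZv.
Qed.

Lemma derive_covec_sum (W : normedModType R) (f : 'rV[R]_(n + n) -> W) z (w : 'rV_n) :
  differentiable f z -> 'D_(row_mx 0 w) f z = \sum_i w 0 i *: 'D_(ep i) f z.
Proof.
move=> df; rewrite covec_sum derive_sumv//; apply: eq_bigr => i _.
exact: deriveZv.
Qed.

Lemma derive_p_upv_fibre z (w : 'rV_n) : U z -> 'D_(row_mx 0 w) p_upv z = w *m gu z.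
Proof.
move=> Uz; apply/rowP => j; rewrite (derive_p_upv _ _ Uz).
rewrite (derive_covec_sum _ (p_up_diff j Uz)) mxE; apply: eq_bigr => i _.
rewrite mxE; congr (_ * _); rewrite /p_up.
have dL : differentiable (d_p j L) z.
  exact: class_C_diff (fun k => class_C_derive _ (K2_smooth k.+1)) Uz.
have -> : (fun y => 2^-1 * d_p j L y) = 2^-1 \*: d_p j L by [].
by apply: deriveZ; exact: diff_derivable.
Qed.

Lemma derive_p_upv_base z (w : 'rV_n) : U z -> 'D_(row_mx w 0) p_upv z = w *m dx_p_up z.
Proof.
move=> Uz; apply/rowP => j; rewrite (derive_p_upv _ _ Uz).
rewrite (derive_vec_sum _ (p_up_diff j Uz)) mxE; apply: eq_bigr => i _.
by rewrite mxE.
Qed.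

Lemma g_up_sym z : U z -> (gu z)^T = gu z.
Proof.
move=> Uz; apply/matrixP => i j; rewrite mxE.
rewrite [LHS]mxE [RHS]mxE; apply: congr1.
exact: derive_comm_scalar oU Uz (K2_smooth 2).
Qed.

Lemma g_up_pos z (w : 'rV_n) : U z -> w != 0 -> 0 < (w *m gu z *m w^T) 0 0.
Proof. by have [_ _ _ pos] := hK; move=> Uz w0; exact: (pos c z Uz w w0). Qed.

(** A nonzero row in the kernel would be isotropic for a positive definite form. *)
Lemma g_up_unit z : U z -> gu z \in unitmx.
Proof.
move=> Uz; rewrite -row_free_unit -kermx_eq0; apply/eqP/row_matrixP => i.
rewrite row0; apply/eqP/negPn/negP => r0.
have := g_up_pos Uz r0.
by rewrite -row_mul mulmx_ker row0 mul0mx mxE ltxx.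
Qed.

Lemma g_dn_unit z : U z -> gd z \in unitmx.
Proof. by move=> Uz; rewrite unitmx_inv; exact: g_up_unit. Qed.

Lemma class_C_g_dn k : class_C k U gd.
Proof. by apply: class_C_invmx; [exact: oU|exact: g_up_unit|exact: class_C_g_up]. Qed.

Lemma g_dn_diff z : U z -> differentiable gd z.
Proof. exact/class_C_diff/class_C_g_dn. Qed.

Lemma g_dn_sym z : U z -> (gd z)^T = gd z.
Proof. by move=> Uz; rewrite trmx_inv g_up_sym. Qed.

Lemma derive_g_dn_sym v z : U z -> ('D_v gd z)^T = 'D_v gd z.
Proof.
move=> Uz; rewrite -(derive_trmx v (g_dn_diff Uz)).
exact: open_eq_derive oU Uz g_dn_sym.
Qed.

(** The form of [g_dn] at [w] is the form of [g_up] at [w *m gd z]. *)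
Lemma g_dn_pos z (w : 'rV_n) : U z -> w != 0 -> 0 < (w *m gd z *m w^T) 0 0.
Proof.
move=> Uz w0; have ug := g_up_unit Uz.
have := @g_up_pos z (w *m gd z) Uz; rewrite mulmx_unit_neq0 ?g_dn_unit// => /(_ w0).
by rewrite trmx_mul g_dn_sym// -mulmxA mulmxA mulmxKV// mulmxA.
Qed.

Lemma fibre_scale_ep l i : fibre_scale l (ep i) = l *: ep i.
Proof. by rewrite /fibre_scale row_mxKl row_mxKr scale_row_mx scaler0. Qed.

Lemma fibre_scale_ex l i : fibre_scale l (ex i) = ex i.
Proof. by rewrite /fibre_scale row_mxKl row_mxKr scaler0. Qed.

(** A momentum derivative lowers the degree by one, because [fibre_scale l] multiplies [ep i] by
    [l]; it fixes [ex i], so an x-derivative keeps the degree. *)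
Lemma d_p_homogeneous (f : 'rV[R]_(n + n) -> R) (b l : R) i z : 0 < l ->
  (forall z, U z -> differentiable f z) ->
  (forall z, U z -> f (fibre_scale l z) = b * f z) -> U z ->
  l * d_p i f (fibre_scale l z) = b * d_p i f z.
Proof.
move=> l0 df hf Uz.
have := derive_homogeneous oU fibre_scale_codom (ep i) l0 df hf Uz.
rewrite fibre_scale_ep deriveZv//; exact/df/fibre_scale_codom.
Qed.

Lemma d_x_homogeneous (f : 'rV[R]_(n + n) -> R) (b l : R) i z : 0 < l ->
  (forall z, U z -> differentiable f z) ->
  (forall z, U z -> f (fibre_scale l z) = b * f z) -> U z ->
  d_x i f (fibre_scale l z) = b * d_x i f z.
Proof.
move=> l0 df hf Uz.
have := derive_homogeneous oU fibre_scale_codom (ex i) l0 df hf Uz.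
by rewrite fibre_scale_ex.
Qed.

Lemma p_up_homogeneous (l : R) z j : 0 < l -> U z ->
  p_up K c (fibre_scale l z) j = l * p_up K c z j.
Proof.
move=> l0 Uz; rewrite /p_up.
have := d_p_homogeneous j l0 K2_diff (fun z _ => K2_homogeneous z l0) Uz.
rewrite expr2 -mulrA => /(mulfI (lt0r_neq0 l0)) ->; exact: mulrCA.
Qed.

Lemma p_upv_homogeneous (l : R) z : 0 < l -> U z ->
  p_upv (fibre_scale l z) = l *: p_upv z.
Proof. by move=> l0 Uz; apply/rowP => j; rewrite !mxE p_up_homogeneous. Qed.

Lemma g_upE i j z : U z -> gu z i j = d_p i (fun y => p_up K c y j) z.
Proof.
move=> Uz; rewrite mxE /p_up.
have dL : differentiable (d_p j L) z.
  exact: class_C_diff (fun k => class_C_derive _ (K2_smooth k.+1)) Uz.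
have -> : (fun y => 2^-1 * d_p j L y) = 2^-1 \*: d_p j L by [].
by apply/esym; apply: deriveZ; exact: diff_derivable.
Qed.

Lemma g_up_homogeneous (l : R) z : 0 < l -> U z -> gu (fibre_scale l z) = gu z.
Proof.
move=> l0 Uz; apply/matrixP => i j.
apply: etrans (g_upE i j (fibre_scale_codom l0 Uz)) _; apply: etrans (esym (g_upE i j Uz)).
apply: (mulfI (lt0r_neq0 l0)).
apply: d_p_homogeneous => // y Uy; first exact: p_up_diff.
exact: p_up_homogeneous.
Qed.

Lemma g_dn_homogeneous (l : R) z : 0 < l -> U z -> gd (fibre_scale l z) = gd z.
Proof. by move=> l0 Uz; rewrite /g_dn g_up_homogeneous. Qed.

Lemma dx_p_up_homogeneous (l : R) z : 0 < l -> U z ->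
  dx_p_up (fibre_scale l z) = l *: dx_p_up z.
Proof.
move=> l0 Uz; apply/matrixP => i j; rewrite !mxE.
apply: d_x_homogeneous => // y Uy; first exact: p_up_diff.
exact: p_up_homogeneous.
Qed.

Lemma dx_K2_homogeneous (l : R) z : 0 < l -> U z ->
  dx_K2 (fibre_scale l z) = l ^+ 2 *: dx_K2 z.
Proof.
move=> l0 Uz; apply/rowP => i; rewrite !mxE.
rewrite (d_x_homogeneous i l0 K2_diff (fun z _ => K2_homogeneous z l0) Uz).
exact: mulrCA.
Qed.

Lemma ham_homogeneous (l : R) z : 0 < l -> U z ->
  ham (fibre_scale l z) = l *: fibre_scale l (ham z).
Proof.
move=> l0 Uz; rewrite /ham /fibre_scale row_mxKl row_mxKr scale_row_mx.
by rewrite -/(fibre_scale l z) p_upv_homogeneous// dx_K2_homogeneous// scalerA -scalerN.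
Qed.

Lemma derive_ham_g_dn_homogeneous (l : R) z : 0 < l -> U z ->
  'D_(ham (fibre_scale l z)) gd (fibre_scale l z) = l *: 'D_(ham z) gd z.
Proof.
move=> l0 Uz; rewrite ham_homogeneous// deriveZv; last exact/g_dn_diff/fibre_scale_codom.
have hg y : U y -> gd (fibre_scale l y) = 1 *: gd y.
  by move=> Uy; rewrite scale1r g_dn_homogeneous.
have := derive_homogeneous oU fibre_scale_codom (ham z) l0 g_dn_diff hg Uz.
by rewrite scale1r => ->.
Qed.

(** Euler's relation for p^i, homogeneous of degree 1: its radial derivative is itself, and its
    derivatives along the fibre are the entries of [g_up]. *)
Lemma p_upvE z : U z -> rsubmx z *m gu z = p_upv z.
Proof.
move=> Uz; rewrite -derive_p_upv_fibre//; apply: derive_radial Uz => l y l0 Uy.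
exact: p_upv_homogeneous.
Qed.

Lemma p_dnE z : U z -> rsubmx z = p_upv z *m gd z.
Proof. by move=> Uz; rewrite -p_upvE// mulmxK// g_up_unit. Qed.

(** [derive_radial] covers degree 1, so Euler's relation is taken for K and carried over to K^2 by
    the product rule; the radial derivative 2 K^2 is then expanded into p_i d K^2 / d p_i. *)
Lemma K2E z : U z -> L z = (p_upv z *m (rsubmx z)^T) 0 0.
Proof.
move=> Uz; pose Kc := K \o cotangent_inv c : 'rV[R]_(n + n) -> R.
have [_ sK hom _] := hK.
have dK : differentiable Kc z by apply: class_C_diff Uz; exact: sK.
have EK : 'D_(radial z) Kc z = Kc z.
  apply: derive_radial Uz => l y l0 _.
  rewrite /Kc /fibre_scale/= /cotangent_inv row_mxKl row_mxKr.
  by rewrite /covec_change -scalemxAl hom.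
have EL : 'D_(radial z) L z = 2 * L z.
  have -> : L = fun y => Kc y * Kc y by apply/funext => y; rewrite /K2_loc expr2.
  by rewrite deriveM_diff// EK mulrDl mul1r.
have n2 : (2 : R) != 0 by rewrite pnatr_eq0.
rewrite -[LHS](mulKf n2) -EL /radial.
rewrite (derive_covec_sum _ (K2_diff Uz)) mxE mulr_sumr; apply: eq_bigr => i _.
by rewrite [p_upv z 0 i]mxE [_^T i 0]mxE /p_up -mulrA [d_p _ _ _ * _]mulrC.
Qed.

(** Obtained by differentiating K^2 = p^j p_j in x^i at fixed momenta. *)
Lemma dx_K2E z : U z -> dx_K2 z = 2^-1 *: (rsubmx z *m (dx_p_up z)^T).
Proof.
move=> Uz; apply/rowP => i; rewrite !mxE; congr (_ * _).
have dr := @differentiable_rsubmx R 1 n n z.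
have dp := p_upv_diff Uz.
rewrite /d_x (open_eq_derive _ oU Uz K2E).
have dm : differentiable (fun y => p_upv y *m (rsubmx y)^T) z.
  by apply: differentiable_mulmx => //; exact: differentiable_trmx.
rewrite -(derive_mxE _ _ _ dm) (derive_mulmx _ dp (differentiable_trmx dr)).
rewrite (derive_trmx _ dr) derive_rsubmx_id row_mxKr trmx0 mulmx0 addr0.
rewrite derive_p_upv_base// -rowE mxE; apply: eq_bigr => j _.
by rewrite !mxE mulrC.
Qed.

(** The left-hand side of p_j = p^i g_ij is constant when only x varies, so the product rule
    exchanges x-derivatives of the metric for x-derivatives of p^i. *)
Lemma p_upv_derive_g_dn z (w : 'rV_n) : U z ->
  p_upv z *m 'D_(row_mx w 0) gd z = - (w *m dx_p_up z *m gd z).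
Proof.
move=> Uz; have dp := p_upv_diff Uz; have dg := g_dn_diff Uz.
have E := open_eq_derive (row_mx w 0) oU Uz p_dnE.
have E2 := derive_mulmx (row_mx w 0) dp dg.
have {E2}E := etrans E E2.
move: E; rewrite derive_rsubmx_id row_mxKr derive_p_upv_base// => /esym/eqP.
by rewrite addrC addr_eq0 => /eqP.
Qed.

Lemma sum_contract m (b : R) (p : 'rV[R]_m) (G : 'M[R]_m) (T : 'I_m -> R) :
  \sum_l (b * \sum_s G l s * T s) * p 0 l = b * \sum_s (p *m G) 0 s * T s.
Proof.
under eq_bigr do rewrite -mulrA mulr_suml.
rewrite -mulr_sumr exchange_big; congr (_ * _); apply: eq_bigr => s _.
by rewrite mxE mulr_suml; apply: eq_bigr => l _; rewrite mulrAC [p _ _ * _]mulrC.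
Qed.

Let half_sum (a b d : R) : 2^-1 * (- b - a - d) = - 2^-1 * (d + a + b).
Proof. ring. Qed.

Let addr_rot (V : zmodType) (a b d e : V) : a - b + d + e = a + d + e - b.
Proof. by rewrite addrAC -[in RHS]addrA [in RHS]addrAC -!addrA; congr (_ + _); rewrite addrCA. Qed.

(** Since p_i g^{is} = p^s, the contraction leaves three sums of p^s times a derivative of the
    metric. With Q for [dx_p_up], two of them become - Q g and its transpose by [p_upv_derive_g_dn];
    the third is the derivative of g along p^s d/dx^s. *)
Lemma gamma0E z : U z -> \matrix_(i, j) gamma0 K c i j z =
  - 2^-1 *: ('D_(row_mx (p_upv z) 0) gd z + dx_p_up z *m gd z + (dx_p_up z *m gd z)^T).
Proof.
move=> Uz; have dg := g_dn_diff Uz; have uE := p_upvE Uz.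
apply/matrixP => i j; rewrite mxE /gamma0 /gamma /p_dn.
have := sum_contract 2^-1 (rsubmx z) (gu z)
  (fun s => d_x j (fun y => gd y i s) z + d_x i (fun y => gd y s j) z
     - d_x s (fun y => gd y i j) z).
move=> ->; rewrite uE.
have T1 : \sum_s p_upv z 0 s * d_x j (fun y => gd y i s) z
    = - (dx_p_up z *m gd z) j i.
  have := p_upv_derive_g_dn (delta_mx 0 j) Uz.
  rewrite -mulmxA -rowE => /rowP/(_ i).
  rewrite mxE => E; rewrite [RHS](_ : _ = (- row j (dx_p_up z *m gd z)) 0 i); last by rewrite !mxE.
  rewrite -E; apply: eq_bigr => s _; congr (_ * _).
  by rewrite -[in RHS](derive_g_dn_sym _ Uz) [RHS]mxE (derive_mxE _ _ _ dg).
have T2 : \sum_s p_upv z 0 s * d_x i (fun y => gd y s j) z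
    = - (dx_p_up z *m gd z) i j.
  have := p_upv_derive_g_dn (delta_mx 0 i) Uz.
  rewrite -mulmxA -rowE => /rowP/(_ j).
  rewrite mxE => E; rewrite [RHS](_ : _ = (- row i (dx_p_up z *m gd z)) 0 j); last by rewrite !mxE.
  rewrite -E; apply: eq_bigr => s _; congr (_ * _).
  by rewrite (derive_mxE _ _ _ dg).
have T3 : \sum_s p_upv z 0 s * d_x s (fun y => gd y i j) z
    = ('D_(row_mx (p_upv z) 0) gd z) i j.
  rewrite (derive_vec_sum _ dg) summxE; apply: eq_bigr => s _.
  by rewrite [RHS]mxE (derive_mxE _ _ _ dg).
under eq_bigr do rewrite mulrBr mulrDr.
rewrite sumrB big_split/= T1 T2 T3.
rewrite [RHS]mxE [in RHS]mxE [in RHS]mxE [_^T _ _]mxE.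
exact: half_sum.
Qed.

(** A second contraction of [gamma0E], now with p^k: p^k (Q g)_{kj} cancels against the derivative
    of g along p^s d/dx^s by [p_upv_derive_g_dn]. What is left, p^k (Q g)_{jk}, is p_i d p^i / d
    x^j, that is, twice [dx_K2]. *)
Lemma gamma00E z j : U z -> gamma00 K c j z = - dx_K2 z 0 j.
Proof.
move=> Uz; rewrite /gamma00.
rewrite exchange_big/=.
transitivity ((p_upv z *m (\matrix_(i, k) gamma0 K c i k z)^T) 0 j).
  rewrite mxE; apply: eq_bigr => k _.
  rewrite ![in RHS]mxE mulrC mulr_suml; apply: eq_bigr => i _.
  by [].
rewrite gamma0E// !linearZ/= !linearD/= trmxK (derive_g_dn_sym _ Uz).
rewrite p_upv_derive_g_dn// trmx_mul (g_dn_sym Uz).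
rewrite [p_upv z *m (gd z *m _)]mulmxA -(p_dnE Uz) (dx_K2E Uz).
rewrite mulmxA addrAC -scalerDr addNr scaler0 add0r.
by rewrite [LHS]mxE [in RHS]mxE mulNr.
Qed.

(** Up to the common factor -1/2, [gamma00E] turns the term with d g / d p_h into the derivative of
    g along the momentum part of [ham], and [gamma0E] supplies the derivative along its base
    part. *)
Lemma N_connE z : U z -> N_conn K c z =
  - 2^-1 *: ('D_(ham z) gd z + dx_p_up z *m gd z + (dx_p_up z *m gd z)^T).
Proof.
move=> Uz; have dg := g_dn_diff Uz.
have -> : ham z = row_mx (p_upv z) 0 - row_mx 0 (dx_K2 z).
  by rewrite /ham opp_row_mx add_row_mx oppr0 addr0 add0r.
rewrite deriveDv// deriveNv//.
have := gamma0E Uz; set D1 := 'D_(row_mx (p_upv z) 0) gd z; set A := _ *m _ => E.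
rewrite (@addr_rot 'M[R]_n D1) scalerBr -E; apply/matrixP => i j.
rewrite mxE [RHS]mxE mxE; congr (_ + _).
rewrite !mxE mulNr opprK (derive_covec_sum _ dg) summxE -mulrN; congr (_ * _).
rewrite -sumrN; apply: eq_bigr => h _.
by rewrite gamma00E// [RHS]mxE mulNr opprK (derive_mxE _ _ _ dg).
Qed.

(** [class_C] speaks of derivatives in constant directions, whereas [ham z] moves with [z]; the
    derivative is therefore expanded over the coordinate directions. *)
Lemma class_C_derive_ham_g_dn k : class_C k U (fun z => 'D_(ham z) gd z).
Proof.
apply: (@class_C_eq _ _ _ k U (fun z => \sum_i p_upv z 0 i *: 'D_(ex i) gd z +
   \sum_i (-1 * dx_K2 z 0 i) *: 'D_(ep i) gd z)) => //.
  move=> z Uz; have dg := g_dn_diff Uz.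
  have -> : ham z = row_mx (p_upv z) 0 + row_mx 0 (- dx_K2 z).
    by rewrite add_row_mx addr0 add0r.
  rewrite (deriveDv _ _ dg) (derive_vec_sum _ dg) (derive_covec_sum _ dg).
  by congr (_ + _); apply: eq_bigr => i _; congr (_ *: _); rewrite [RHS]mxE mulN1r.
apply: class_C_add => //; apply: class_C_bigsum => // i; apply: class_C_scale => //.
- exact: class_C_coord (class_C_p_upv _).
- by apply: class_C_derive; exact: class_C_g_dn.
- apply: class_C_mul => //; first exact: class_C_cst.
  exact: class_C_coord (class_C_dx_K2 _).
- by apply: class_C_derive; exact: class_C_g_dn.
Qed.

Lemma class_C_dx_p_up k : class_C k U dx_p_up.
Proof.
apply/(class_C_mxP _ _ oU) => i j; under eq_fun do rewrite mxE.
apply: class_C_derive; apply: class_C_mul => //; first exact: class_C_cst.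
by apply: class_C_derive; exact: K2_smooth.
Qed.

Lemma class_C_N_conn k : class_C k U (N_conn K c).
Proof.
have cA : class_C k U (fun z => dx_p_up z *m gd z).
  by apply: class_C_mulmx => //; [exact: class_C_dx_p_up|exact: class_C_g_dn].
apply: class_C_eq oU (fun z Uz => esym (N_connE Uz)) _.
apply: class_C_scale => //; first exact: class_C_cst.
apply: class_C_add => //; last exact: class_C_trmx.
by apply: class_C_add => //; exact: class_C_derive_ham_g_dn.
Qed.

Lemma N_conn_diff z : U z -> differentiable (N_conn K c) z.
Proof. exact/class_C_diff/class_C_N_conn. Qed.

Lemma N_conn_homogeneous (l : R) z : 0 < l -> U z ->
  N_conn K c (fibre_scale l z) = l *: N_conn K c z.
Proof.
move=> l0 Uz; have Ulz := fibre_scale_codom l0 Uz.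
rewrite (N_connE Ulz) (N_connE Uz) derive_ham_g_dn_homogeneous//.
rewrite dx_p_up_homogeneous// g_dn_homogeneous// -scalemxAl linearZ/=.
by rewrite -!scalerDr scalerA mulrC -scalerA.
Qed.

Lemma derive_radial_N_conn z : U z -> 'D_(radial z) (N_conn K c) z = N_conn K c z.
Proof. by move=> Uz; apply: derive_radial Uz => l y; exact: N_conn_homogeneous. Qed.

Definition delta_pv z v : 'rV[R]_n := rsubmx v - lsubmx v *m N_conn K c z.

Lemma delta_pE z v i : delta_p K c z i v = delta_pv z v 0 i.
Proof.
by rewrite !mxE /delta_p; congr (_ - _); [rewrite mxE|apply: eq_bigr => j _; rewrite mulrC].
Qed.

Lemma bilinear_formE (g : 'M[R]_n) (a b : 'rV[R]_n) :
  \sum_i \sum_j g i j * a 0 i * b 0 j = (a *m g *m b^T) 0 0.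
Proof.
rewrite exchange_big mxE; apply: eq_bigr => j _.
rewrite !mxE mulr_suml; apply: eq_bigr => i _.
by rewrite [g i j * _]mulrC.
Qed.

Lemma G_locE z v w : G_loc K c z v w =
  (lsubmx v *m gd z *m (lsubmx w)^T + delta_pv z v *m gu z *m (delta_pv z w)^T) 0 0.
Proof.
rewrite /G_loc bilinear_formE [RHS]mxE; congr (_ + _).
rewrite -bilinear_formE; apply: eq_bigr => i _; apply: eq_bigr => j _.
by rewrite !delta_pE.
Qed.

Lemma delta_pvB z v w : delta_pv z (v - w) = delta_pv z v - delta_pv z w.
Proof. by rewrite /delta_pv !linearB/= mulmxBl !opprD !opprK addrACA. Qed.

Lemma G_locB z v v' w : G_loc K c z (v - v') w = G_loc K c z v w - G_loc K c z v' w.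
Proof.
rewrite !G_locE delta_pvB linearB/= !mulmxBl.
by rewrite addrACA -opprD [LHS]mxE [X in _ + X]mxE.
Qed.

(** In the adapted coframe G is the sum of two definite forms, one in the base part and one in
    [delta_pv], so both parts vanish. *)
Lemma G_loc_eq0 z v : U z -> G_loc K c z v v = 0 -> v = 0.
Proof.
move=> Uz; rewrite G_locE mxE => /eqP.
have gd0 (w : 'rV_n) : 0 <= (w *m gd z *m w^T) 0 0.
  by have [->|/(g_dn_pos Uz)/ltW//] := eqVneq w 0; rewrite !mul0mx mxE.
have gu0 (w : 'rV_n) : 0 <= (w *m gu z *m w^T) 0 0.
  by have [->|/(g_up_pos Uz)/ltW//] := eqVneq w 0; rewrite !mul0mx mxE.
rewrite paddr_eq0// => /andP[l0 d0].
have lv : lsubmx v = 0.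
  by apply/eqP/negPn/negP => /(g_dn_pos Uz); rewrite (eqP l0) ltxx.
have dv : delta_pv z v = 0.
  by apply/eqP/negPn/negP => /(g_up_pos Uz); rewrite (eqP d0) ltxx.
move: dv; rewrite /delta_pv lv mul0mx subr0 => rv.
by rewrite -(hsubmxK v) lv rv row_mx0.
Qed.

Definition hpart z v : 'rV[R]_(n + n) := row_mx (lsubmx v) (lsubmx v *m N_conn K c z).

Definition vpart z v : 'rV[R]_(n + n) := row_mx 0 (delta_pv z v).

(** The square of C^* for G; over the chart it equals K^2, by [p_upvE] and [K2E]. *)
Definition radial_sq z : R := (rsubmx z *m gu z *m (rsubmx z)^T) 0 0.

(** Coefficient of C^* in the orthogonal projection of the vertical part of [v] onto the line of
    C^*. *)
Definition radial_coef z v : R :=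
  (delta_pv z v *m gu z *m (rsubmx z)^T) 0 0 / radial_sq z.

Definition lpart z v : 'rV[R]_(n + n) := radial_coef z v *: radial z.

Lemma hpart_vpart z v : hpart z v + vpart z v = v.
Proof. by rewrite add_row_mx addr0 addrC subrK hsubmxK. Qed.

Lemma radial_sq_neq0 z : U z -> radial_sq z != 0.
Proof.
by move=> Uz; apply/lt0r_neq0/(g_up_pos Uz); case/slit_codomP : Uz.
Qed.

Lemma delta_pv_linear z a v w : delta_pv z (a *: v + w) = a *: delta_pv z v + delta_pv z w.
Proof.
by rewrite /delta_pv !linearP/= mulmxDl -scalemxAl scalerBr opprD addrACA.
Qed.

Lemma vpart_linear z a v w : vpart z (a *: v + w) = a *: vpart z v + vpart z w.
Proof. by rewrite /vpart delta_pv_linear scale_row_mx add_row_mx scaler0 addr0. Qed.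

Lemma radial_coef_linear z a v w :
  radial_coef z (a *: v + w) = a * radial_coef z v + radial_coef z w.
Proof.
rewrite /radial_coef delta_pv_linear; move: (delta_pv z v) (delta_pv z w) => x y.
rewrite !mulmxDl -!scalemxAl mulrA -mulrDl.
move: (x *m _ *m _) (y *m _ *m _) => A B; rewrite [in LHS]mxE.
by rewrite [X in (X + _) / _]mxE.
Qed.

Lemma lpart_linear z a v w : lpart z (a *: v + w) = a *: lpart z v + lpart z w.
Proof. by rewrite /lpart radial_coef_linear scalerDl scalerA. Qed.

Lemma delta_pv_hpart z v : delta_pv z (hpart z v) = 0.
Proof. by rewrite /delta_pv row_mxKl row_mxKr subrr. Qed.

Lemma delta_pv_vert z (w : 'rV[R]_n) : delta_pv z (row_mx 0 w) = w.
Proof. by rewrite /delta_pv row_mxKl row_mxKr mul0mx subr0. Qed.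

Lemma lpart_hpart z v : lpart z (hpart z v) = 0.
Proof. by rewrite /lpart /radial_coef delta_pv_hpart !mul0mx mxE mul0r scale0r. Qed.

Lemma lpart_vpart z v : lpart z (vpart z v) = lpart z v.
Proof. by rewrite /lpart /radial_coef delta_pv_vert. Qed.

Lemma vpart_vert z (w : 'rV[R]_n) : vpart z (row_mx 0 w) = row_mx 0 w.
Proof. by rewrite /vpart delta_pv_vert. Qed.

Lemma lpart_vert z v : lpart z v = row_mx 0 (radial_coef z v *: rsubmx z).
Proof. by rewrite /lpart scale_row_mx scaler0. Qed.

Lemma radial_coef_radial z a : U z -> radial_coef z (a *: radial z) = a.
Proof.
move=> Uz; have := radial_coef_linear z a (radial z) 0; rewrite addr0 => ->.
rewrite /radial_coef delta_pv_vert divff ?radial_sq_neq0// mulr1.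
have -> : delta_pv z 0 = 0 by rewrite -(row_mx0 R 1 n n) delta_pv_vert.
by rewrite !mul0mx mxE mul0r addr0.
Qed.

Lemma lpart_radial z a : U z -> lpart z (a *: radial z) = a *: radial z.
Proof. by move=> Uz; rewrite /lpart radial_coef_radial. Qed.

Lemma lpart_idem z v : U z -> lpart z (lpart z v) = lpart z v.
Proof. by move=> Uz; rewrite {2}/lpart lpart_radial. Qed.

Lemma G_loc_sym z v w : U z -> G_loc K c z v w = G_loc K c z w v.
Proof.
move=> Uz; rewrite !G_locE -[in LHS](trmxK (lsubmx v *m _ *m _ + _)) [LHS]mxE.
congr (fun_of_matrix _ _ _); rewrite linearD/= !trmx_mul !trmxK.
by rewrite g_dn_sym// g_up_sym// !mulmxA.
Qed.

Section SmoothParts.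
Variables (k : nat) (X : 'rV[R]_(n + n) -> 'rV[R]_(n + n)).
Hypothesis cX : class_C k U X.

Let crs : class_C k U (rsubmx : 'rV[R]_(n + n) -> 'rV[R]_n).
Proof. by apply: class_C_rsubmx => //; exact: class_C_id. Qed.

Lemma class_C_delta_pv : class_C k U (fun z => delta_pv z (X z)).
Proof.
apply: (@class_C_eq _ _ _ k U
  (fun z => rsubmx (X z) + (-1) *: (lsubmx (X z) *m N_conn K c z))) => //.
  by move=> z _; rewrite scaleN1r.
apply: class_C_add => //; first exact: class_C_rsubmx.
apply: class_C_scale => //; first exact: class_C_cst.
by apply: class_C_mulmx => //; [exact: class_C_lsubmx|exact: class_C_N_conn].
Qed.

Lemma class_C_vpart : class_C k U (fun z => vpart z (X z)).
Proof.
by apply: class_C_row_mx => //; [exact: class_C_cst|exact: class_C_delta_pv].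
Qed.

Lemma class_C_radial_coef : class_C k U (fun z => radial_coef z (X z)).
Proof.
have cT := class_C_trmx oU crs; have cg := class_C_g_up k.
apply: class_C_mul => //.
  apply: class_C_coord => //; apply: class_C_mulmx => //.
  by apply: class_C_mulmx => //; exact: class_C_delta_pv.
apply: class_C_inv => //; first exact: radial_sq_neq0.
by apply: class_C_coord => //; do 2!apply: class_C_mulmx => //.
Qed.

Lemma class_C_lpart : class_C k U (fun z => lpart z (X z)).
Proof.
apply: class_C_scale => //; first exact: class_C_radial_coef.
by apply: class_C_row_mx => //; exact: class_C_cst.
Qed.

End SmoothParts.

End LocalGeometry.

(** * Change of coordinates *)

Section ChartChange.
Context {R : realType} {n : nat}.
Variables (M : manifold R n) (K : cotangent M -> R) (hK : cartan_structure K).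
Variables c d : chart (mfd_atlas M).
Let cS : chart (slit_cotangent M) := c.
Let dS : chart (slit_cotangent M) := d.
Notation F := (slit_transition c d).
Notation O := (slit_overlap c d).
Notation D a := (jacobian (transition c d) a).
Notation C a := (cojac c d a).
Implicit Types (z : 'rV[R]_(n + n)) (v w : 'rV[R]_n).

Let oO : open O := @open_slit_overlap _ _ M c d.

Let overlap_codom z : O z -> chart_codom cS z.
Proof. exact: slit_overlap_codom. Qed.

Lemma slit_transition_codom z : O z -> chart_codom dS (F z).
Proof.
move=> oz; have [/overlapP[_ dx] _] := oz.
exists (cotangent_inv c z) => //; split=> //.
by have [] := slit_codom_dom (overlap_codom oz).
Qed.

Lemma cotangent_inv_transition z : O z -> cotangent_inv d (F z) = cotangent_inv c z.
Proof. by move=> [/overlapP[_ dx] _]; exact: cotangent_mapK. Qed.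

Lemma K2_transition z : O z -> K2_loc K c z = K2_loc K d (F z).
Proof. by move=> oz; rewrite /K2_loc cotangent_inv_transition. Qed.

Lemma jacobian_mul_cojacT a : overlap c d a -> D a *m (C a)^T = 1%:M.
Proof. by move=> oa; rewrite trmxK mulmxV// jacobian_transition_unit. Qed.

Lemma cojacT_mul_jacobian a : overlap c d a -> (C a)^T *m D a = 1%:M.
Proof. by move=> oa; rewrite trmxK mulVmx// jacobian_transition_unit. Qed.

Lemma cojac_mul_jacobianT a : overlap c d a -> C a *m (D a)^T = 1%:M.
Proof.
by move=> oa; apply: trmx_inj; rewrite trmx_mul trmx1 (trmxK (D a)) jacobian_mul_cojacT.
Qed.

Lemma jacobianT_mul_cojac a : overlap c d a -> (D a)^T *m C a = 1%:M.
Proof.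
by move=> oa; apply: trmx_inj; rewrite trmx_mul trmx1 (trmxK (D a)) cojacT_mul_jacobian.
Qed.

Lemma differentiable_jacobian_transition a : overlap c d a ->
  differentiable (fun a => D a) a.
Proof.
by move=> oa; case: (class_C_jacobian_transition c d 1) => + _; exact.
Qed.

Lemma derive_slit_transition_fibre z v : O z ->
  'D_(row_mx 0 v) F z = row_mx 0 (v *m C (lsubmx z)).
Proof.
by move=> oz; rewrite derive_slit_transition// row_mxKl row_mxKr derive0 mul0mx mulmx0 addr0.
Qed.

Lemma derive_slit_transition_base z v : O z ->
  'D_(row_mx v 0) F z =
  row_mx (v *m D (lsubmx z)) (rsubmx z *m 'D_v (cojac c d) (lsubmx z)).
Proof.
by move=> oz; rewrite derive_slit_transition// row_mxKl row_mxKr mul0mx add0r.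
Qed.

Lemma derive_K2_transition z u : O z ->
  'D_u (K2_loc K c) z = 'D_('D_u F z) (K2_loc K d) (F z).
Proof.
move=> oz; apply: etrans (open_eq_derive u oO oz K2_transition) _.
apply: (derive_comp _ (differentiable_slit_transition oz)).
exact: (K2_diff hK (slit_transition_codom oz)).
Qed.

Lemma derive_K2_fibre (e : chart (slit_cotangent M)) z v : chart_codom e z ->
  'D_(row_mx 0 v) (K2_loc K e) z = 2 * (v *m (p_upv K e z)^T) 0 0.
Proof.
move=> Uz; rewrite (derive_covec_sum _ (K2_diff hK Uz)) mxE mulr_sumr.
apply: eq_bigr => i _; rewrite [_^T _ _]mxE [p_upv _ _ _ _ _]mxE /p_up mulrCA [X in _ * X]mulrA.
by rewrite mulfV ?pnatr_eq0// mul1r.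
Qed.

Lemma derive_K2_base (e : chart (slit_cotangent M)) z v : chart_codom e z ->
  'D_(row_mx v 0) (K2_loc K e) z = 2 * (v *m (dx_K2 K e z)^T) 0 0.
Proof.
move=> Uz; rewrite (derive_vec_sum _ (K2_diff hK Uz)) mxE mulr_sumr.
apply: eq_bigr => i _; rewrite [_^T _ _]mxE [dx_K2 _ _ _ _ _]mxE mulrCA [X in _ * X]mulrA.
by rewrite mulfV ?pnatr_eq0// mul1r.
Qed.

Lemma form_inj (a b : 'cV[R]_n) : (forall v, (v *m a) 0 0 = (v *m b) 0 0) -> a = b.
Proof.
move=> ab; apply/colP => i; have := ab (delta_mx 0 i).
by rewrite -!rowE !mxE.
Qed.

(** p^i is a momentum derivative of the invariant function K^2. The transition maps fibre directions
    by C, and moving C across the pairing puts its transpose on p^i. *)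
Lemma p_upv_transition z : O z ->
  p_upv K c z = p_upv K d (F z) *m (C (lsubmx z))^T.
Proof.
move=> oz; apply: trmx_inj; rewrite trmx_mul trmxK; apply: form_inj => v.
have n2 : (2 : R) != 0 by rewrite pnatr_eq0.
apply: (mulfI n2); rewrite -(derive_K2_fibre v (overlap_codom oz)).
rewrite (derive_K2_transition _ oz) derive_slit_transition_fibre//.
by rewrite (derive_K2_fibre _ (slit_transition_codom oz)) mulmxA.
Qed.

Lemma p_upv_jacobian z : O z -> p_upv K c z *m D (lsubmx z) = p_upv K d (F z).
Proof.
move=> oz; have [oa _] := oz.
by rewrite p_upv_transition// -mulmxA cojacT_mul_jacobian// mulmx1.
Qed.

Let diff_cojacT z : O z -> differentiable (fun y => (C (lsubmx y))^T) z.
Proof.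
move=> [oa _]; apply: differentiable_trmx.
exact: (differentiable_comp_lsubmx (differentiable_cojac oa)).
Qed.

Let derive_cojacT z u : O z ->
  'D_u (fun y => (C (lsubmx y))^T) z = ('D_(lsubmx u) (cojac c d) (lsubmx z))^T.
Proof.
move=> [oa _]; have dc := differentiable_cojac oa.
apply: etrans (derive_trmx u (differentiable_comp_lsubmx dc)) _.
by apply: congr1; exact: derive_comp_lsubmx.
Qed.

Lemma derive_p_upv_transition z u : O z ->
  'D_u (p_upv K c) z = 'D_('D_u F z) (p_upv K d) (F z) *m (C (lsubmx z))^T +
    p_upv K d (F z) *m ('D_(lsubmx u) (cojac c d) (lsubmx z))^T.
Proof.
move=> oz; have dF := differentiable_slit_transition oz.
have dp := p_upv_diff hK (slit_transition_codom oz).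
apply: etrans (open_eq_derive u oO oz p_upv_transition) _.
apply: etrans (derive_mulmx u (differentiable_comp dF dp) (diff_cojacT oz)) _.
have E1 := derive_comp u dF dp; have E2 := derive_cojacT u oz.
exact: (congr2 (fun a b => a *m (C (lsubmx z))^T + p_upv K d (F z) *m b) E1 E2).
Qed.

(** Fibre derivative of [p_upv_transition]; C depends on the base point only and is constant along
    the fibre. *)
Lemma g_up_transition z : O z ->
  g_up K c z = C (lsubmx z) *m g_up K d (F z) *m (C (lsubmx z))^T.
Proof.
move=> oz; apply: mulmx_rV_inj => v.
rewrite -(derive_p_upv_fibre hK v (overlap_codom oz)) derive_p_upv_transition//.
rewrite derive_slit_transition_fibre// row_mxKl derive0 trmx0 mulmx0 addr0.
by rewrite (derive_p_upv_fibre hK _ (slit_transition_codom oz)) !mulmxA.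
Qed.

Lemma g_dn_transition z : O z ->
  g_dn K c z = D (lsubmx z) *m g_dn K d (F z) *m (D (lsubmx z))^T.
Proof.
move=> oz; have [oa _] := oz.
have ug := g_up_unit hK (overlap_codom oz).
have ud := g_up_unit hK (slit_transition_codom oz).
have DC := jacobianT_mul_cojac oa.
have gV : g_dn K c z *m g_up K c z = 1%:M by exact: (mulVmx ug).
have gdV : g_dn K d (F z) *m g_up K d (F z) = 1%:M by exact: (mulVmx ud).
apply: (can_inj (mulmxK ug)); rewrite gV (g_up_transition oz).
rewrite !mulmxA -(mulmxA _ _^T (C _)) DC mulmx1 -(mulmxA _ (g_dn _ _ _)).
by rewrite gdV mulmx1 (jacobian_mul_cojacT oa).
Qed.

(** The product of [w] with the derivative of the Jacobian along [v] is the second derivative of the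
    transition in the directions [v] and [w]. *)
Lemma derive_jacobian_sym a v w : overlap c d a ->
  w *m 'D_v (fun a => D a) a = v *m 'D_w (fun a => D a) a.
Proof.
move=> oa; have oov := @open_overlap _ _ M c d.
have E (u u' : 'rV[R]_n) : u *m 'D_u' (fun a => D a) a = 'D_u' ('D_u (transition c d)) a.
  have dj := differentiable_jacobian_transition oa.
  have dc : differentiable (fun _ : 'rV[R]_n => u) a by exact: differentiable_cst.
  have E1 := derive_mulmx u' dc dj.
  rewrite derive_cst mul0mx add0r in E1.
  apply: etrans (esym E1) _; apply: open_eq_derive oov oa _ => b ob.
  by rewrite (deriveEjacobian _ (differentiable_transition ob)).
apply: etrans (E w v) _; apply: etrans (esym (E v w)).
exact: derive_comm oov oa (smooth_transition c d 2).
Qed.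

Lemma derive_cojacT_jacobian a v : overlap c d a ->
  ('D_v (cojac c d) a)^T *m D a = - ((C a)^T *m 'D_v (fun a => D a) a).
Proof.
move=> oa; have dj := differentiable_jacobian_transition oa.
have dc := differentiable_trmx (differentiable_cojac oa).
have E := derive_mulmx v dc dj.
have E1 := open_eq_derive v (@open_overlap _ _ M c d) oa cojacT_mul_jacobian.
have := etrans (esym E1) E; rewrite derive_cst => /esym/eqP.
by rewrite addr_eq0 => /eqP; rewrite (derive_trmx v (differentiable_cojac oa)).
Qed.

(** Differentiating C D^T = 1 expresses the derivative of C by that of the Jacobian, where
    [derive_jacobian_sym] applies. *)
Lemma derive_cojac_sym a v w : overlap c d a ->
  'D_v (cojac c d) a *m (w *m D a)^T = 'D_w (cojac c d) a *m (v *m D a)^T.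
Proof.
move=> oa.
have E (u u' : 'rV[R]_n) : 'D_u (cojac c d) a *m (u' *m D a)^T =
    - (C a *m (u' *m 'D_u (fun a => D a) a)^T).
  have dj := differentiable_jacobian_transition oa; have dc := differentiable_cojac oa.
  have E := derive_mulmx u dc (differentiable_trmx dj).
  have E1 := open_eq_derive u (@open_overlap _ _ M c d) oa cojac_mul_jacobianT.
  have := etrans (esym E1) E; rewrite derive_cst => /esym/eqP.
  rewrite addr_eq0 (derive_trmx u dj) => /eqP E2.
  by rewrite !trmx_mul !mulmxA E2 mulNmx.
apply: etrans (E v w) _; apply: etrans (esym (E w v)).
have E3 := derive_jacobian_sym v w oa.
exact: (congr1 (fun X : 'rV[R]_n => - (C a *m X^T)) E3).
Qed.

(** [B] and [E] collect the inhomogeneous terms of the laws for momenta and for p^i as matrices: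
    [v *m B z] and [v *m E z] are these terms in the base direction [v] ([mul_B], [mul_E]). *)
Let B z : 'M[R]_n := \matrix_(i, j) (rsubmx z *m 'D_(delta_mx 0 i) (cojac c d) (lsubmx z)) 0 j.
Let E z : 'M[R]_n :=
  \matrix_(i, j) (p_upv K d (F z) *m ('D_(delta_mx 0 i) (cojac c d) (lsubmx z))^T) 0 j.

Let derive_cojac_sum a v : overlap c d a ->
  'D_v (cojac c d) a = \sum_i v 0 i *: 'D_(delta_mx 0 i) (cojac c d) a.
Proof.
move=> oa; have dc := differentiable_cojac oa.
rewrite [in LHS](row_sum_delta v) (derive_sumv _ dc); apply: eq_bigr => i _.
exact: deriveZv.
Qed.

Let mul_B z v : O z -> v *m B z = rsubmx z *m 'D_v (cojac c d) (lsubmx z).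
Proof.
move=> [oa _]; rewrite derive_cojac_sum// mulmx_sumr mulmx_sum_row.
apply: eq_bigr => i _; rewrite -scalemxAr; congr (_ *: _).
by apply/rowP => j; rewrite !mxE.
Qed.

Let mul_E z v : O z -> v *m E z = p_upv K d (F z) *m ('D_v (cojac c d) (lsubmx z))^T.
Proof.
move=> [oa _]; rewrite derive_cojac_sum// linear_sum mulmx_sumr mulmx_sum_row.
apply: eq_bigr => i _; rewrite linearZ -scalemxAr; congr (_ *: _).
by apply/rowP => j; rewrite !mxE.
Qed.

(** A base direction [v] is sent to a vector with momentum part [v *m B z], which meets the fibre
    derivative [g_up] of p^i; [E] comes from differentiating C in [p_upv_transition]. *)
Lemma dx_p_up_transition z : O z -> dx_p_up K c z =
  (D (lsubmx z) *m dx_p_up K d (F z) + B z *m g_up K d (F z)) *m (C (lsubmx z))^T + E z.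
Proof.
move=> oz; apply: mulmx_rV_inj => v.
rewrite -(derive_p_upv_base hK v (overlap_codom oz)) derive_p_upv_transition//.
rewrite derive_slit_transition_base// row_mxKl -mul_B// -mul_E// mulmxDr; congr (_ + _).
have -> : row_mx (v *m D (lsubmx z)) (v *m B z) =
    row_mx (v *m D (lsubmx z)) 0 + row_mx 0 (v *m B z) by rewrite add_row_mx addr0 add0r.
have Ud := slit_transition_codom oz.
rewrite (deriveDv _ _ (p_upv_diff hK Ud)) (derive_p_upv_base hK _ Ud).
by rewrite (derive_p_upv_fibre hK _ Ud) -!mulmxA -!mulmxDr !mulmxA.
Qed.

Let form_swap (X Y W : 'M[R]_1) :
  X 0 0 + Y 0 0 = W 0 0 -> (- W + Y^T) 0 0 = (- X) 0 0.
Proof. by rewrite !mxE => <-; rewrite opprD subrK. Qed.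

(** The field is determined by K^2 and the canonical symplectic form, both independent of the chart.
    In coordinates, the base part is [p_upv_jacobian], and the momentum part is read off from the
    base derivatives of K^2 in the two charts. *)
Lemma ham_transition z : O z -> 'D_(ham K c z) F z = ham K d (F z).
Proof.
move=> oz; have [oa _] := oz; have Ud := slit_transition_codom oz.
rewrite derive_slit_transition// row_mxKl row_mxKr p_upv_jacobian//; congr row_mx.
have uD := jacobian_transition_unit oa.
apply: trmx_inj; apply: form_inj => w.
(* Every test row is the image of some [v] in the first chart, along which the invariance of K^2 can
   be differentiated. *)
have [v ->] : exists v, w = v *m D (lsubmx z).
  by exists (w *m invmx (D (lsubmx z))); rewrite mulmxKV.
have n2 : (2 : R) != 0 by rewrite pnatr_eq0.
have := derive_K2_base v (overlap_codom oz).
rewrite derive_K2_transition// derive_slit_transition_base//.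
have -> : row_mx (v *m D (lsubmx z)) (rsubmx z *m 'D_v (cojac c d) (lsubmx z)) =
  row_mx (v *m D (lsubmx z)) 0 + row_mx 0 (rsubmx z *m 'D_v (cojac c d) (lsubmx z)).
  by rewrite add_row_mx addr0 add0r.
rewrite (deriveDv _ _ (K2_diff hK Ud)) (derive_K2_base _ Ud) (derive_K2_fibre _ Ud).
rewrite -mulrDr => /(mulfI n2) E1.
rewrite mulNmx linearD linearN/= mulmxDr mulmxN linearN/= mulmxN.
have -> : v *m D (lsubmx z) *m (dx_K2 K c z *m C (lsubmx z))^T = v *m (dx_K2 K c z)^T.
  by rewrite trmx_mul -!mulmxA (mulmxA (D _)) jacobian_mul_cojacT// mul1mx.
(* Symmetry of second derivatives moves the differentiation of C from the direction p^i to [v],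
   where it matches the fibre term in the derivative of K^2. *)
have -> : v *m D (lsubmx z) *m (rsubmx z *m 'D_(p_upv K c z) (cojac c d) (lsubmx z))^T =
   (rsubmx z *m 'D_v (cojac c d) (lsubmx z) *m (p_upv K d (F z))^T)^T.
  rewrite trmx_mul mulmxA -[v *m D _]trmxK -trmx_mul -trmx_mul; congr (_^T).
  by rewrite derive_cojac_sym// p_upv_jacobian// mulmxA.
exact: form_swap E1.
Qed.

(** Product rule for [g_dn_transition] along xi: [ham_transition] handles the middle factor, and the
    last term is the transpose of the first because g is symmetric. *)
Lemma derive_ham_g_dn_transition z : O z ->
  'D_(ham K c z) (g_dn K c) z =
   'D_(p_upv K c z) (fun a => D a) (lsubmx z) *m g_dn K d (F z) *m (D (lsubmx z))^T
   + D (lsubmx z) *m 'D_(ham K d (F z)) (g_dn K d) (F z) *m (D (lsubmx z))^T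
   + ('D_(p_upv K c z) (fun a => D a) (lsubmx z) *m g_dn K d (F z) *m (D (lsubmx z))^T)^T.
Proof.
move=> oz; have [oa _] := oz; have Ud := slit_transition_codom oz.
have dF := differentiable_slit_transition oz.
have dg := g_dn_diff hK Ud; have dj := differentiable_jacobian_transition oa.
have djl := differentiable_comp_lsubmx dj.
have djt := differentiable_trmx djl.
have dgF := differentiable_comp dF dg.
have djg := differentiable_mulmx djl dgF.
apply: etrans (open_eq_derive _ oO oz g_dn_transition) _.
apply: etrans (derive_mulmx (ham K c z) djg djt) _.
rewrite (derive_mulmx (ham K c z) djl dgF) (derive_trmx (ham K c z) djl).
have e1 := derive_comp_lsubmx (ham K c z) dj; rewrite [lsubmx (ham _ _ _)]row_mxKl in e1.
have e2 := etrans (derive_comp (ham K c z) dF dg)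
  (congr1 (fun u => 'D_u (g_dn K d) (F z)) (ham_transition oz)).
apply: etrans (congr2 (fun a b => (a *m g_dn K d (F z) + D (lsubmx z) *m b) *m
  (D (lsubmx z))^T + D (lsubmx z) *m g_dn K d (F z) *m a^T) e1 e2) _.
by rewrite !trmx_mul (trmxK (D _)) (g_dn_sym hK Ud) mulmxDl mulmxA.
Qed.

(** Read J as the Jacobian, T as the derivative of g along xi, Q as the product of [dx_p_up] and
    [g_dn], S as B D^T, and A as the contribution to T of the derivative of the Jacobian along p^i.
    In T + Q + Q^T the terms A cancel, and the symmetric S occurs twice, which absorbs the factor
    1/2. *)
Let congruence_algebra (Nc Nd J Tc Td Qc Qd S A : 'M[R]_n) :
  Nc = - 2^-1 *: (Tc + Qc + Qc^T) -> Nd = - 2^-1 *: (Td + Qd + Qd^T) ->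
  Qc = J *m Qd *m J^T + S - A -> Tc = A + J *m Td *m J^T + A^T -> S^T = S ->
  Nc = J *m Nd *m J^T - S.
Proof.
move=> -> -> -> -> sS; rewrite -scalemxAr -scalemxAl !mulmxDr !mulmxDl.
have tD (X Y : 'M[R]_n) : (X + Y)^T = X^T + Y^T by apply/matrixP => i j; rewrite !mxE.
have tN (X : 'M[R]_n) : (- X)^T = - X^T by apply/matrixP => i j; rewrite !mxE.
rewrite !tD tN sS.
have -> : J *m Qd^T *m J^T = (J *m Qd *m J^T)^T by rewrite !trmx_mul trmxK mulmxA.
move: (J *m Td *m _) (J *m Qd *m _) => X Y.
apply/matrixP => i j; rewrite !mxE; lra.
Qed.

(** This is the law N = D N' D^T - S multiplied by C on the right. In this form it says that the
    derivative of the transition sends the horizontal vector (a, a N) to (a D, a D N'). *)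
Lemma N_conn_transition z : O z ->
  N_conn K c z *m C (lsubmx z) + B z = D (lsubmx z) *m N_conn K d (F z).
Proof.
move=> oz; have [oa _] := oz; have Ud := slit_transition_codom oz.
(* The symmetry of S = B D^T is [derive_cojac_sym] for two basis vectors, paired with the
   momenta. *)
have Bsym : B z *m (D (lsubmx z))^T = (B z *m (D (lsubmx z))^T)^T.
  apply/matrixP => i j; rewrite [RHS]mxE.
  have e k l : (B z *m (D (lsubmx z))^T) k l =
     (rsubmx z *m ('D_(delta_mx 0 k) (cojac c d) (lsubmx z) *m
        ((delta_mx 0 l : 'rV[R]_n) *m D (lsubmx z))^T)) 0 0.
    rewrite mulmxA -mul_B// trmx_mul mulmxA -rowE.
    by rewrite trmx_delta -colE [RHS]mxE -row_mul [RHS]mxE.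
  have sy := derive_cojac_sym (delta_mx 0 i) (delta_mx 0 j) oa.
  by apply: etrans (e i j) _; rewrite sy; exact: esym (e j i).
(* Symmetry of second derivatives exchanges the free direction with p^i, so the inhomogeneous term
   of p^i becomes a derivative of the Jacobian along p^i. *)
have ED : E z *m D (lsubmx z) = - 'D_(p_upv K c z) (fun a => D a) (lsubmx z).
  apply: mulmx_rV_inj => v; rewrite mulmxA mul_E// -mulmxA derive_cojacT_jacobian//.
  by rewrite mulmxN mulmxA -p_upv_transition// derive_jacobian_sym// mulmxN.
have Ug : g_up K d (F z) *m g_dn K d (F z) = 1%:M by rewrite mulmxV// (g_up_unit hK Ud).
have CD := cojacT_mul_jacobian oa.
have Qg : dx_p_up K c z *m g_dn K c z =
    D (lsubmx z) *m (dx_p_up K d (F z) *m g_dn K d (F z)) *m (D (lsubmx z))^T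
    + B z *m (D (lsubmx z))^T
    - 'D_(p_upv K c z) (fun a => D a) (lsubmx z) *m g_dn K d (F z) *m (D (lsubmx z))^T.
  have E1 : E z *m (D (lsubmx z) *m g_dn K d (F z) *m (D (lsubmx z))^T) =
      - ('D_(p_upv K c z) (fun a => D a) (lsubmx z) *m g_dn K d (F z) *m (D (lsubmx z))^T).
    by rewrite !mulmxA ED !mulNmx.
  have E2 : (D (lsubmx z) *m dx_p_up K d (F z) + B z *m g_up K d (F z)) *m (C (lsubmx z))^T
      *m (D (lsubmx z) *m g_dn K d (F z) *m (D (lsubmx z))^T) =
    D (lsubmx z) *m (dx_p_up K d (F z) *m g_dn K d (F z)) *m (D (lsubmx z))^T
    + B z *m (D (lsubmx z))^T.
    rewrite -!mulmxA (mulmxA (C _)^T) CD mul1mx mulmxDl -!mulmxA.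
    by rewrite (mulmxA (g_up _ _ _)) Ug mul1mx.
  rewrite (dx_p_up_transition oz) (g_dn_transition oz).
  by apply: etrans (mulmxDl _ _ _) _; rewrite E1 E2.
have -> : N_conn K c z =
    D (lsubmx z) *m N_conn K d (F z) *m (D (lsubmx z))^T - B z *m (D (lsubmx z))^T.
  exact: (congruence_algebra (N_connE hK (overlap_codom oz)) (N_connE hK Ud) Qg
    (derive_ham_g_dn_transition oz) (esym Bsym)).
rewrite mulmxBl -!mulmxA.
by rewrite (jacobianT_mul_cojac oa) !mulmx1 subrK.
Qed.

(** The derivative of C in the differential of the transition cancels against the term [B] of
    [N_conn_transition], so vertical parts change like momenta. *)
Lemma delta_pv_transition z u : O z ->
  delta_pv K d (F z) ('D_u F z) = delta_pv K c z u *m C (lsubmx z).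
Proof.
move=> oz; rewrite derive_slit_transition// /delta_pv row_mxKl row_mxKr.
rewrite -mulmxA -N_conn_transition// mulmxDr mul_B// mulmxA mulmxBl.
by rewrite opprD addrACA subrr addr0.
Qed.

Lemma derive_transition_hpart z u : O z ->
  'D_(hpart K c z u) F z = hpart K d (F z) ('D_u F z).
Proof.
move=> oz; rewrite !derive_slit_transition// /hpart !row_mxKl !row_mxKr; congr row_mx.
by rewrite -[RHS]mulmxA -(N_conn_transition oz) mulmxDr (mul_B _ oz) mulmxA.
Qed.

Lemma derive_transition_vpart z u : O z ->
  'D_(vpart K c z u) F z = vpart K d (F z) ('D_u F z).
Proof.
move=> oz; rewrite derive_slit_transition_fibre// /vpart.
by rewrite delta_pv_transition.
Qed.

Lemma derive_transition_lpart z u : O z ->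
  'D_(lpart K c z u) F z = lpart K d (F z) ('D_u F z).
Proof.
move=> oz; have dF := differentiable_slit_transition oz; have [oa _] := oz.
have rF : rsubmx (F z) = rsubmx z *m C (lsubmx z) by rewrite slit_transitionE// row_mxKr.
have inv (x y : 'rV[R]_n) : (x *m g_up K c z *m y^T) 0 0 =
   (x *m C (lsubmx z) *m g_up K d (F z) *m (y *m C (lsubmx z))^T) 0 0.
  by rewrite (g_up_transition oz) trmx_mul !mulmxA.
have c2 : radial_sq K c z = radial_sq K d (F z) by rewrite /radial_sq rF; exact: inv.
have c1 : radial_coef K c z u = radial_coef K d (F z) ('D_u F z).
  rewrite /radial_coef c2 (delta_pv_transition u oz) rF.
  exact: (congr1 (fun t : R => t / radial_sq K d (F z)) (inv (delta_pv K c z u) (rsubmx z))).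
apply: etrans (deriveZv _ _ dF) _; rewrite c1; apply: congr1.
by rewrite /radial (derive_slit_transition_fibre _ oz) rF.
Qed.

End ChartChange.

(** * Vector fields and connections *)

Section SlitVectorFields.
Context {R : realType} {n : nat}.
Variable M : manifold R n.
Let S := slit_cotangent M.
Let A := mfd_atlas M.
Notation vf := (@vfield R (n + n) (cotangent M)).
Implicit Types (c : chart S) (X Y Z W : vf) (f : cotangent M -> R)
  (u : cotangent M) (z : 'rV[R]_(n + n)).

Lemma slit_overlap_coords_at c u : chart_dom c u ->
  slit_overlap (chart_at A u.1) c (coords_at S u).
Proof. by move=> [cu u0]; apply: slit_overlap_map => //; exact: chart_at_dom. Qed.

Lemma slit_transition_coords_at c z : chart_codom c z ->
  slit_transition (chart_at A (chart_inv c z).1) c (coords_at S (chart_inv c z)) = z.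
Proof.
move=> cz; set u := chart_inv c z.
have E : cotangent_inv (chart_at A u.1) (coords_at S u) = u.
  exact: slit_inv_coords_at.
by rewrite /slit_transition/= E; exact: slit_codomK.
Qed.

Lemma local_repD c X Y z : chart_codom c z ->
  local_rep c (vf_add X Y) z = local_rep c X z + local_rep c Y z.
Proof.
move=> cz; have oz := slit_overlap_coords_at (slit_codom_dom cz).
exact: (deriveDv _ _ (differentiable_slit_transition oz)).
Qed.

Lemma local_repZ c f X z : chart_codom c z ->
  local_rep c (vf_scale f X) z = f (chart_inv c z) *: local_rep c X z.
Proof.
move=> cz; have oz := slit_overlap_coords_at (slit_codom_dom cz).
exact: (deriveZv _ _ (differentiable_slit_transition oz)).
Qed.

Lemma local_rep_eq c X Y z : vf_eq S X Y -> chart_codom c z ->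
  local_rep c X z = local_rep c Y z.
Proof.
by move=> XY cz; rewrite !local_repE/= XY//; exact: slit_inv_pts cz.
Qed.

Lemma local_rep_at X u : pts S u -> local_rep (chart_at S u) X (coords_at S u) = X u.
Proof.
move=> pu; rewrite /local_rep (slit_inv_coords_at u).
have cz := slit_coords_at pu.
have Eid := open_eq_derive (X u) (@open_slit_codom _ _ _ (chart_at S u)) cz
  (g := id) (fun z zc => slit_codomK zc).
by apply: etrans Eid _; exact: derive_id.
Qed.

Lemma smooth_vfield_eq X Y : vf_eq S X Y -> smooth_vfield S X -> smooth_vfield S Y.
Proof.
move=> XY sX c k; apply: class_C_eq (@open_slit_codom _ _ _ c) _ (sX c k) => z cz.
exact: local_rep_eq XY cz.
Qed.

Lemma smooth_vf_add X Y : smooth_vfield S X -> smooth_vfield S Y ->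
  smooth_vfield S (vf_add X Y).
Proof.
move=> sX sY c k; have oc := @open_slit_codom _ _ _ c.
apply: class_C_eq oc _ (class_C_add oc (sX c k) (sY c k)) => z cz.
by rewrite local_repD.
Qed.

Lemma smooth_vf_scale f X : smooth_fun S f -> smooth_vfield S X ->
  smooth_vfield S (vf_scale f X).
Proof.
move=> sf sX c k; have oc := @open_slit_codom _ _ _ c.
apply: class_C_eq oc _ (class_C_scale oc (sf c k) (sX c k)) => z cz.
by rewrite local_repZ.
Qed.

Lemma smooth_fun_cst (a : R) : smooth_fun S (fun _ : cotangent M => a).
Proof. by move=> c k; exact: class_C_cst. Qed.

Lemma smooth_vf_opp X : smooth_vfield S X -> smooth_vfield S (vf_scale (fun=> -1) X).
Proof. by move=> sX; apply: smooth_vf_scale => //; exact: smooth_fun_cst. Qed.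

Lemma smooth_vf_sub X Y : smooth_vfield S X -> smooth_vfield S Y ->
  smooth_vfield S (fun u => X u - Y u).
Proof.
move=> sX sY; have -> : (fun u => X u - Y u) = vf_add X (vf_scale (fun=> -1) Y).
  by apply/funext => u; rewrite /vf_add /vf_scale scaleN1r.
exact: (smooth_vf_add sX (smooth_vf_opp sY)).
Qed.

Lemma smooth_vf0 : smooth_vfield S (fun=> 0 : 'rV[R]_(n + n)).
Proof.
move=> c k; apply: class_C_eq (@open_slit_codom _ _ _ c) _ (class_C_cst _ _ 0) => z cz.
by rewrite local_repE /= derive0.
Qed.

Lemma section_full X : section S full_distr X <-> smooth_vfield S X.
Proof. by split=> [[]|]. Qed.

Lemma local_rep_diff c X z : smooth_vfield S X -> chart_codom c z ->
  differentiable (local_rep c X) z.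
Proof. by move=> sX cz; case: (sX c 1%N) => + _; exact. Qed.

Lemma lie_bracketE X Y u : lie_bracket S X Y u =
  'D_(X u) (local_rep (chart_at S u) Y) (coords_at S u) -
  'D_(Y u) (local_rep (chart_at S u) X) (coords_at S u).
Proof. by []. Qed.

Section Brackets.
Variables (u : cotangent M) (pu : pts S u).
Let c := chart_at S u.
Let z := coords_at S u.
Let cz : chart_codom c z := slit_coords_at pu.
Let oc := @open_slit_codom _ _ _ c.

Let derive_local_rep_eq X Y (v : 'rV[R]_(n + n)) : vf_eq S X Y ->
  'D_v (local_rep c X) z = 'D_v (local_rep c Y) z.
Proof. by move=> XY; apply: open_eq_derive oc cz _ => y; exact: local_rep_eq. Qed.

Lemma lie_bracket_eq X X' Y Y' : vf_eq S X X' -> vf_eq S Y Y' ->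
  lie_bracket S X Y u = lie_bracket S X' Y' u.
Proof.
move=> XX YY; rewrite !lie_bracketE (XX _ pu) (YY _ pu).
have E1 := derive_local_rep_eq (X' u) YY; have E2 := derive_local_rep_eq (Y' u) XX.
exact: (congr2 (fun a b : 'rV[R]_(n + n) => a - b) E1 E2).
Qed.

Let derive_local_repD X Y (v : 'rV[R]_(n + n)) : smooth_vfield S X -> smooth_vfield S Y ->
  'D_v (local_rep c (vf_add X Y)) z = 'D_v (local_rep c X) z + 'D_v (local_rep c Y) z.
Proof.
move=> sX sY.
apply: etrans (open_eq_derive v oc cz (fun y => @local_repD c X Y y)) _.
by apply: deriveD; apply: diff_derivable; exact: local_rep_diff.
Qed.

Let derive_local_repZ f X (v : 'rV[R]_(n + n)) : smooth_fun S f -> smooth_vfield S X ->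
  'D_v (local_rep c (vf_scale f X)) z =
  'D_v (f \o chart_inv c : 'rV[R]_(n + n) -> R) z *: X u + f u *: 'D_v (local_rep c X) z.
Proof.
move=> sf sX.
have df : differentiable (f \o chart_inv c : 'rV[R]_(n + n) -> R) z.
  by case: (sf c 1%N) => + _; exact.
have dX := local_rep_diff sX cz.
apply: etrans (open_eq_derive v oc cz (fun y => @local_repZ c f X y)) _.
apply: etrans (derive_scale v df dX) _.
have E1 : local_rep c X z = X u by exact: local_rep_at.
have E2 : (f \o chart_inv c) z = f u by exact: (congr1 f (slit_inv_coords_at u)).
by rewrite E1 E2.
Qed.

Lemma lie_bracket_antisym X Y : lie_bracket S Y X u = - lie_bracket S X Y u.
Proof. by rewrite !lie_bracketE opprB. Qed.

Lemma lie_bracketDr X Y Z : smooth_vfield S X -> smooth_vfield S Y -> smooth_vfield S Z ->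
  lie_bracket S X (vf_add Y Z) u = lie_bracket S X Y u + lie_bracket S X Z u.
Proof.
move=> sX sY sZ; rewrite !lie_bracketE; have dX := local_rep_diff sX cz.
have E1 := derive_local_repD (X u) sY sZ.
have E2 := deriveDv (Y u) (Z u) dX.
apply: etrans (congr2 (fun a b => a - b) E1 E2) _.
by rewrite opprD addrACA.
Qed.

Lemma lie_bracketZr f X Y : smooth_fun S f -> smooth_vfield S X -> smooth_vfield S Y ->
  lie_bracket S X (vf_scale f Y) u = vact S X f u *: Y u + f u *: lie_bracket S X Y u.
Proof.
move=> sf sX sY; rewrite !lie_bracketE; have dX := local_rep_diff sX cz.
have E1 := derive_local_repZ (X u) sf sY.
have E2 := deriveZv (f u) (Y u) dX.
apply: etrans (congr2 (fun a b => a - b) E1 E2) _.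
by rewrite scalerBr addrA.
Qed.

Lemma lie_bracketDl X Y Z : smooth_vfield S X -> smooth_vfield S Y -> smooth_vfield S Z ->
  lie_bracket S (vf_add X Y) Z u = lie_bracket S X Z u + lie_bracket S Y Z u.
Proof.
move=> sX sY sZ; apply: etrans (lie_bracket_antisym Z (vf_add X Y)) _.
rewrite (lie_bracketDr sZ sX sY) opprD.
exact: (congr2 +%R (esym (lie_bracket_antisym Z X)) (esym (lie_bracket_antisym Z Y))).
Qed.

Lemma lie_bracketZl f X Y : smooth_fun S f -> smooth_vfield S X -> smooth_vfield S Y ->
  lie_bracket S (vf_scale f X) Y u = f u *: lie_bracket S X Y u - vact S Y f u *: X u.
Proof.
move=> sf sX sY; apply: etrans (lie_bracket_antisym Y (vf_scale f X)) _.
rewrite (lie_bracketZr sf sY sX) opprD addrC -scalerN.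
by rewrite -(lie_bracket_antisym Y X).
Qed.

Lemma vactD X Y f : smooth_fun S f ->
  vact S (vf_add X Y) f u = vact S X f u + vact S Y f u.
Proof.
move=> sf; apply: deriveDv.
by case: (sf c 1%N) => + _; exact.
Qed.

Lemma vact_eq X Y f : vf_eq S X Y -> vact S X f u = vact S Y f u.
Proof. by move=> XY; rewrite /vact XY. Qed.

Lemma lie_bracket0r X : smooth_vfield S X -> lie_bracket S X (fun=> 0) u = 0.
Proof.
move=> sX.
have E y : chart_codom c y -> local_rep c (fun=> 0 : 'rV[R]_(n + n)) y = 0.
  by move=> cy; rewrite local_repE /= derive0.
have E1 := etrans (open_eq_derive (X u) oc cz E) (derive_cst _ _ _).
have E2 := derive0 (local_rep c X) z.
apply: etrans (congr2 (fun a b : 'rV[R]_(n + n) => a - b) E1 E2) _.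
by rewrite subr0.
Qed.

End Brackets.

(* Multiplication by this function fixes the fields that vanish on T^*M_0, so a connection, being
   linear over smooth functions, ignores the values of fields on the zero section. *)
Lemma smooth_fun_off_pts : smooth_fun S (fun u => (u.2 == 0)%:R : R).
Proof.
move=> c k; apply: class_C_eq (@open_slit_codom _ _ _ c) _ (class_C_cst _ _ 0) => z cz.
by have /slit_ptsP/negbTE u0 := slit_inv_pts cz; rewrite /comp u0.
Qed.

Lemma off_pts_scale X : vf_eq S X (fun=> 0) -> vf_scale (fun u => (u.2 == 0)%:R) X = X.
Proof.
move=> X0; apply/funext => u; rewrite /vf_scale.
have [u0|u0] := boolP (u.2 == 0); first by rewrite scale1r.
by rewrite X0 ?scaler0//; apply/slit_ptsP.
Qed.

Section ConnectionLocality.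
Variable nabla : vf -> vf -> vf.
Hypothesis cn : connection_on S full_distr nabla.

Let fs X : smooth_vfield S X -> section S full_distr X. Proof. by move/section_full. Qed.

Lemma connection_smooth X Y : smooth_vfield S X -> smooth_vfield S Y ->
  smooth_vfield S (nabla X Y).
Proof. by move=> sX sY; have [h _ _ _ _] := cn; have [] := h _ _ (fs sX) (fs sY). Qed.

Lemma connection_eql X X' Y : vf_eq S X X' -> smooth_vfield S X -> smooth_vfield S Y ->
  vf_eq S (nabla X Y) (nabla X' Y).
Proof.
move=> XX sX sY; have [_ hD hZ _ _] := cn.
have sX' := smooth_vfield_eq XX sX.
pose W := fun u => X' u - X u; have sW : smooth_vfield S W by exact: smooth_vf_sub.
have W0 : vf_eq S W (fun=> 0) by move=> u pu; rewrite /W XX// subrr.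
have EX : X' = vf_add X W by apply/funext => u; rewrite /vf_add /W addrC subrK.
move=> u pu; have E1 := hD _ _ _ (fs sX) (fs sW) (fs sY) u pu.
have E2 := hZ _ _ _ smooth_fun_off_pts (fs sW) (fs sY) u pu.
rewrite (off_pts_scale W0) in E2.
rewrite EX E1 /vf_add E2 /vf_scale.
by move/slit_ptsP/negbTE : pu => ->; rewrite scale0r addr0.
Qed.

Lemma connection_eqr X Y Y' : vf_eq S Y Y' -> smooth_vfield S X -> smooth_vfield S Y ->
  vf_eq S (nabla X Y) (nabla X Y').
Proof.
move=> YY sX sY; have [_ _ _ hD hZ] := cn.
have sY' := smooth_vfield_eq YY sY.
pose W := fun u => Y' u - Y u; have sW : smooth_vfield S W by exact: smooth_vf_sub.
have W0 : vf_eq S W (fun=> 0) by move=> u pu; rewrite /W YY// subrr.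
have EY : Y' = vf_add Y W by apply/funext => u; rewrite /vf_add /W addrC subrK.
move=> u pu; have E1 := hD _ _ _ (fs sX) (fs sY) (fs sW) u pu.
have E2 := hZ _ _ _ smooth_fun_off_pts (fs sX) (fs sW) u pu.
rewrite (off_pts_scale W0) in E2.
rewrite EY E1 /vf_add E2 /vf_add /vf_scale (W0 u pu) scaler0 add0r.
by move/slit_ptsP/negbTE : pu => ->; rewrite scale0r addr0.
Qed.

Lemma connection_eq X X' Y Y' u : vf_eq S X X' -> vf_eq S Y Y' ->
  smooth_vfield S X -> smooth_vfield S Y -> pts S u ->
  nabla X Y u = nabla X' Y' u.
Proof.
move=> XX YY sX sY pu; rewrite (connection_eql XX sX sY pu).
exact: connection_eqr YY (smooth_vfield_eq XX sX) sY _ pu.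
Qed.

Lemma connection0r X u : smooth_vfield S X -> pts S u -> nabla X (fun=> 0) u = 0.
Proof.
move=> sX pu; have [_ _ _ _ hZ] := cn.
have -> : (fun=> 0) = vf_scale (fun=> 0 : R) (fun=> 0) :> vf.
  by apply/funext => v; rewrite /vf_scale scaler0.
rewrite (hZ _ _ _ (smooth_fun_cst 0) (fs sX) (fs smooth_vf0) u pu).
by rewrite /vf_add /vf_scale scaler0 scale0r addr0.
Qed.

End ConnectionLocality.

End SlitVectorFields.

(** * Complementary projections and restricted Vranceanu connections *)

Section ComplementaryProjections.
(* Failing unifications that unfold these constants do not terminate in reasonable time. *)
#[local] Opaque smooth_vfield lie_bracket vact orth_proj.
Context {R : realType} {n : nat}.
Variable M : manifold R n.
Let S := slit_cotangent M.
Notation vf := (@vfield R (n + n) (cotangent M)).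
Notation endo := (cotangent M -> 'rV[R]_(n + n) -> 'rV[R]_(n + n)).
Implicit Types (X Y Z W : vf) (f : cotangent M -> R) (u : cotangent M) (p q : endo).

Definition fibre_linear p := forall u a x y, p u (a *: x + y) = a *: p u x + p u y.

Definition smooth_endo p := forall X, smooth_vfield S X ->
  smooth_vfield S (fun u => p u (X u)).

(** Linearity, smoothness and idempotence are asked of [p]: the third clause forces [q] to be the
    identity minus [p], and [complementary_sym] derives the same properties for it. *)
Definition complementary p q :=
  [/\ fibre_linear p, smooth_endo p,
      forall u x, p u x + q u x = x & forall u x, pts S u -> p u (p u x) = p u x].

Lemma fibre_linear0 p u : fibre_linear p -> p u 0 = 0.
Proof.
move=> lp; have := lp u 1 0 0; rewrite !scale1r addr0 => /eqP.
by rewrite -subr_eq0 opprD addrA subrr sub0r oppr_eq0 => /eqP.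
Qed.

Lemma fibre_linearZ p u a x : fibre_linear p -> p u (a *: x) = a *: p u x.
Proof. by move=> lp; have := lp u a x 0; rewrite !addr0 fibre_linear0// addr0. Qed.

Lemma fibre_linearD p u x y : fibre_linear p -> p u (x + y) = p u x + p u y.
Proof. by move=> lp; have := lp u 1 x y; rewrite !scale1r. Qed.

Lemma fibre_linearB p u x y : fibre_linear p -> p u (x - y) = p u x - p u y.
Proof. by move=> lp; rewrite -scaleN1r fibre_linearD// fibre_linearZ// scaleN1r. Qed.

Lemma complementaryE p q u x : complementary p q -> q u x = x - p u x.
Proof. by case=> _ _ pq _; rewrite -[X in X - _](pq u x) addrC addKr. Qed.

Lemma complementary0 p q u x : complementary p q -> pts S u -> p u (q u x) = 0.
Proof.
by move=> c pu; rewrite (complementaryE _ _ c);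
   case: c => lp _ _ pp; rewrite fibre_linearB// pp// subrr.
Qed.

Lemma complementary_sym p q : complementary p q -> complementary q p.
Proof.
move=> c; have E u x := complementaryE u x c; case: (c) => lp sp pq pp; split.
- by move=> u a x y; rewrite !E lp scalerBr opprD addrACA.
- move=> X sX; apply: smooth_vfield_eq (smooth_vf_sub sX (sp X sX)) => u pu.
  by rewrite E.
- by move=> u x; rewrite addrC.
- by move=> u x pu; rewrite {1}E (complementary0 _ c pu) subr0.
Qed.

Variable nabla : vf -> vf -> vf.
Hypothesis cn : connection_on S full_distr nabla.
Hypothesis torsion : forall X Y, section S full_distr X -> section S full_distr Y ->
  forall u, pts S u -> nabla X Y u - nabla Y X u = lie_bracket S X Y u.

(* Torsion-freeness spares the naturality of the bracket under changes of charts. *)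
Lemma smooth_lie_bracket X Y : smooth_vfield S X -> smooth_vfield S Y ->
  smooth_vfield S (lie_bracket S X Y).
Proof.
move=> sX sY.
have sXY := connection_smooth cn sX sY; have sYX := connection_smooth cn sY sX.
apply: smooth_vfield_eq (smooth_vf_sub sXY sYX) => u pu.
have fX := (section_full X).2 sX; have fY := (section_full Y).2 sY.
exact: (torsion fX fY pu).
Qed.

(** One operator for both restricted connections: [p] and [q] will be [hor_proj] and [vert_proj] in
    one case, [vert_perp_proj] and its complement in the other. *)
Definition proj_connection p q X Z : vf := fun u =>
  p u (nabla (fun v => p v (X v)) Z u + lie_bracket S (fun v => q v (X v)) Z u).

Lemma leibniz_sum (V : lmodType R) (a b d : R) (x y z : V) :
  a *: x + b *: y + (d *: x + b *: z) = (a + d) *: x + b *: (y + z).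
Proof. by rewrite addrACA -scalerDl -scalerDr. Qed.

(** Linearity over functions in [X] holds because the derivative term of the bracket is a multiple
    of [q X], which [p] kills. The Leibniz rule holds because the derivatives of [f] along [p X] and
    [q X] add up to the one along [X]. *)
Lemma proj_connectionP p q (E : @Defs.distribution R (n + n) (cotangent M)) :
  complementary p q -> (forall u x, pts S u -> E u x <-> p u x = x) ->
  connection_on S E (proj_connection p q).
Proof.
move=> c hE; have [lq sq _ _] := complementary_sym c; have [lp sp pq pp] := c.
have [hs hD hZ hDr hZr] := cn.
have fs X : smooth_vfield S X -> section S full_distr X by move/section_full.
have ss X : section S full_distr X -> smooth_vfield S X by move/section_full.
split.
- move=> X Z /ss sX [sZ _]; split; last by move=> u pu; apply/hE => //; exact: pp.
  apply: (sp); apply: smooth_vf_add.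
    exact: (connection_smooth cn (sp _ sX) sZ).
  exact: (smooth_lie_bracket (sq _ sX) sZ).
- move=> X Y Z /ss sX /ss sY [sZ _] u pu; rewrite /proj_connection.
  have -> : (fun v => p v (vf_add X Y v)) =
      vf_add (fun v => p v (X v)) (fun v => p v (Y v)).
    by apply/funext => v; rewrite /vf_add fibre_linearD.
  have -> : (fun v => q v (vf_add X Y v)) =
      vf_add (fun v => q v (X v)) (fun v => q v (Y v)).
    by apply/funext => v; rewrite /vf_add fibre_linearD.
  rewrite (hD _ _ _ (fs _ (sp _ sX)) (fs _ (sp _ sY)) (fs _ sZ) u pu).
  rewrite (lie_bracketDl pu (sq _ sX) (sq _ sY) sZ).
  by rewrite /vf_add addrACA; apply: etrans (fibre_linearD u _ _ lp) _.
- move=> f X Z sf /ss sX [sZ _] u pu; rewrite /proj_connection.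
  have -> : (fun v => p v (vf_scale f X v)) = vf_scale f (fun v => p v (X v)).
    by apply/funext => v; rewrite /vf_scale fibre_linearZ.
  have -> : (fun v => q v (vf_scale f X v)) = vf_scale f (fun v => q v (X v)).
    by apply/funext => v; rewrite /vf_scale fibre_linearZ.
  rewrite (hZ _ _ _ sf (fs _ (sp _ sX)) (fs _ sZ) u pu).
  rewrite (lie_bracketZl pu sf (sq _ sX) sZ).
  rewrite /vf_scale addrA -scalerDr fibre_linearB// !fibre_linearZ//.
  by rewrite (complementary0 _ c pu) scaler0 subr0.
- move=> X Z W /ss sX [sZ _] [sW _] u pu; rewrite /proj_connection.
  rewrite (hDr _ _ _ (fs _ (sp _ sX)) (fs _ sZ) (fs _ sW) u pu).
  rewrite (lie_bracketDr pu (sq _ sX) sZ sW).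
  by rewrite /vf_add addrACA; apply: etrans (fibre_linearD u _ _ lp) _.
- move=> f X Z sf /ss sX [sZ EZ] u pu; rewrite /proj_connection.
  rewrite (hZr _ _ _ sf (fs _ (sp _ sX)) (fs _ sZ) u pu).
  rewrite (lie_bracketZr pu sf (sq _ sX) sZ).
  have Ev : vact S (fun v => p v (X v)) f u + vact S (fun v => q v (X v)) f u = vact S X f u.
    by apply: etrans (esym (vactD pu _ _ sf)) (vact_eq pu _ _) => v _; exact: pq.
  rewrite /vf_add /vf_scale leibniz_sum Ev lp fibre_linearZ//.
  by rewrite ((hE u _ pu).1 (EZ u pu)).
Qed.

Lemma proj_connection_eqr p q X Z Z' u : complementary p q ->
  vf_eq S Z Z' -> smooth_vfield S X -> smooth_vfield S Z -> pts S u ->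
  proj_connection p q X Z u = proj_connection p q X Z' u.
Proof.
move=> c ZZ sX sZ pu; have [_ sp _ _] := c.
rewrite /proj_connection; apply: congr1.
have E1 := connection_eqr cn ZZ (sp _ sX) sZ pu.
have E2 := lie_bracket_eq pu (fun v _ => erefl (q v (X v))) ZZ.
exact: (congr2 +%R E1 E2).
Qed.

Section Vranceanu.
Variables (G : @tensor2 R (n + n) (cotangent M)) (E : @Defs.distribution R (n + n) (cotangent M)).
Variables p q : endo.
Hypothesis cpq : complementary p q.
Hypothesis PE : forall X, vf_eq S (orth_proj G E X) (fun u => p u (X u)).
Hypothesis QE : forall X, vf_eq S (orth_proj G (orth_compl G E) X) (fun u => q u (X u)).

Let ep X : vf := fun u => p u (X u).
Let eq X : vf := fun u => q u (X u).

Lemma vranceanuE X Z u : smooth_vfield S X -> smooth_vfield S Z -> pts S u ->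
  vranceanu S G nabla E X Z u =
  p u (nabla (ep X) (ep Z) u) + q u (nabla (eq X) (eq Z) u) +
  (p u (lie_bracket S (eq X) (ep Z) u) + q u (lie_bracket S (ep X) (eq Z) u)).
Proof.
move=> sX sZ pu; rewrite /vranceanu /vf_add !(PE _ pu) !(QE _ pu).
have [_ sp _ _] := cpq; have [_ sq _ _] := complementary_sym cpq.
have sP Y : smooth_vfield S Y -> smooth_vfield S (orth_proj G E Y).
  by move=> sY; apply: smooth_vfield_eq (sp _ sY) => v pv; rewrite PE.
have sQ Y : smooth_vfield S Y -> smooth_vfield S (orth_proj G (orth_compl G E) Y).
  by move=> sY; apply: smooth_vfield_eq (sq _ sY) => v pv; rewrite QE.
have E1 := connection_eq cn (PE X) (PE Z) (sP _ sX) (sP _ sZ) pu.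
have E2 := connection_eq cn (QE X) (QE Z) (sQ _ sX) (sQ _ sZ) pu.
have E3 := lie_bracket_eq pu (QE X) (PE Z).
have E4 := lie_bracket_eq pu (PE X) (QE Z).
by rewrite E1 E2 E3 E4.
Qed.

(** The complementary part of [Z] vanishes, so two of the four terms drop out; the other two add up
    under [p]. *)
Lemma vranceanu_structural X Z u : smooth_vfield S X -> smooth_vfield S Z ->
  vf_eq S (ep Z) Z -> pts S u ->
  vranceanu S G nabla E X Z u = proj_connection p q X Z u.
Proof.
move=> sX sZ pZ pu; have [lp sp pq _] := cpq; have [lq sq _ _] := complementary_sym cpq.
have qZ : vf_eq S (eq Z) (fun=> 0).
  move=> v pv; rewrite /eq (complementaryE _ _ cpq).
  by have := pZ v pv; rewrite /ep => ->; rewrite subrr.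
rewrite (vranceanuE sX sZ pu).
have E1 := connection_eqr cn pZ (sp _ sX) (sp _ sZ) pu.
have E2 := etrans (connection_eqr cn qZ (sq _ sX) (sq _ sZ) pu)
  (connection0r cn (sq _ sX) pu).
have E3 := lie_bracket_eq pu (fun v _ => erefl (eq X v)) pZ.
have E4 := etrans (lie_bracket_eq pu (fun v _ => erefl (ep X v)) qZ)
  (lie_bracket0r pu (sp _ sX)).
rewrite [nabla (ep X) _ u]E1 [nabla (eq X) _ u]E2.
rewrite [lie_bracket S (eq X) _ u]E3 [lie_bracket S (ep X) _ u]E4.
by rewrite !(fibre_linear0 u lq) !addr0 /proj_connection fibre_linearD.
Qed.

Lemma vranceanu_transversal X Z u : smooth_vfield S X -> smooth_vfield S Z ->
  vf_eq S (eq Z) Z -> pts S u ->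
  vranceanu S G nabla E X Z u = proj_connection q p X Z u.
Proof.
move=> sX sZ qZ pu; have [lp sp pq _] := cpq; have [lq sq _ _] := complementary_sym cpq.
have pZ : vf_eq S (ep Z) (fun=> 0).
  move=> v pv; rewrite /ep (complementaryE _ _ (complementary_sym cpq)).
  by have := qZ v pv; rewrite /eq => ->; rewrite subrr.
rewrite (vranceanuE sX sZ pu).
have E1 := connection_eqr cn qZ (sq _ sX) (sq _ sZ) pu.
have E2 := etrans (connection_eqr cn pZ (sp _ sX) (sp _ sZ) pu)
  (connection0r cn (sp _ sX) pu).
have E3 := lie_bracket_eq pu (fun v _ => erefl (ep X v)) qZ.
have E4 := etrans (lie_bracket_eq pu (fun v _ => erefl (eq X v)) pZ)
  (lie_bracket0r pu (sq _ sX)).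
rewrite [nabla (ep X) _ u]E2 [nabla (eq X) _ u]E1.
rewrite [lie_bracket S (eq X) _ u]E4 [lie_bracket S (ep X) _ u]E3.
by rewrite !(fibre_linear0 u lp) !add0r /proj_connection fibre_linearD.
Qed.

End Vranceanu.

(** The connections of the theorem are written with [orth_proj]; the axioms are checked for explicit
    projections and transported here. Closure of sections under sums and multiples enters because
    the axioms evaluate the operator on them. *)
Lemma connection_on_eq (E : @Defs.distribution R (n + n) (cotangent M)) (D D' : vf -> vf -> vf) :
  (forall X Z, smooth_vfield S X -> section S E Z -> vf_eq S (D X Z) (D' X Z)) ->
  (forall Z W, section S E Z -> section S E W -> section S E (vf_add Z W)) ->
  (forall f Z, smooth_fun S f -> section S E Z -> section S E (vf_scale f Z)) ->
  connection_on S E D -> connection_on S E D'.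
Proof.
move=> DD Ea Es [hs hD hZ hDr hZr].
have fs X : smooth_vfield S X -> section S full_distr X by move/section_full.
have ss X : section S full_distr X -> smooth_vfield S X by move/section_full.
split.
- move=> X Z sX sZ; have [sD ED] := hs _ _ sX sZ; split.
    exact: smooth_vfield_eq (DD _ _ (ss _ sX) sZ) sD.
  by move=> u pu; rewrite -(DD _ _ (ss _ sX) sZ u pu); exact: ED.
- move=> X Y Z sX sY sZ u pu; rewrite /vf_add.
  rewrite -(DD _ _ (smooth_vf_add (ss _ sX) (ss _ sY)) sZ u pu).
  by rewrite -(DD _ _ (ss _ sX) sZ u pu) -(DD _ _ (ss _ sY) sZ u pu); exact: hD.
- move=> f X Z sf sX sZ u pu; rewrite /vf_scale.
  rewrite -(DD _ _ (smooth_vf_scale sf (ss _ sX)) sZ u pu).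
  by rewrite -(DD _ _ (ss _ sX) sZ u pu); exact: hZ.
- move=> X Z W sX sZ sW u pu; rewrite /vf_add.
  rewrite -(DD _ _ (ss _ sX) (Ea _ _ sZ sW) u pu).
  by rewrite -(DD _ _ (ss _ sX) sZ u pu) -(DD _ _ (ss _ sX) sW u pu); exact: hDr.
- move=> f X Z sf sX sZ u pu; rewrite /vf_add.
  rewrite -(DD _ _ (ss _ sX) (Es _ _ sf sZ) u pu) /vf_scale.
  by rewrite -(DD _ _ (ss _ sX) sZ u pu); exact: hZr.
Qed.

Lemma section_image_add p q (E : @Defs.distribution R (n + n) (cotangent M)) Z W :
  complementary p q -> (forall u x, pts S u -> E u x <-> p u x = x) ->
  section S E Z -> section S E W -> section S E (vf_add Z W).
Proof.
move=> [lp _ _ _] hE [sZ EZ] [sW EW]; split; first exact: (smooth_vf_add sZ sW).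
move=> u pu; apply/(hE u _ pu); rewrite /vf_add fibre_linearD//.
by rewrite ((hE u _ pu).1 (EZ u pu)) ((hE u _ pu).1 (EW u pu)).
Qed.

Lemma section_image_scale p q (E : @Defs.distribution R (n + n) (cotangent M)) f Z :
  complementary p q -> (forall u x, pts S u -> E u x <-> p u x = x) ->
  smooth_fun S f -> section S E Z -> section S E (vf_scale f Z).
Proof.
move=> [lp _ _ _] hE sf [sZ EZ]; split; first exact: (smooth_vf_scale sf sZ).
move=> u pu; apply/(hE u _ pu); rewrite /vf_scale fibre_linearZ//.
by rewrite ((hE u _ pu).1 (EZ u pu)).
Qed.

Lemma proj_connection_on_eq p q (E : @Defs.distribution R (n + n) (cotangent M))
    (D : vf -> vf -> vf) :
  complementary p q -> (forall u x, pts S u -> E u x <-> p u x = x) ->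
  (forall X Z, smooth_vfield S X -> section S E Z ->
    vf_eq S (proj_connection p q X Z) (D X Z)) ->
  connection_on S E D.
Proof.
move=> c hE DD; apply: connection_on_eq DD _ _ (proj_connectionP c hE).
  by move=> Z W; exact: section_image_add c hE.
by move=> f Z; exact: section_image_scale c hE.
Qed.

End ComplementaryProjections.

(** * The distributions of a Cartan space *)

Section CartanDistributions.
Context {R : realType} {n : nat}.
Variables (M : manifold R n) (K : cotangent M -> R) (hK : cartan_structure K).
Let S := slit_cotangent M.
Notation vf := (@vfield R (n + n) (cotangent M)).
Notation endo := (cotangent M -> 'rV[R]_(n + n) -> 'rV[R]_(n + n)).
Implicit Types (X Y Z W : vf) (u : cotangent M) (x y : 'rV[R]_(n + n)).

Definition hor_proj : endo := fun u => hpart K (chart_at S u) (coords_at S u).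
Definition vert_proj : endo := fun u => vpart K (chart_at S u) (coords_at S u).
Definition line_proj : endo := fun u => lpart K (chart_at S u) (coords_at S u).
Definition vert_perp_proj : endo := fun u x => vert_proj u x - line_proj u x.
Definition line_perp_proj : endo := fun u x => x - line_proj u x.

Section PartFields.
Variable part : chart S -> 'rV[R]_(n + n) -> 'rV[R]_(n + n) -> 'rV[R]_(n + n).
Hypothesis part_transition : forall (c d : chart (mfd_atlas M)) z v, slit_overlap c d z ->
  'D_(part c z v) (slit_transition c d) z =
  part d (slit_transition c d z) ('D_v (slit_transition c d) z).
Hypothesis part_smooth : forall (c : chart S) k (X : 'rV[R]_(n + n) -> 'rV[R]_(n + n)),
  class_C k (chart_codom c) X ->
  class_C k (chart_codom c) (fun z => part c z (X z)).

(** Compatibility with the derivative of every transition gives a map defined through preferred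
    charts the same expression in all charts; smoothness can then be read off from that
    expression. *)
Lemma local_rep_part (c : chart S) X z : chart_codom c z ->
  local_rep c (fun u => part (chart_at S u) (coords_at S u) (X u)) z =
  part c z (local_rep c X z).
Proof.
move=> cz; have oz := slit_overlap_coords_at (slit_codom_dom cz).
apply: etrans (part_transition _ oz) _.
by rewrite (slit_transition_coords_at cz).
Qed.

Lemma smooth_part : smooth_endo (fun u => part (chart_at S u) (coords_at S u)).
Proof.
move=> X sX c k; apply: class_C_eq (@open_slit_codom _ _ _ c) _ (part_smooth (sX c k)).
by move=> z cz; rewrite local_rep_part.
Qed.

End PartFields.

Lemma local_rep_hor (c : chart S) X z : chart_codom c z ->
  local_rep c (fun u => hor_proj u (X u)) z = hpart K c z (local_rep c X z).
Proof. exact: (local_rep_part (derive_transition_hpart hK)). Qed.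

Lemma local_rep_vert (c : chart S) X z : chart_codom c z ->
  local_rep c (fun u => vert_proj u (X u)) z = vpart K c z (local_rep c X z).
Proof. exact: (local_rep_part (derive_transition_vpart hK)). Qed.

Lemma local_rep_line (c : chart S) X z : chart_codom c z ->
  local_rep c (fun u => line_proj u (X u)) z = lpart K c z (local_rep c X z).
Proof. exact: (local_rep_part (derive_transition_lpart hK)). Qed.

Lemma smooth_vert_proj : smooth_endo vert_proj.
Proof. exact: (smooth_part (derive_transition_vpart hK) (class_C_vpart hK)). Qed.

Lemma smooth_line_proj : smooth_endo line_proj.
Proof. exact: (smooth_part (derive_transition_lpart hK) (class_C_lpart hK)). Qed.

Lemma line_proj_linear : fibre_linear line_proj.
Proof. by move=> u a x y; exact: lpart_linear. Qed.

Lemma vert_proj_linear : fibre_linear vert_proj.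
Proof. by move=> u a x y; exact: vpart_linear. Qed.

Lemma line_vert_proj u x : line_proj u (vert_proj u x) = line_proj u x.
Proof. exact: lpart_vpart. Qed.

Lemma vert_line_proj u x : vert_proj u (line_proj u x) = line_proj u x.
Proof. by rewrite /line_proj lpart_vert; exact: vpart_vert. Qed.

Lemma vert_proj_idem u x : vert_proj u (vert_proj u x) = vert_proj u x.
Proof. exact: vpart_vert. Qed.

Lemma line_proj_idem u x : pts S u -> line_proj u (line_proj u x) = line_proj u x.
Proof. by move=> pu; exact: (lpart_idem hK _ (slit_coords_at pu)). Qed.

Lemma complementary_vert : complementary vert_proj hor_proj.
Proof.
split; [exact: vert_proj_linear|exact: smooth_vert_proj| |].
  by move=> u x; rewrite addrC; exact: hpart_vpart.
by move=> u x _; exact: vert_proj_idem.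
Qed.

Lemma complementary_line : complementary line_proj line_perp_proj.
Proof.
split; [exact: line_proj_linear|exact: smooth_line_proj| |exact: line_proj_idem].
by move=> u x; rewrite /line_perp_proj addrC subrK.
Qed.

Lemma complementary_vert_perp :
  complementary vert_perp_proj (fun u x => x - vert_perp_proj u x).
Proof.
have lv := vert_proj_linear; have ll := line_proj_linear; split.
- move=> u a x y; rewrite /vert_perp_proj lv ll scalerBr opprD.
  exact: addrACA.
- by move=> X sX; exact: (smooth_vf_sub (smooth_vert_proj sX) (smooth_line_proj sX)).
- by move=> u x; rewrite addrC subrK.
- move=> u x pu; rewrite /vert_perp_proj (fibre_linearB _ _ _ lv) (fibre_linearB _ _ _ ll).
  by rewrite vert_proj_idem vert_line_proj line_vert_proj line_proj_idem// subrr subr0.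
Qed.

Lemma vert_proj_vert_perp u x : pts S u -> vert_perp_proj u x = x -> vert_proj u x = x.
Proof.
move=> pu E; rewrite -[in LHS]E /vert_perp_proj (fibre_linearB _ _ _ vert_proj_linear).
by rewrite vert_proj_idem vert_line_proj.
Qed.

Lemma line_proj_vert_perp u x : pts S u -> line_proj u (vert_perp_proj u x) = 0.
Proof.
move=> pu; rewrite /vert_perp_proj (fibre_linearB _ _ _ line_proj_linear).
by rewrite line_vert_proj line_proj_idem// subrr.
Qed.

(** In the induced chart the projection to M is [lsubmx], which is its own derivative. *)
Lemma verticalP u x : pts S u -> vertical u x <-> lsubmx x = 0.
Proof.
move=> pu; rewrite /vertical/=.
have cz := slit_coords_at pu; have oc := @open_slit_codom _ _ _ (chart_at S u).
have E z : chart_codom (chart_at S u) z ->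
    (chart_map (chart_at (mfd_atlas M) u.1) \o fst \o chart_inv (chart_at S u)) z = lsubmx z.
  by move=> /slit_codomP[/chart_codomK[_ <-] _].
have E1 := open_eq_derive x oc cz E; have E2 := derive_lsubmx_id (coords_at S u) x.
by split=> [v0|x0]; [rewrite -E2 -E1|rewrite E1 E2].
Qed.

Lemma vertical_imageP u x : pts S u -> vertical u x <-> vert_proj u x = x.
Proof.
move=> pu; split=> [/(verticalP _ pu) x0|<-].
  by rewrite -(hsubmxK x) x0; exact: vpart_vert.
by apply/(verticalP _ pu); rewrite /vert_proj /vpart row_mxKl.
Qed.

Lemma horizontal_imageP u x : pts S u -> horizontal K u x <-> hor_proj u x = x.
Proof.
move=> pu.
have E (a : 'I_n -> R) : \sum_i a i *: delta_x K (chart_at S u) (coords_at S u) i =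
   row_mx (\row_i a i) ((\row_i a i) *m N_conn K (chart_at S u) (coords_at S u)).
  have -> : \row_i a i = \sum_i a i *: delta_mx 0 i :> 'rV[R]_n.
    by rewrite [LHS]row_sum_delta; apply: eq_bigr => i _; rewrite mxE.
  rewrite mulmx_suml; elim/big_rec3 : _ => [|i v w s _ ->]; first by rewrite row_mx0.
  by rewrite /delta_x scale_row_mx add_row_mx -scalemxAl -rowE.
split=> [[a ->]|<-].
  by rewrite E /hor_proj /hpart row_mxKl.
exists (fun i => lsubmx x 0 i); rewrite E /hor_proj /hpart.
suff -> : \row_i lsubmx x 0 i = lsubmx x by [].
by apply/rowP => i; rewrite mxE.
Qed.

Lemma liouvilleE u : liouville u = radial (coords_at S u).
Proof. by rewrite /liouville /radial rsubmx_coords_at. Qed.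

Lemma liouville_line_imageP u x : pts S u -> liouville_line u x <-> line_proj u x = x.
Proof.
move=> pu; split=> [[a ->]|<-].
  by rewrite liouvilleE; exact: (lpart_radial hK _ (slit_coords_at pu)).
by exists (radial_coef K (chart_at S u) (coords_at S u) x); rewrite liouvilleE.
Qed.

Lemma cartan_metric_line u x y : pts S u ->
  line_proj u x = 0 -> cartan_metric K u x (line_proj u y) = 0.
Proof.
move=> pu; have cz := slit_coords_at pu => x0.
have : radial_coef K (chart_at S u) (coords_at S u) x = 0.
  (* [radial_coef] recovers the coefficient of a multiple of C^*; applied to [line_proj u x] and to
     the zero multiple, it shows that the coefficient of [x] is zero. *)
  have E1 : radial_coef K (chart_at S u) (coords_at S u) (line_proj u x) =
    radial_coef K (chart_at S u) (coords_at S u) x by exact: (radial_coef_radial hK _ cz).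
  rewrite -E1 x0 -(scale0r (radial (coords_at S u))).
  exact: (radial_coef_radial hK _ cz).
rewrite /radial_coef => /eqP; rewrite mulf_eq0 invr_eq0 (negbTE (radial_sq_neq0 hK cz)) orbF.
move=> /eqP E.
rewrite /cartan_metric G_locE /line_proj lpart_vert row_mxKl trmx0 mulmx0 add0r.
by rewrite delta_pv_vert linearZ/= -scalemxAr mxE E mulr0.
Qed.

Lemma liouville_perp_imageP u x : pts S u ->
  liouville_perp K u x <-> line_perp_proj u x = x.
Proof.
move=> pu; have cz := slit_coords_at pu.
have ->  : line_perp_proj u x = x <-> line_proj u x = 0.
  rewrite /line_perp_proj; split=> [/eqP|->]; last by rewrite subr0.
  by rewrite subr_eq addrC -subr_eq subrr => /eqP.
split=> [h|x0 e /(liouville_line_imageP _ pu) <-]; last exact: cartan_metric_line.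
have /h : liouville_line u (liouville u) by exists 1; rewrite scale1r.
rewrite liouvilleE /cartan_metric G_locE row_mxKl trmx0 mulmx0 add0r delta_pv_vert.
by move=> E; rewrite /line_proj /lpart /radial_coef E mul0r scale0r.
Qed.

Lemma vertical_perp_imageP u x : pts S u ->
  vertical_perp K u x <-> vert_perp_proj u x = x.
Proof.
move=> pu; split=> [[/(vertical_imageP _ pu) v /(liouville_perp_imageP _ pu) l]|E].
  by rewrite /vert_perp_proj v; exact: l.
split; first by apply/(vertical_imageP _ pu); exact: vert_proj_vert_perp.
apply/(liouville_perp_imageP _ pu); rewrite /line_perp_proj -{2}E line_proj_vert_perp//.
by rewrite subr0.
Qed.

Section OrthogonalProjections.
Variables (p q : endo) (E : @Defs.distribution R (n + n) (cotangent M)).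
Hypothesis cpq : complementary p q.
Hypothesis imE : forall u x, pts S u -> E u x <-> p u x = x.
Hypothesis ortho : forall u x y, pts S u -> cartan_metric K u (q u x) (p u y) = 0.
Notation G := (cartan_metric K).

Let GB u x y z : G u (x - y) z = G u x z - G u y z.
Proof. exact: G_locB. Qed.

Let G0 u x : pts S u -> G u x x = 0 -> x = 0.
Proof. by move=> pu; exact: (G_loc_eq0 hK (slit_coords_at pu)). Qed.

(** For a second candidate [w'], the difference of [w'] and [w] lies in [F] and is orthogonal to
    [F], hence to itself, so it is zero by definiteness. *)
Let xget_proj u (F : set 'rV[R]_(n + n)) x w : pts S u ->
  (forall y z, F y -> F z -> F (y - z)) -> F w ->
  (forall e, F e -> G u (x - w) e = 0) ->
  xget 0 [set w | F w /\ forall e, F e -> G u (x - w) e = 0] = w.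
Proof.
move=> pu FB Fw ow; apply: xget_unique => // w' [Fw' ow'].
apply/eqP; rewrite -subr_eq0; apply/eqP; apply: (G0 pu).
have -> : G u (w' - w) (w' - w) = G u ((x - w) - (x - w')) (w' - w).
  by congr (G u _ _); rewrite [in RHS]opprB [RHS]addrC addrA subrK.
by rewrite GB ow ?ow' ?subrr//; exact: FB.
Qed.

Lemma orth_proj_image X : vf_eq S (orth_proj G E X) (fun u => p u (X u)).
Proof.
move=> u pu; have [lp _ _ pp] := cpq; apply: xget_proj => //.
- move=> y z /(imE _ pu) Ey /(imE _ pu) Ez; apply/(imE _ pu).
  by rewrite fibre_linearB// Ey Ez.
- by apply/(imE _ pu); exact: pp.
- move=> e /(imE _ pu) <-; rewrite -(complementaryE _ _ cpq); exact: ortho.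
Qed.

Lemma orth_proj_compl_image X :
  vf_eq S (orth_proj G (orth_compl G E) X) (fun u => q u (X u)).
Proof.
move=> u pu; have [lp _ _ pp] := cpq; apply: xget_proj => //.
- by move=> y z Ey Ez e Ee; rewrite GB Ey ?Ez ?subrr.
- by move=> e /(imE _ pu) <-; exact: ortho.
- move=> e oe; rewrite (complementaryE _ _ cpq) subKr.
  rewrite /cartan_metric (G_loc_sym hK _ _ (slit_coords_at pu)).
  by apply: oe; apply/(imE _ pu); exact: pp.
Qed.

End OrthogonalProjections.

Lemma metric_hor_vert u x y : cartan_metric K u (hor_proj u x) (vert_proj u y) = 0.
Proof.
rewrite /cartan_metric G_locE delta_pv_hpart row_mxKl [lsubmx (vert_proj _ _)]row_mxKl.
by rewrite trmx0 mulmx0 !mul0mx add0r mxE.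
Qed.

Lemma metric_vert_hor u x y : pts S u ->
  cartan_metric K u (vert_proj u x) (hor_proj u y) = 0.
Proof.
move=> pu; rewrite /cartan_metric (G_loc_sym hK _ _ (slit_coords_at pu)).
exact: metric_hor_vert.
Qed.

Lemma metric_line_perp u x y : pts S u ->
  cartan_metric K u (line_proj u x) (line_perp_proj u y) = 0.
Proof.
move=> pu; rewrite /cartan_metric (G_loc_sym hK _ _ (slit_coords_at pu)).
apply: (cartan_metric_line _ pu).
rewrite /line_perp_proj (fibre_linearB _ _ _ line_proj_linear) line_proj_idem//.
by rewrite subrr.
Qed.

Lemma metric_vert_perp u x y : pts S u ->
  cartan_metric K u (x - vert_perp_proj u x) (vert_perp_proj u y) = 0.
Proof.
move=> pu; have cz := slit_coords_at pu.
(* The complement of V_{C^*} is H plus the line of C^*; the sum is written as a difference to suit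
   [G_locB]. *)
have E : x - vert_perp_proj u x = hor_proj u x - (0 - line_proj u x).
  rewrite -[x in X in X - _](hpart_vpart K (chart_at S u) (coords_at S u) x).
  by rewrite /vert_perp_proj sub0r opprK opprB addrACA subrr addr0.
have Ev : vert_proj u (vert_perp_proj u y) = vert_perp_proj u y.
  have [_ _ _ pp] := complementary_vert_perp.
  exact: (vert_proj_vert_perp pu (pp _ _ pu)).
rewrite E /cartan_metric !G_locB -!/(cartan_metric K u _ _).
rewrite -[in X in X - _]Ev metric_hor_vert.
have -> : cartan_metric K u 0 (vert_perp_proj u y) = 0.
  by rewrite -(subrr (0 : 'rV[R]_(n + n))) /cartan_metric G_locB subrr.
rewrite /cartan_metric (G_loc_sym hK (line_proj u x) _ cz) -!/(cartan_metric K u _ _).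
by rewrite (cartan_metric_line _ pu) ?line_proj_vert_perp// !subr0.
Qed.

End CartanDistributions.

(** * Brackets of vertical, radial and horizontal fields *)

Section CartanBrackets.
Context {R : realType} {n : nat}.
Variables (M : manifold R n) (K : cotangent M -> R) (hK : cartan_structure K).
Let S := slit_cotangent M.
Notation vf := (@vfield R (n + n) (cotangent M)).
Implicit Types (X Y Z W : vf).
Variables (u : cotangent M) (pu : pts S u).
Let c := chart_at S u.
Let z := coords_at S u.
Let cz : chart_codom c z := slit_coords_at pu.
Let oc := @open_slit_codom _ _ _ c.

(** Vertical fields have zero base components on the whole chart, and so have their derivatives: V
    is integrable. *)
Lemma hor_proj_bracket_vert X W : smooth_vfield S X -> smooth_vfield S W ->
  vf_eq S (fun v => vert_proj K v (X v)) X -> vf_eq S (fun v => vert_proj K v (W v)) W ->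
  hor_proj K u (lie_bracket S X W u) = 0.
Proof.
move=> sX sW vX vW.
have D0 Y (v : 'rV[R]_(n + n)) : smooth_vfield S Y -> vf_eq S (fun v => vert_proj K v (Y v)) Y ->
    lsubmx ('D_v (local_rep c Y) z) = 0.
  move=> sY vY; have dY := local_rep_diff sY cz.
  have E y : chart_codom c y -> lsubmx (local_rep c Y y) = 0.
    move=> cy; rewrite -(local_rep_eq vY cy) (local_rep_vert hK _ cy).
    by rewrite /vpart row_mxKl.
  have E1 := open_eq_derive v oc cz E; have E2 := derive_lsubmx v dY.
  by apply: etrans (esym E2) _; apply: etrans E1 _; exact: derive_cst.
have l0 : lsubmx (lie_bracket S X W u) = 0.
  have lB (x y : 'rV[R]_(n + n)) : lsubmx (x - y) = lsubmx x - lsubmx y by rewrite linearB.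
  apply: etrans (lB _ _) _.
  apply: etrans (congr2 (fun x y => x - y) (D0 W (X u) sW vW) (D0 X (W u) sX vX)) _.
  exact: subrr.
by rewrite /hor_proj /hpart l0 mul0mx row_mx0.
Qed.

Let line_rep X y : smooth_vfield S X -> vf_eq S (fun v => line_proj K v (X v)) X ->
  chart_codom c y ->
  local_rep c X y = radial_coef K c y (local_rep c X y) *: radial y.
Proof.
move=> sX lX cy; rewrite -[in LHS](local_rep_eq lX cy).
exact: (local_rep_line hK _ cy).
Qed.

Let coef_diff X : smooth_vfield S X ->
  differentiable (fun y => radial_coef K c y (local_rep c X y)) z.
Proof.
by move=> sX; apply: class_C_diff cz => k; exact: (class_C_radial_coef hK (sX c k)).
Qed.

Let radial_diff : differentiable (@radial R n) z.
Proof.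
apply: differentiable_row_mx; first exact: differentiable_cst.
exact: differentiable_rsubmx.
Qed.

Let derive_radial_field (v : 'rV[R]_(n + n)) : 'D_v (@radial R n) z = row_mx 0 (rsubmx v).
Proof.
have dc : differentiable (fun _ : 'rV[R]_(n + n) => 0 : 'rV[R]_n) z.
  exact: differentiable_cst.
have dr := @differentiable_rsubmx R 1 n n z.
apply: etrans (derive_row_mx v dc dr) _.
by rewrite derive_cst derive_rsubmx_id.
Qed.

(** Product rule for a multiple of C^*, whose momentum components are linear: besides a multiple of
    C^* only the momentum part of the direction appears. *)
Let derive_line X (v : 'rV[R]_(n + n)) : smooth_vfield S X ->
  vf_eq S (fun v => line_proj K v (X v)) X ->
  exists t, 'D_v (local_rep c X) z =
    t *: radial z + radial_coef K c z (X u) *: row_mx 0 (rsubmx v).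
Proof.
move=> sX lX; have dr := coef_diff sX.
have E1 := open_eq_derive v oc cz (fun y => line_rep sX lX).
have E2 := derive_scale v dr radial_diff.
exists ('D_v (fun y => radial_coef K c y (local_rep c X y)) z).
apply: etrans E1 _; apply: etrans E2 _; apply: congr1.
rewrite derive_radial_field; congr (radial_coef K c z _ *: _).
exact: local_rep_at.
Qed.

Let line_at X : smooth_vfield S X -> vf_eq S (fun v => line_proj K v (X v)) X ->
  X u = radial_coef K c z (X u) *: radial z.
Proof. by move=> sX lX; rewrite -[in LHS](lX _ pu). Qed.

Lemma bracket_line X W : smooth_vfield S X -> smooth_vfield S W ->
  vf_eq S (fun v => line_proj K v (X v)) X -> vf_eq S (fun v => line_proj K v (W v)) W ->
  exists t, lie_bracket S X W u = t *: radial z.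
Proof.
move=> sX sW lX lW.
have [s E1] := derive_line (X u) sW lW; have [t E2] := derive_line (W u) sX lX.
have r Y : smooth_vfield S Y -> vf_eq S (fun v => line_proj K v (Y v)) Y ->
    row_mx 0 (rsubmx (Y u)) = radial_coef K c z (Y u) *: radial z.
  move=> sY lY; rewrite [in LHS](line_at sY lY) scale_row_mx row_mxKr.
  by rewrite scaler0.
have E1' := etrans E1 (congr1 (fun v => s *: radial z + radial_coef K c z (W u) *: v) (r X sX lX)).
have E2' := etrans E2 (congr1 (fun v => t *: radial z + radial_coef K c z (X u) *: v) (r W sW lW)).
exists (s - t); apply: etrans (congr2 (fun x y => x - y) E1' E2') _.
(* The product of the two coefficients occurs in both halves of the bracket and cancels; only
   derivatives of the coefficients survive. *)
rewrite !scalerA [radial_coef K c z (W u) * _]mulrC opprD addrACA subrr addr0.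
by rewrite -scalerBl.
Qed.

Lemma vert_perp_proj_radial t : vert_perp_proj K u (t *: radial z) = 0.
Proof.
rewrite /vert_perp_proj; have -> : vert_proj K u (t *: radial z) = t *: radial z.
  by rewrite scale_row_mx scaler0; exact: vpart_vert.
by rewrite /line_proj (lpart_radial hK _ cz) subrr.
Qed.

Lemma vert_perp_proj_hor x : vert_perp_proj K u (hor_proj K u x) = 0.
Proof.
rewrite /vert_perp_proj /vert_proj /line_proj lpart_hpart subr0.
by rewrite /vpart delta_pv_hpart row_mx0.
Qed.

Lemma vert_perp_proj_bracket_line X W : smooth_vfield S X -> smooth_vfield S W ->
  vf_eq S (fun v => line_proj K v (X v)) X -> vf_eq S (fun v => line_proj K v (W v)) W ->
  vert_perp_proj K u (lie_bracket S X W u) = 0.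
Proof.
by move=> sX sW lX lW; have [t ->] := bracket_line sX sW lX lW; exact: vert_perp_proj_radial.
Qed.

(* [C^*, delta / delta x^i] = (C^* N_ij - N_ij) d / d p_j = 0 as N is homogeneous of degree 1. *)
Lemma vert_perp_proj_bracket_line_hor X Y : smooth_vfield S X -> smooth_vfield S Y ->
  vf_eq S (fun v => line_proj K v (X v)) X -> vf_eq S (fun v => hor_proj K v (Y v)) Y ->
  vert_perp_proj K u (lie_bracket S X Y u) = 0.
Proof.
move=> sX sY lX hY; have dY := local_rep_diff sY cz.
pose b := radial_coef K c z (X u).
have XE : X u = b *: radial z by exact: line_at.
have dN := N_conn_diff hK cz.
have E y : chart_codom c y -> local_rep c Y y =
    row_mx (lsubmx (local_rep c Y y)) (lsubmx (local_rep c Y y) *m N_conn K c y).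
  by move=> cy; rewrite -[in LHS](local_rep_eq hY cy); exact: (local_rep_hor hK _ cy).
have dl : differentiable (fun y => lsubmx (local_rep c Y y)) z.
  exact: (differentiable_comp dY (@differentiable_lsubmx _ _ _ _ _)).
(* The derivative of (a, a N) is horizontal up to a times the derivative of N, which Euler's
   relation turns into b a N; the other half of the bracket produces the same term. *)
have E1 : 'D_(X u) (local_rep c Y) z =
    hpart K c z ('D_(X u) (local_rep c Y) z) +
    row_mx 0 (b *: (lsubmx (Y u) *m N_conn K c z)).
  have e1 := open_eq_derive (X u) oc cz E.
  have e2 := derive_row_mx (X u) dl (differentiable_mulmx dl dN).
  have e3 := derive_mulmx (X u) dl dN.
  have e4 := derive_lsubmx (X u) dY.
  have e5 : 'D_(X u) (N_conn K c) z = b *: N_conn K c z.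
    rewrite XE; apply: etrans (deriveZv _ _ dN) _.
    by rewrite (derive_radial_N_conn hK cz).
  apply: etrans e1 _; apply: etrans e2 _.
  apply: etrans (congr1 (row_mx _) e3) _; rewrite e4 e5.
  have -> : local_rep c Y z = Y u by exact: local_rep_at.
  by rewrite /hpart add_row_mx addr0 -scalemxAr.
have [t E2] := derive_line (Y u) sX lX.
have YE : rsubmx (Y u) = lsubmx (Y u) *m N_conn K c z.
  by rewrite -[in LHS](hY _ pu) /hor_proj row_mxKr.
have b_row (w : 'rV[R]_n) : b *: row_mx 0 w = row_mx 0 (b *: w) :> 'rV[R]_(n + n).
  by rewrite scale_row_mx scaler0.
have E2' := etrans E2 (congr1 (fun w => t *: radial z + b *: row_mx 0 w) YE).
rewrite b_row in E2'.
have -> : lie_bracket S X Y u = hor_proj K u ('D_(X u) (local_rep c Y) z) - t *: radial z.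
  apply: etrans (congr2 (fun x y => x - y) E1 E2') _.
  by rewrite opprD addrACA subrr addr0.
have [lp _ _ _] := complementary_vert_perp hK.
by rewrite (fibre_linearB _ _ _ lp) vert_perp_proj_hor vert_perp_proj_radial subrr.
Qed.

End CartanBrackets.

(** * The adapted triple of basic connections *)

Section AdaptedTriple.
#[local] Opaque smooth_vfield lie_bracket vact orth_proj.
Context {R : realType} {n : nat}.
Variables (M : manifold R n) (K : cotangent M -> R) (hK : cartan_structure K).
Let S := slit_cotangent M.
Notation vf := (@vfield R (n + n) (cotangent M)).
Notation G := (cartan_metric K).
Notation h := (hor_proj K).
Notation v := (vert_proj K).
Notation l := (line_proj K).
Notation w := (vert_perp_proj K).
Notation t := (line_perp_proj K).
Implicit Types (X Y Z W : vf).
Variable nabla : vf -> vf -> vf.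
Hypothesis cn : connection_on S full_distr nabla.
Hypothesis torsion : forall X Y, section S full_distr X -> section S full_distr Y ->
  forall u, pts S u -> nabla X Y u - nabla Y X u = lie_bracket S X Y u.

Let cv := complementary_vert hK.
Let ch := complementary_sym (complementary_vert hK).
Let ct := complementary_sym (complementary_line hK).
Let cw := complementary_vert_perp hK.

Let Dh := proj_connection nabla h v.
Let Dw := proj_connection nabla w (fun u x => x - w u x).

Let orth_vert X : vf_eq S (orth_proj G (@vertical _ _ M) X) (fun u => v u (X u)).
Proof.
exact: (orth_proj_image hK cv (@vertical_imageP _ _ M K)
  (fun u x y _ => metric_hor_vert K u x y)).
Qed.

Let orth_compl_vert X :
  vf_eq S (orth_proj G (orth_compl G (@vertical _ _ M)) X) (fun u => h u (X u)).
Proof.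
exact: (orth_proj_compl_image hK cv (@vertical_imageP _ _ M K)
  (fun u x y _ => metric_hor_vert K u x y)).
Qed.

Let orth_hor X : vf_eq S (orth_proj G (horizontal K) X) (fun u => h u (X u)).
Proof.
exact: (orth_proj_image hK ch (@horizontal_imageP _ _ M K) (metric_vert_hor hK)).
Qed.

Let orth_perp X : vf_eq S (orth_proj G (liouville_perp K) X) (fun u => t u (X u)).
Proof.
exact: (orth_proj_image hK ct (liouville_perp_imageP hK) (metric_line_perp hK)).
Qed.

Let orth_vert_perp X : vf_eq S (orth_proj G (vertical_perp K) X) (fun u => w u (X u)).
Proof.
exact: (orth_proj_image hK cw (vertical_perp_imageP hK) (metric_vert_perp hK)).
Qed.

Let orth_compl_vert_perp X :
  vf_eq S (orth_proj G (orth_compl G (vertical_perp K)) X) (fun u => X u - w u (X u)).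
Proof.
exact: (orth_proj_compl_image hK cw (vertical_perp_imageP hK) (metric_vert_perp hK)).
Qed.

Lemma vranceanu_horE X Z : smooth_vfield S X -> smooth_vfield S Z ->
  vf_eq S (fun u => h u (Z u)) Z -> vf_eq S (Dh X Z) (vranceanu_hor K nabla X Z).
Proof.
move=> sX sZ hZ u pu.
exact: (esym (vranceanu_transversal cn cv orth_vert orth_compl_vert sX sZ hZ pu)).
Qed.

Lemma vranceanu_vertE X Z : smooth_vfield S X -> smooth_vfield S Z ->
  vf_eq S (fun u => w u (Z u)) Z -> vf_eq S (Dw X Z) (vranceanu_vert K nabla X Z).
Proof.
move=> sX sZ wZ u pu.
exact: (esym (vranceanu_structural cn cw orth_vert_perp orth_compl_vert_perp sX sZ wZ pu)).
Qed.

Let smooth_h X : smooth_vfield S X -> smooth_vfield S (fun u => h u (X u)).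
Proof. have [_ sp _ _] := ch; exact: (sp X). Qed.

Let smooth_w X : smooth_vfield S X -> smooth_vfield S (fun u => w u (X u)).
Proof. have [_ sp _ _] := cw; exact: (sp X). Qed.

Let hh X : vf_eq S (fun u => h u (h u (X u))) (fun u => h u (X u)).
Proof. by move=> u pu; have [_ _ _ pp] := ch; exact: pp. Qed.

Let ww X : vf_eq S (fun u => w u (w u (X u))) (fun u => w u (X u)).
Proof. by move=> u pu; have [_ _ _ pp] := cw; exact: pp. Qed.

Let hor_vert_perp u x : h u x + w u x = t u x.
Proof.
have := hpart_vpart K (chart_at S u) (coords_at S u) x => E.
by rewrite /vert_perp_proj addrA; congr (_ - _); exact: E.
Qed.

(** The projected fields inside [vranceanu_sum] are known to agree with [h Z] and [w Z] on the slit
    bundle, so they are exchanged under each connection by [proj_connection_eqr]. *)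
Lemma vranceanu_sumE X Z : smooth_vfield S X -> smooth_vfield S Z ->
  vf_eq S (vf_add (Dh X (fun u => h u (Z u))) (Dw X (fun u => w u (Z u))))
    (vranceanu_sum K nabla X Z).
Proof.
move=> sX sZ u pu.
have eh : vf_eq S (fun u => h u (Z u)) (orth_proj G (horizontal K) Z).
  by move=> y py; exact: (esym (orth_hor Z py)).
have ew : vf_eq S (fun u => w u (Z u)) (orth_proj G (vertical_perp K) Z).
  by move=> y py; exact: (esym (orth_vert_perp Z py)).
have sh := smooth_h sZ; have sw := smooth_w sZ.
have sh' := smooth_vfield_eq eh sh; have sw' := smooth_vfield_eq ew sw.
have fh : vf_eq S (fun u => h u (orth_proj G (horizontal K) Z u)) (orth_proj G (horizontal K) Z).
  move=> y py; apply: etrans (congr1 (h y) (esym (eh y py))) _.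
  exact: etrans (hh Z py) (eh y py).
have fw : vf_eq S (fun u => w u (orth_proj G (vertical_perp K) Z u))
    (orth_proj G (vertical_perp K) Z).
  move=> y py; apply: etrans (congr1 (w y) (esym (ew y py))) _.
  exact: etrans (ww Z py) (ew y py).
have E1 := etrans (proj_connection_eqr cn ch eh sX sh pu) (vranceanu_horE sX sh' fh pu).
have E2 := etrans (proj_connection_eqr cn cw ew sX sw pu) (vranceanu_vertE sX sw' fw pu).
exact: (congr2 (fun x y : 'rV[R]_(n + n) => x + y) E1 E2).
Qed.

Lemma connection_vranceanu_hor : connection_on S (horizontal K) (vranceanu_hor K nabla).
Proof.
apply: (proj_connection_on_eq cn torsion ch (@horizontal_imageP _ _ M K)) => X Z sX [sZ HZ].
have hZ : vf_eq S (fun u => h u (Z u)) Z.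
  by move=> u pu; apply/(horizontal_imageP _ _ pu); exact: HZ.
exact: (vranceanu_horE sX sZ hZ).
Qed.

Lemma connection_vranceanu_vert : connection_on S (vertical_perp K) (vranceanu_vert K nabla).
Proof.
apply: (proj_connection_on_eq cn torsion cw (vertical_perp_imageP hK)) => X Z sX [sZ VZ].
have wZ : vf_eq S (fun u => w u (Z u)) Z.
  by move=> u pu; apply/(vertical_perp_imageP hK _ pu); exact: VZ.
exact: (vranceanu_vertE sX sZ wZ).
Qed.

Let line_hor u x : l u (h u x) = 0.
Proof. exact: lpart_hpart. Qed.

(** Each component satisfies the axioms on its own bundle, and [h] and [w] commute with sums and
    multiples. In the Leibniz rule the derivative terms give X(f) (h Z + w Z), which is X(f) Z
    because [t] fixes [Z]. *)
Lemma connection_sum : connection_on S (liouville_perp K)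
  (fun X Z => vf_add (Dh X (fun u => h u (Z u))) (Dw X (fun u => w u (Z u)))).
Proof.
have [hs hD hZ hDr hZr] := proj_connectionP cn torsion ch (@horizontal_imageP _ _ M K).
have [ws wD wZ wDr wZr] := proj_connectionP cn torsion cw (vertical_perp_imageP hK).
have [lh _ _ _] := ch; have [lw _ _ _] := cw.
have sh Z : smooth_vfield S Z -> section S (horizontal K) (fun u => h u (Z u)).
  move=> sZ; split; first exact: smooth_h.
  by move=> u pu; apply/(horizontal_imageP _ _ pu); exact: hh.
have sw Z : smooth_vfield S Z -> section S (vertical_perp K) (fun u => w u (Z u)).
  move=> sZ; split; first exact: smooth_w.
  by move=> u pu; apply/(vertical_perp_imageP hK _ pu); exact: ww.
split.
- move=> X Z sX [sZ _].
  have [sD1 E1] := hs _ _ sX (sh _ sZ); have [sD2 E2] := ws _ _ sX (sw _ sZ).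
  split; first exact: (smooth_vf_add sD1 sD2).
  move=> u pu; apply/(liouville_perp_imageP hK _ pu).
  have /(horizontal_imageP _ _ pu) e1 := E1 u pu.
  have /(vertical_perp_imageP hK _ pu) e2 := E2 u pu.
  set a := Dh X _; set b := Dw X _.
  have e : l u (a u + b u) = 0.
    apply: etrans (fibre_linearD u (a u) (b u) (line_proj_linear K)) _.
    have l1 : l u (a u) = 0 by apply: etrans (congr1 (l u) (esym e1)) _; exact: line_hor.
    have l2 : l u (b u) = 0.
      by apply: etrans (congr1 (l u) (esym e2)) _; exact: (line_proj_vert_perp hK _ pu).
    by rewrite l1 l2 addr0.
  exact: (etrans (congr1 (fun x => a u + b u - x) e) (subr0 _)).
- move=> X Y Z sX sY [sZ _] u pu.
  have E1 := hD _ _ _ sX sY (sh _ sZ) u pu; have E2 := wD _ _ _ sX sY (sw _ sZ) u pu.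
  apply: etrans (congr2 (fun x y : 'rV[R]_(n + n) => x + y) E1 E2) _; exact: addrACA.
- move=> f X Z sf sX [sZ _] u pu.
  have E1 := hZ _ _ _ sf sX (sh _ sZ) u pu; have E2 := wZ _ _ _ sf sX (sw _ sZ) u pu.
  apply: etrans (congr2 (fun x y : 'rV[R]_(n + n) => x + y) E1 E2) _.
  exact: (esym (scalerDr _ _ _)).
- move=> X Z W sX [sZ _] [sW _] u pu.
  have E1 := hDr _ _ _ sX (sh _ sZ) (sh _ sW) u pu.
  have E2 := wDr _ _ _ sX (sw _ sZ) (sw _ sW) u pu.
  have e1 : (fun u => h u (vf_add Z W u)) = vf_add (fun u => h u (Z u)) (fun u => h u (W u)).
    by apply/funext => y; exact: fibre_linearD.
  have e2 : (fun u => w u (vf_add Z W u)) = vf_add (fun u => w u (Z u)) (fun u => w u (W u)).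
    by apply/funext => y; exact: fibre_linearD.
  rewrite e1 e2; apply: etrans (congr2 (fun x y : 'rV[R]_(n + n) => x + y) E1 E2) _; exact: addrACA.
- move=> f X Z sf sX [sZ LZ] u pu.
  have E1 := hZr _ _ _ sf sX (sh _ sZ) u pu.
  have E2 := wZr _ _ _ sf sX (sw _ sZ) u pu.
  have e1 : (fun u => h u (vf_scale f Z u)) = vf_scale f (fun u => h u (Z u)).
    by apply/funext => y; exact: fibre_linearZ.
  have e2 : (fun u => w u (vf_scale f Z u)) = vf_scale f (fun u => w u (Z u)).
    by apply/funext => y; exact: fibre_linearZ.
  rewrite e1 e2; apply: etrans (congr2 (fun x y : 'rV[R]_(n + n) => x + y) E1 E2) _.
  rewrite /vf_add /vf_scale addrACA -!scalerDr hor_vert_perp.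
  by have /(liouville_perp_imageP hK _ pu) -> := LZ u pu.
Qed.

Lemma connection_vranceanu_sum : connection_on S (liouville_perp K) (vranceanu_sum K nabla).
Proof.
apply: connection_on_eq connection_sum.
- by move=> X Z sX [sZ _]; exact: (vranceanu_sumE sX sZ).
- by move=> Z W; exact: (section_image_add ct (liouville_perp_imageP hK)).
- by move=> f Z; exact: (section_image_scale ct (liouville_perp_imageP hK)).
Qed.

Lemma connection0l Y u : smooth_vfield S Y -> pts S u -> nabla (fun=> 0) Y u = 0.
Proof.
move=> sY pu; have [_ _ hZ _ _] := cn.
have -> : (fun=> 0) = vf_scale (fun=> 0 : R) (fun=> 0) :> vf.
  by apply/funext => y; rewrite /vf_scale scaler0.
have f0 := (section_full (fun=> 0)).2 (@smooth_vf0 R n M); have fY := (section_full Y).2 sY.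
by rewrite (hZ _ _ _ (smooth_fun_cst 0) f0 fY u pu) /vf_scale scale0r.
Qed.

Lemma proj_connection_bracket p q X Z u : complementary p q ->
  vf_eq S (fun u => p u (X u)) (fun=> 0) -> smooth_vfield S X -> smooth_vfield S Z ->
  pts S u -> proj_connection nabla p q X Z u = p u (lie_bracket S X Z u).
Proof.
move=> c pX sX sZ pu; have [_ sp _ _] := c.
have qX : vf_eq S (fun u => q u (X u)) X.
  move=> y py; rewrite (complementaryE _ _ c).
  by apply: etrans (congr1 (fun x => X y - x) (pX y py)) _; rewrite subr0.
have E1 := etrans (connection_eql cn pX (sp _ sX) sZ pu) (connection0l sZ pu).
have E2 := lie_bracket_eq pu qX (fun y _ => erefl (Z y)).
rewrite /proj_connection; apply: congr1.
apply: etrans (congr2 (fun x y : 'rV[R]_(n + n) => x + y) E1 E2) _.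
exact: add0r.
Qed.

Let line_image X : section S (@liouville_line _ _ M) X -> vf_eq S (fun u => l u (X u)) X.
Proof. by move=> [_ LX] u pu; apply/(liouville_line_imageP hK _ pu); exact: LX. Qed.

Let line_vert X : vf_eq S (fun u => l u (X u)) X -> vf_eq S (fun u => v u (X u)) X.
Proof.
move=> lX u pu; apply: etrans (congr1 (v u) (esym (lX u pu))) _.
by rewrite vert_line_proj; exact: lX.
Qed.

Let line_vert_perp X : vf_eq S (fun u => l u (X u)) X -> vf_eq S (fun u => w u (X u)) (fun=> 0).
Proof.
move=> lX u pu; rewrite /vert_perp_proj.
by apply: etrans (congr2 (fun x y => x - y) (line_vert lX pu) (lX u pu)) _; exact: subrr.
Qed.

Let vert_hor X : vf_eq S (fun u => v u (X u)) X -> vf_eq S (fun u => h u (X u)) (fun=> 0).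
Proof.
move=> vX u pu; rewrite (complementaryE _ _ cv).
by apply: etrans (congr1 (fun x => X u - x) (vX u pu)) _; exact: subrr.
Qed.

Let smooth_l X : smooth_vfield S X -> smooth_vfield S (fun u => l u (X u)).
Proof. exact: (smooth_line_proj hK). Qed.

Let smooth_v X : smooth_vfield S X -> smooth_vfield S (fun u => v u (X u)).
Proof. exact: (smooth_vert_proj hK). Qed.

Let vv X : vf_eq S (fun u => v u (v u (X u))) (fun u => v u (X u)).
Proof. by move=> u pu; exact: vert_proj_idem. Qed.

Let ll X : vf_eq S (fun u => l u (l u (X u))) (fun u => l u (X u)).
Proof. by move=> u pu; exact: (line_proj_idem hK _ pu). Qed.

Let lie_bracket_split X Y Y1 Y2 u : vf_eq S Y (vf_add Y1 Y2) ->
  smooth_vfield S X -> smooth_vfield S Y1 -> smooth_vfield S Y2 -> pts S u ->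
  lie_bracket S X Y u = lie_bracket S X Y1 u + lie_bracket S X Y2 u.
Proof.
move=> YE sX s1 s2 pu.
exact: etrans (lie_bracket_eq pu (fun y _ => erefl (X y)) YE) (lie_bracketDr pu sX s1 s2).
Qed.

Let fibre_linear_add0 (p : cotangent M -> 'rV[R]_(n + n) -> 'rV[R]_(n + n)) u x y :
  fibre_linear p -> p u y = 0 -> p u (x + y) = p u x.
Proof. by move=> lp y0; rewrite fibre_linearD// y0 addr0. Qed.

(** Used with [x], [y], [z] the brackets of [X] with [h Y], [w Y] and [l Yt]: [y] and [z] have no
    horizontal part by integrability of V, [x] has no part in V_{C^*} by Euler's relation, and [z]
    has none because the bracket of two multiples of C^* is again one. *)
Let perp_sum u x y z : h u y = 0 -> w u x = 0 -> h u z = 0 -> w u z = 0 ->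
  t u (x + y + z) = h u x + w u y.
Proof.
have [lh _ _ _] := ch; have [lw _ _ _] := cw; move=> hy wx hz wz.
rewrite -hor_vert_perp !(fibre_linearD _ _ _ lh) !(fibre_linearD _ _ _ lw).
by rewrite hy wx hz wz !addr0 add0r.
Qed.

Lemma basic_vranceanu_vert : basic_connection S G
  (@vertical _ _ M) (@liouville_line _ _ M) (vertical_perp K) (vranceanu_vert K nabla).
Proof.
split; first exact: connection_vranceanu_vert.
move=> X Y Yt LX [sY VY] [sYt VYt] PY u pu.
have [sX _] := LX; have lX := line_image LX.
have wY : vf_eq S (fun u => w u (Y u)) Y.
  by move=> y py; apply/(vertical_perp_imageP hK _ py); exact: VY.
have E1 := etrans (esym (vranceanu_vertE sX sY wY pu))
  (proj_connection_bracket cw (line_vert_perp lX) sX sY pu).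
apply: etrans E1 _; apply: etrans _ (esym (orth_vert_perp _ pu)).
have sW := smooth_l sYt.
have YtE : vf_eq S Yt (vf_add Y (fun u => l u (Yt u))).
  move=> y py; rewrite /vf_add -(PY y py) (orth_vert_perp Yt py) /vert_perp_proj subrK.
  by apply/esym/(vertical_imageP _ _ py); exact: VYt.
have B := lie_bracket_split YtE sX sY sW pu; have [lw _ _ _] := cw.
have B0 := vert_perp_proj_bracket_line hK pu sX sW lX (ll Yt).
have F := fibre_linear_add0 (lie_bracket S X Y u) lw B0.
by apply: esym; apply: etrans (congr1 (w u) B) _; exact: F.
Qed.

Lemma basic_vranceanu_hor : basic_connection S G
  full_distr (@vertical _ _ M) (horizontal K) (vranceanu_hor K nabla).
Proof.
split; first exact: connection_vranceanu_hor.
move=> X Y Yt [sX VX] [sY HY] [sYt _] PY u pu.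
have vX : vf_eq S (fun u => v u (X u)) X.
  by move=> y py; apply/(vertical_imageP _ _ py); exact: VX.
have hY : vf_eq S (fun u => h u (Y u)) Y.
  by move=> y py; apply/(horizontal_imageP _ _ py); exact: HY.
have E1 := etrans (esym (vranceanu_horE sX sY hY pu))
  (proj_connection_bracket ch (vert_hor vX) sX sY pu).
apply: etrans E1 _; apply: etrans _ (esym (orth_hor _ pu)).
have sW := smooth_v sYt.
have YtE : vf_eq S Yt (vf_add Y (fun u => v u (Yt u))).
  move=> y py; rewrite /vf_add -(PY y py) (orth_hor Yt py).
  by have [_ _ pq _] := ch; exact: (esym (pq y (Yt y))).
have B := lie_bracket_split YtE sX sY sW pu; have [lh _ _ _] := ch.
have B0 := hor_proj_bracket_vert hK pu sX sW vX (vv Yt).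
have F := fibre_linear_add0 (lie_bracket S X Y u) lh B0.
by apply: esym; apply: etrans (congr1 (h u) B) _; exact: F.
Qed.

Lemma basic_vranceanu_sum : basic_connection S G
  full_distr (@liouville_line _ _ M) (liouville_perp K) (vranceanu_sum K nabla).
Proof.
split; first exact: connection_vranceanu_sum.
move=> X Y Yt LX [sY PYY] [sYt _] PY u pu.
have [sX _] := LX; have lX := line_image LX; have vX := line_vert lX.
have sh := smooth_h sY; have sw := smooth_w sY; have sW := smooth_l sYt.
have E1 := proj_connection_bracket ch (vert_hor vX) sX sh pu.
have E2 := proj_connection_bracket cw (line_vert_perp lX) sX sw pu.
apply: etrans (esym (vranceanu_sumE sX sY pu)) _.
apply: etrans (congr2 (fun x y : 'rV[R]_(n + n) => x + y) E1 E2) _;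
    apply: etrans _ (esym (orth_perp _ pu)).
have YtE : vf_eq S Yt (vf_add Y (fun u => l u (Yt u))).
  move=> y py; rewrite /vf_add -(PY y py) (orth_perp Yt py).
  by rewrite /line_perp_proj subrK.
have YE : vf_eq S Y (vf_add (fun u => h u (Y u)) (fun u => w u (Y u))).
  move=> y py; rewrite /vf_add hor_vert_perp; apply/esym.
  by apply/(liouville_perp_imageP hK _ py); exact: PYY.
have B := lie_bracket_split YtE sX sY sW pu.
have B' := lie_bracket_split YE sX sh sw pu.
have vw : vf_eq S (fun u => v u (w u (Y u))) (fun u => w u (Y u)).
  by move=> y py; apply: (vert_proj_vert_perp py); exact: ww.
have H1 := hor_proj_bracket_vert hK pu sX sw vX vw.
have H2 := vert_perp_proj_bracket_line_hor hK pu sX sh lX (hh Y).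
have H3 := hor_proj_bracket_vert hK pu sX sW vX (line_vert (ll Yt)).
have H4 := vert_perp_proj_bracket_line hK pu sX sW lX (ll Yt).
apply: etrans (esym (perp_sum H1 H2 H3 H4)) _.
apply: congr1; apply: etrans (esym B).
exact: (congr1 (fun x => x + lie_bracket S X (fun u => l u (Yt u)) u) (esym B')).
Qed.

End AdaptedTriple.

Theorem proposition4p6 (R : realType) (n : nat) (M : manifold R n)
    (K : cotangent M -> R) (hK : cartan_structure K)
    (nabla : @vfield R (n + n) (cotangent M) -> @vfield R (n + n) (cotangent M) ->
             @vfield R (n + n) (cotangent M))
    (hnabla : levi_civita (slit_cotangent M) (cartan_metric K) nabla) :
  adapted_basic_triple K
    (vranceanu_vert K nabla) (vranceanu_hor K nabla) (vranceanu_sum K nabla).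
Proof.
have [cn torsion _] := hnabla; split.
- exact: basic_vranceanu_vert.
- exact: basic_vranceanu_hor.
- exact: basic_vranceanu_sum.
Qed.
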